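(* Consider a sequence of instances of the data model below indexed by $n\to\infty$ (with $d,\Sigma,w^*$ allowed to depend on $n$, $\sigma$ fixed), and let $\hat w$ be the minimal $\ell_2$ norm interpolator. Suppose there is a sequence of covariance splittings $\Sigma=\Sigma_1\oplus\Sigma_2$ with $\Sigma_2\neq0$ such that, with $H\sim N(0,I_d)$: (1) $\operatorname{rank}(\Sigma_1)/n\to0$; (2) $n/R(\Sigma_2)\to0$; (3) $\|w^*\|_2\,\mathbb{E}\|\Sigma_2^{1/2}H\|_2/\sqrt n\to0$. Then $L(\hat w)\to\sigma^2$ in probability.
   Context: Data model: $d \ge n$; $\Sigma \in \mathbb{R}^{d\times d}$ positive semidefinite; $w^* \in \mathbb{R}^d$ arbitrary; $\sigma\ge0$. $X \in \mathbb{R}^{n\times d}$ has i.i.d. rows $X_i\sim N(0,\Sigma)$, $\xi\sim N(0,\sigma^2I_n)$ independent of $X$, $Y=Xw^*+\xi$. $L(w)=\sigma^2+\|w-w^*\|_\Sigma^2$, $\|x\|_A^2:=\langle x,Ax\rangle$. $\hat w\in\arg\min\{\|w\|_2:Xw=Y\}$. Covariance splitting: $\Sigma=\Sigma_1\oplus\Sigma_2$ means $\Sigma=\Sigma_1+\Sigma_2$, both positive semidefinite, with orthogonal column spaces. $R(A)=\operatorname{Tr}(A)^2/\operatorname{Tr}(A^2)$. *)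

(* Defs.v *)
From HB Require Import structures.
From mathcomp Require Import all_boot all_order all_algebra.
From mathcomp Require Import all_classical all_reals all_analysis.

Set Implicit Arguments.
Unset Strict Implicit.
Unset Printing Implicit Defensive.

Import Order.TTheory GRing.Theory Num.Theory.
Import numFieldNormedType.Exports.

Local Open Scope classical_set_scope.
Local Open Scope ring_scope.

Section defs.
Context {R : realType}.

Definition norm2 {k : nat} (x : 'cV[R]_k) : R := Num.sqrt (\sum_i (x i 0) ^+ 2).

Definition qform {k : nat} (A : 'M[R]_k) (x : 'cV[R]_k) : R := (x^T *m A *m x) 0 0.

Definition psd {k : nat} (A : 'M[R]_k) : Prop :=
  A^T = A /\ forall x : 'cV[R]_k, 0 <= qform A x.

(* the positive semidefinite square root A^{1/2} (unique for A psd) *)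
Definition sqrtm {k : nat} (A : 'M[R]_k) : 'M[R]_k :=
  xget 0 [set S : 'M[R]_k | psd S /\ S *m S = A].

(* Covariance splitting Sigma = Sigma1 (+) Sigma2: Sigma = Sigma1 + Sigma2,
   both psd, with orthogonal column spaces (every column of Sigma1 is
   orthogonal to every column of Sigma2, i.e. Sigma1^T Sigma2 = 0). *)
Definition cov_split {k : nat} (S S1 S2 : 'M[R]_k) : Prop :=
  [/\ S = S1 + S2, psd S1, psd S2 & S1^T *m S2 = 0].

Definition effrank {k : nat} (A : 'M[R]_k) : R := (\tr A) ^+ 2 / \tr (A *m A).

Definition loss {k : nat} (sigma : R) (S : 'M[R]_k) (wstar w : 'cV[R]_k) : R :=
  sigma ^+ 2 + qform S (w - wstar).

(* minimal l2-norm interpolator: the element of argmin{||w||_2 : X w = Y}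
   (this argmin is a singleton whenever X w = Y is solvable; the value 0 is
   an arbitrary default when the argmin is empty). *)
Definition minnorm_interp {m k : nat} (X : 'M[R]_(m, k)) (Y : 'cV[R]_m) : 'cV[R]_k :=
  xget 0 [set w : 'cV[R]_k | X *m w = Y /\
                              forall v : 'cV[R]_k, X *m v = Y -> norm2 w <= norm2 v].

Context {dT : measure_display} {T : measurableType dT}.

Definition normal_law (P : probability T R) (Y : T -> R) (m v : R) : Prop :=
  (v = 0 /\ P [set w | Y w = m] = 1%E) \/
  (0 < v /\ forall B : set R, measurable B ->
              P (Y @^-1` B) = normal_prob m (Num.sqrt v) B).

Definition gaussian_vec (P : probability T R) {k : nat} (Z : 'I_k -> T -> R)
    (C : 'M[R]_k) : Prop :=
  forall t : 'cV[R]_k,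
    normal_law P (fun w => \sum_i t i 0 * Z i w) 0 (qform C t).

Definition gen_sigma {I : Type} (F : I -> T -> R) : set (set T) :=
  <<s [set A | exists i (B : set R), measurable B /\ A = F i @^-1` B] >>.

Definition indep_family (P : probability T R) {I : finType}
    (S : I -> set (set T)) : Prop :=
  forall A : I -> set T, (forall i, S i (A i)) ->
    P (\bigcap_(i in [set: I]) A i) = (\prod_(i : I) P (A i))%E.

Definition indep2 (P : probability T R) (S1 S2 : set (set T)) : Prop :=
  forall A B, S1 A -> S2 B -> P (A `&` B) = (P A * P B)%E.

End defs.

(* Main.v *)
(* Reveal the rows of X one at a time. The minimal-norm interpolator W_k of the
   first k rows changes by a rank-one correction along u_k = M_k x_k, where M_k
   projects away the previous rows; it is run on the responses [X w* | I], so
   that one deterministic recursion carries both the signal and the noise. Given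
   the past, the new row enters only through moments of order at most four.

   With b_k = |u_k|^2, t_k = tr(M_k Sigma), Q_k = tr(M_k Sigma M_k Sigma),
   tau = tr Sigma2, residual e_k and excess risk Phi_k:
   - the rank of M_k and n << R(Sigma2) give t_k >= (1 - o(1)) tau, and a
     leave-one-out argument over the first o(n) rows gives t_k <= (1 + o(1)) tau
     afterwards; as t_k decreases by about Q_k / t_k, sum Q_k = o(tau^2);
   - |W_k|^2 increases by |e_k|^2 / b_k, of conditional mean about
     (1 + Phi_k) / tau, while an explicit interpolator, built from leave-one-out
     projections, bounds |W_n|^2 by |w*|^2 + (1 + o(1)) n / tau; since
     |w*|^2 tau = o(n) by (3), some Phi_k must be small before time n;
   - from then on (1 + Phi_k) prod_(j < k) (1 + 72 Q_j / tau^2)^-1 is a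
     supermartingale while the b_j are of order tau, so Phi_n is still small;
   - averaging over the noise bounds the excess risk by a multiple of Phi_n. *)

Require Import Defs.
From HB Require Import structures.
From mathcomp Require Import all_boot all_order all_algebra.
From mathcomp Require Import all_classical all_reals all_analysis.
From mathcomp Require Import measurable_realfun ring lra.
From mathcomp Require mxpoly spectral sesquilinear complex.

Set Implicit Arguments.
Unset Strict Implicit.
Unset Printing Implicit Defensive.

Import Order.TTheory GRing.Theory Num.Theory.
Import numFieldNormedType.Exports.

Local Open Scope classical_set_scope.
Local Open Scope ring_scope.

(** * Frobenius norms and Gram-Schmidt projections *)

Section frobenius.
Context {R : realFieldType}.

(** The eigenvalues of [Sigma1] are unrestricted, so [t_0], the trace of [Sigma], may exceed [tau]
    by any factor. This is why an initial stretch of rows is sacrificed: it costs a negligible share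
    of the norm budget and removes the few directions of [Sigma1], after which the process behaves
    as if the covariance were [Sigma2]. The noise block is the identity whatever [sigma] is. Each
    residual therefore has a constant part of norm 1, smallness of [Phi_k] is measured against that
    fixed 1, and [sigma = 0] needs no separate treatment. Only four moments of a row are available
    and [Phi_k] may be huge on rare events. In the budget the squared residuals are therefore
    weighted by [min(1 + Phi_k, 1 + eps) / (1 + Phi_k)], which caps their conditional moments. In
    the last phase ordinary Markov would give a bound close to 1; since the process is also almost
    bounded below by 1, a mean close to 1 already forces it to be near 1 with high probability. All
    tolerances come from one parameter [u]: losses are of order [s = u^2 / 20], and the gain
    [u^2 = 20 s] has to beat them. *)

Definition fsq {m p} (A : 'M[R]_(m, p)) : R := \sum_i \sum_j A i j ^+ 2.

Lemma fsq_ge0 m p (A : 'M[R]_(m, p)) : 0 <= fsq A.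
Proof. by apply: sumr_ge0 => i _; apply: sumr_ge0 => j _; exact: sqr_ge0. Qed.
Lemma fsqE m p (A : 'M[R]_(m, p)) : fsq A = \tr (A^T *m A).
Proof.
rewrite /fsq exchange_big /mxtrace; apply: eq_bigr => j _; rewrite mxE.
by apply: eq_bigr => i _; rewrite mxE expr2.
Qed.
Lemma fsq_eq0 m p (A : 'M[R]_(m, p)) : (fsq A == 0) = (A == 0).
Proof.
apply/eqP/eqP => [A0|->]; last first.
  by apply: big1 => i _; apply: big1 => j _; rewrite mxE expr0n.
apply/matrixP => i j; rewrite mxE; apply/eqP; rewrite -sqrf_eq0.
have s0 k : 0 <= \sum_j A k j ^+ 2 by apply: sumr_ge0 => ? _; exact: sqr_ge0.
move: A0 => /eqP; rewrite psumr_eq0 // => /allP/(_ i).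
rewrite mem_index_enum => /(_ isT) /=; rewrite psumr_eq0; last by move=> ? _; exact: sqr_ge0.
by move=> /allP/(_ j); rewrite mem_index_enum => /(_ isT).
Qed.
Lemma fsq0 m p : fsq (0 : 'M[R]_(m, p)) = 0.
Proof. by apply/eqP; rewrite fsq_eq0. Qed.
Lemma fsq_tr m p (A : 'M[R]_(m, p)) : fsq A^T = fsq A.
Proof.
rewrite /fsq exchange_big; apply: eq_bigr => i _; apply: eq_bigr => j _.
by rewrite mxE.
Qed.
Lemma fsqZ m p c (A : 'M[R]_(m, p)) : fsq (c *: A) = c ^+ 2 * fsq A.
Proof.
rewrite /fsq mulr_sumr; apply: eq_bigr => i _; rewrite mulr_sumr.
by apply: eq_bigr => j _; rewrite mxE exprMn.
Qed.
Lemma fsqN m p (A : 'M[R]_(m, p)) : fsq (- A) = fsq A.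
Proof. by rewrite -scaleN1r fsqZ sqrrN expr1n mul1r. Qed.
Lemma fsqD m p (A B : 'M[R]_(m, p)) :
  fsq (A + B) = fsq A + 2 * \tr (A^T *m B) + fsq B.
Proof.
have h : \tr (B^T *m A) = \tr (A^T *m B) by rewrite -mxtrace_tr trmx_mul trmxK.
rewrite !fsqE (linearD trmx) mulmxDl !mulmxDr !linearD /= h; ring.
Qed.
Lemma fsq_col_sum m p (A : 'M[R]_(m, p)) : fsq A = \sum_j fsq (col j A).
Proof.
rewrite /fsq exchange_big; apply: eq_bigr => j _; apply: eq_bigr => i _.
by rewrite big_ord1 mxE.
Qed.
Lemma fsq_row_sum m p (A : 'M[R]_(m, p)) : fsq A = \sum_i fsq (row i A).
Proof.
by apply: eq_bigr => i _; rewrite /fsq big_ord1; apply: eq_bigr => j _; rewrite mxE.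
Qed.
Lemma fsq_row_mx m p q (A : 'M[R]_(m, p)) (B : 'M[R]_(m, q)) :
  fsq (row_mx A B) = fsq A + fsq B.
Proof.
rewrite /fsq -big_split; apply: eq_bigr => i _; rewrite big_split_ord /=.
by congr (_ + _); apply: eq_bigr => j _; rewrite ?row_mxEl ?row_mxEr.
Qed.
Lemma fsq_cV1 p (u : 'cV[R]_p) : u^T *m u = (fsq u)%:M.
Proof.
apply/matrixP => i j; rewrite !ord1 !mxE eqxx mulr1n /fsq.
by apply: eq_bigr => k _; rewrite big_ord1 mxE expr2.
Qed.
(* The discriminant of [c |-> fsq (A + c B) >= 0]. *)
Lemma tr_mul_sq_le m p (A B : 'M[R]_(m, p)) :
  \tr (A^T *m B) ^+ 2 <= fsq A * fsq B.
Proof.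
have [B0|Bn0] := eqVneq (fsq B) 0.
  move/eqP: B0; rewrite fsq_eq0 => /eqP ->.
  by rewrite mulmx0 mxtrace0 expr0n /= mulr_ge0 // fsq_ge0.
have Bp : 0 < fsq B by rewrite lt_def Bn0 fsq_ge0.
set t := \tr _.
have := fsq_ge0 (fsq B *: A - t *: B).
rewrite fsqD fsqN !fsqZ mulmxN [\tr (- _)]raddfN /= [(_ *: _)^T]linearZ /=.
rewrite -scalemxAl -scalemxAr !mxtraceZ -/t.
move=> h; rewrite -subr_ge0 -(pmulr_rge0 _ Bp); apply: le_trans h _.
by rewrite le_eqVlt; apply/orP; left; apply/eqP; ring.
Qed.
Lemma tr_mul_le m p (A B : 'M[R]_(m, p)) (c : R) : 0 < c ->
  2 * \tr (A^T *m B) <= c * fsq A + fsq B / c.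
Proof.
move=> c0; have cn0 : c != 0 by rewrite gt_eqF.
have := fsq_ge0 (c *: A - B); rewrite fsqD fsqN fsqZ mulmxN linearN /= [(_ *: _)^T]linearZ /=.
rewrite -scalemxAl mxtraceZ /= => h.
have -> : c * fsq A + fsq B / c = (c ^+ 2 * fsq A + fsq B) / c by field.
by rewrite ler_pdivlMr //; lra.
Qed.
Lemma fsqD_le m p (A B : 'M[R]_(m, p)) : fsq (A + B) <= 2 * fsq A + 2 * fsq B.
Proof.
have := @tr_mul_le _ _ A B 1 ltr01; rewrite fsqD divr1 mul1r; lra.
Qed.
Lemma fsqM_le m p q (A : 'M[R]_(m, p)) (B : 'M[R]_(p, q)) :
  fsq (A *m B) <= fsq A * fsq B.
Proof.
rewrite {1}/fsq (fsq_row_sum A) mulr_suml; apply: ler_sum => i _.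
rewrite (fsq_col_sum B) mulr_sumr; apply: ler_sum => j _.
have -> : (A *m B) i j = \tr ((row i A)^T^T *m col j B).
  rewrite trmxK [RHS]big_ord1 !mxE; apply: eq_bigr => k _; rewrite !mxE //.
by apply: le_trans (tr_mul_sq_le _ _) _; rewrite fsq_tr.
Qed.
Lemma fsq_projM m p (N : 'M[R]_m) (A : 'M[R]_(m, p)) :
  N^T = N -> N *m N = N -> fsq A = fsq (N *m A) + fsq ((1%:M - N) *m A).
Proof.
move=> sN iN; rewrite -{1}(subrK (N *m A) A) -{1}(mul1mx A) -mulmxBl addrC fsqD.
rewrite trmx_mul sN -mulmxA (mulmxA N) mulmxBr mulmx1 iN subrr mul0mx mulmx0.
by rewrite mxtrace0; ring.
Qed.
Lemma fsq_proj_le m p (N : 'M[R]_m) (A : 'M[R]_(m, p)) :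
  N^T = N -> N *m N = N -> fsq (N *m A) <= fsq A.
Proof. by move=> sN iN; rewrite (fsq_projM A sN iN) lerDl fsq_ge0. Qed.
Lemma tr_proj m (N : 'M[R]_m) : N^T = N -> N *m N = N -> \tr N = fsq N.
Proof. by move=> sN iN; rewrite fsqE sN iN. Qed.
End frobenius.
Section projections.
Context {R : realFieldType} {p : nat}.
Implicit Types (M : 'M[R]_p) (x v : 'cV[R]_p) (l : seq 'cV[R]_p).
(* One Gram-Schmidt step; when [M x = 0], the convention [0^-1 = 0] leaves [M]
   unchanged. *)
Definition pupd x M : 'M[R]_p :=
  M - (fsq (M *m x))^-1 *: (M *m x *m (M *m x)^T).
(* The orthogonal projection onto the orthogonal complement of the span of [l] *)
Definition pj l : 'M[R]_p := foldr pupd 1%:M l.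
Lemma mul_cV_sq (u : 'cV[R]_p) : u *m u^T *m (u *m u^T) = fsq u *: (u *m u^T).
Proof. by rewrite mulmxA -(mulmxA u) fsq_cV1 mul_mx_scalar -scalemxAl. Qed.
Lemma invr_fsqK (u : 'cV[R]_p) : (fsq u)^-1 * fsq u *: u = u.
Proof.
have [|u0] := eqVneq (fsq u) 0; last by rewrite mulVf // scale1r.
by move=> /eqP; rewrite fsq_eq0 => /eqP ->; rewrite scaler0.
Qed.
Lemma pj_props l : (pj l)^T = pj l /\ pj l *m pj l = pj l.
Proof.
elim: l => [|x l [sM iM]] /=; first by rewrite trmx1 mulmx1.
set M := pj l in sM iM *; rewrite /pupd; set u := M *m x.
have Mu : M *m u = u by rewrite mulmxA iM.
have uM : u^T *m M = u^T by rewrite -{1}sM -trmx_mul Mu.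
split.
  by rewrite linearB /= linearZ /= trmx_mul trmxK sM.
rewrite mulmxBl !mulmxBr iM -!scalemxAr -!scalemxAl mul_cV_sq.
rewrite (mulmxA M) Mu -(mulmxA u _ M) uM.
have -> : (fsq u)^-1 *: (fsq u *: (u *m u^T)) = u *m u^T.
  by rewrite scalerA scalemxAl invr_fsqK.
by rewrite subrr subr0.
Qed.
Lemma pj_sym l : (pj l)^T = pj l. Proof. by case: (pj_props l). Qed.
Lemma pj_idem l : pj l *m pj l = pj l. Proof. by case: (pj_props l). Qed.
Lemma pj_cons x l : pj (x :: l) = pupd x (pj l). Proof. by []. Qed.
Lemma pj_dot l x : x^T *m (pj l *m x) = (fsq (pj l *m x))%:M.
Proof. by rewrite -fsq_cV1 trmx_mul pj_sym -mulmxA (mulmxA (pj l)) pj_idem. Qed.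
Lemma pj_mem l x : x \in l -> pj l *m x = 0.
Proof.
elim: l => // y l IH; rewrite inE pj_cons /pupd; set u := pj l *m y.
rewrite mulmxBl -scalemxAl -mulmxA.
case/predU1P => [->|/IH Mx0]; last first.
  by rewrite Mx0 trmx_mul pj_sym -(mulmxA y^T) Mx0 !mulmx0 scaler0 subrr.
have -> : u^T *m y = (fsq u)%:M by rewrite -pj_dot trmx_mul pj_sym mulmxA.
by rewrite mul_mx_scalar scalerA invr_fsqK subrr.
Qed.
(** Together with [pj_mem] this characterises the projection, so that nested projections are
    compared through their lists alone, without bases or ranks. *)
Lemma pj_fix q l (V : 'M[R]_(p, q)) : (forall x, x \in l -> x^T *m V = 0) -> pj l *m V = V.
Proof.
elim: l => [|x l IH] h /=; first by rewrite mul1mx.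
have hV : pj l *m V = V by apply: IH => y yl; apply: h; rewrite inE yl orbT.
rewrite /pupd mulmxBl hV -scalemxAl -(mulmxA (pj l *m x)) trmx_mul pj_sym -(mulmxA x^T) hV.
by rewrite h ?inE ?eqxx // mulmx0 scaler0 subr0.
Qed.
Lemma pj_sub l l' : {subset l <= l'} -> pj l *m pj l' = pj l'.
Proof.
move=> h; apply: pj_fix => x /h xl.
by rewrite -pj_sym -trmx_mul pj_mem // trmx0.
Qed.
Lemma pj_subr l l' : {subset l <= l'} -> pj l' *m pj l = pj l'.
Proof. by move=> h; rewrite -{1}pj_sym -{1}(pj_sym l) -trmx_mul pj_sub // pj_sym. Qed.
Lemma fsq_pj_sub q l l' (V : 'M[R]_(p, q)) : {subset l <= l'} ->
  fsq (pj l' *m V) <= fsq (pj l *m V).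
Proof.
by move=> h; rewrite -(pj_subr h) -mulmxA fsq_proj_le ?pj_sym ?pj_idem.
Qed.
(** A Gram-Schmidt step lowers the trace by 1, or by 0 when the new vector is dependent on the
    others. This replaces every rank computation for projections. *)
Lemma tr_1Bpj l : \tr (1%:M - pj l) <= (size l)%:R.
Proof.
elim: l => [|x l IH] /=; first by rewrite subrr mxtrace0.
rewrite /pupd opprB addrCA addrC linearD /= linearZ /= -natr1 lerD //.
rewrite mxtrace_mulC fsq_cV1 mxtrace_scalar; set a := fsq _.
by have [->|a0] := eqVneq a 0; rewrite ?mulr0 ?ler01 // mulVf.
Qed.
Lemma subpj_sym l : (1%:M - pj l)^T = 1%:M - pj l.
Proof. by rewrite linearB /= trmx1 pj_sym. Qed.
Lemma subpj_idem l : (1%:M - pj l) *m (1%:M - pj l) = 1%:M - pj l.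
Proof. by rewrite mulmxBl mul1mx mulmxBr mulmx1 pj_idem subrr subr0. Qed.
Lemma fsq_subpj l : fsq (1%:M - pj l) <= (size l)%:R.
Proof. by rewrite -tr_proj ?subpj_sym ?subpj_idem // tr_1Bpj. Qed.
End projections.
(** * Moments of Gaussian vectors *)
Section density.
Context d (T : measurableType d) {R : realType}.
Variables (mu nu : {measure set T -> \bar R}) (g : T -> R).
Hypothesis mg : measurable_fun setT g.
Hypothesis g0 : forall x, 0 <= g x.
Hypothesis nuE : forall A, measurable A -> (nu A = \int[mu]_(x in A) (g x)%:E)%E.
Import HBNNSimple.
Let density_nnsfun (h : {nnsfun T >-> R}) :
  (\int[nu]_x (h x)%:E = \int[mu]_x ((h x)%:E * (g x)%:E))%E.
Proof.
have hg0 r x : (0 <= (r * \1_(h @^-1` [set r]) x)%:E)%E.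
  by rewrite EFinM nnfun_muleindic_ge0.
under [LHS]eq_integral do rewrite fimfunE -fsumEFin//.
rewrite [LHS]ge0_integral_fsum//; last first.
  by move=> r; exact/measurable_EFinP/measurableT_comp.
under [RHS]eq_integral.
  move=> x _; rewrite fimfunE -fsumEFin// muleC ge0_mule_fsumr//.
  over.
rewrite [RHS]ge0_integral_fsum//; last 2 first.
- move=> r; apply: emeasurable_funM; first exact/measurable_EFinP.
  exact/measurable_EFinP/measurableT_comp.
- by move=> r x _; apply: mule_ge0 => //; rewrite lee_fin.
apply: eq_fsbigr => r rh; rewrite integralZl_indic_nnsfun//=.
rewrite integral_indic//= setIT nuE//.
under [RHS]eq_integral do rewrite EFinM muleCA.
have r0 : (0 <= r)%R by move: rh; rewrite inE => -[x _ <-]; exact: fun_ge0.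
rewrite [RHS]ge0_integralZl//; last 2 first.
- apply: emeasurable_funM; exact/measurable_EFinP.
- by move=> x _; apply: mule_ge0 => //; rewrite lee_fin.
congr (_ * _)%E; rewrite integral_mkcond; apply: eq_integral => x _.
rewrite patchE indicE; case: ifPn => _; by rewrite ?mule1 ?mule0.
Qed.
(** Simple functions first, then monotone convergence. It turns the normal law, which is prescribed
    on sets, into integrals against its density. *)
Lemma ge0_integral_density (f : T -> \bar R) : measurable_fun setT f ->
  (forall x, 0 <= f x)%E -> (\int[nu]_x f x = \int[mu]_x (f x * (g x)%:E))%E.
Proof.
move=> mf f0; pose f_ := nnsfun_approx measurableT mf.
transitivity (lim (\int[nu]_x (f_ n x)%:E @[n --> \oo])%E).
  rewrite -monotone_convergence//=.
  - apply: eq_integral => ? _; apply/esym/cvg_lim => //=.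
    exact: cvg_nnsfun_approx.
  - by move=> n; exact/measurable_EFinP/measurable_funTS.
  - by move=> n ? _; rewrite lee_fin.
  - by move=> ? _ ? ? mn; rewrite lee_fin; exact/lefP/nd_nnsfun_approx.
have -> : (\int[mu]_x (f x * (g x)%:E) = lim (\int[mu]_x ((f_ n x)%:E * (g x)%:E) @[n --> \oo]))%E.
  rewrite -monotone_convergence//=.
  - apply: eq_integral => x _; apply/esym/cvg_lim => //=.
    under eq_fun do rewrite muleC.
    by rewrite muleC; apply: cvgeZl => //; exact: cvg_nnsfun_approx.
  - by move=> n; apply: emeasurable_funM; exact/measurable_EFinP/measurable_funTS.
  - by move=> n ? _; apply: mule_ge0 => //; rewrite lee_fin.
  - move=> x _ a b ab; apply: lee_wpmul2r; rewrite lee_fin//.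
    exact/lefP/nd_nnsfun_approx.
by apply: congr_lim; apply/funext => n /=; exact: density_nnsfun.
Qed.
End density.
Section gauss_moments.
Context {R : realType}.
Import gauss_integral_proof.
Notation mu := (@lebesgue_measure R).
Lemma cvg_exprn_gauss_fun n : (x ^+ n * gauss_fun x : R) @[x --> +oo] --> 0.
Proof.
apply/cvgrPdist_le => e e0; near=> x.
have x1 : 1 <= x by near: x; exact: nbhs_pinfty_ge.
have x0 : 0 < x by rewrite (lt_le_trans ltr01).
have f0 : (0 : R) < n.+1`!%:R by rewrite ltr0n fact_gt0.
have xe : n.+1`!%:R <= e * x.
  by rewrite mulrC -ler_pdivrMr//; near: x; exact: nbhs_pinfty_ge.
rewrite sub0r normrN ger0_norm ?mulr_ge0 ?exprn_ge0 ?gauss_fun_ge0 ?(ltW x0)//=.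
(* The Taylor term of degree [n.+1] of the exponential at [x^2] grows like [x^(2n+2)], which leaves
   more than one spare factor [x] over [x^n]. *)
have h : (x ^+ 2) ^+ n.+1 / n.+1`!%:R <= expR (x ^+ 2).
  apply: le_trans (expR_ge1Dxn n (sqr_ge0 x)); rewrite lerDr //.
rewrite /gauss_fun expRN -/(_ / _).
rewrite ler_pdivrMr ?expR_gt0//; apply: le_trans (ler_wpM2l (ltW e0) h).
rewrite mulrA ler_pdivlMr// -exprM mulnC muln2 -addnn exprD exprS.
have xn : x ^+ n <= x ^+ n * x ^+ n.+1 by rewrite ler_peMr ?exprn_ge0 ?exprn_ege1 ?(ltW x0).
have -> : e * (x * x ^+ n * (x * x ^+ n)) = (e * x) * (x ^+ n * x ^+ n.+1).
  by rewrite exprS; ring.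
by rewrite mulrC; apply: ler_pM => //; rewrite ?exprn_ge0 ?(ltW x0).
Unshelve. all: end_near. Qed.
Lemma cvg_integral0_gauss : @integral0_gauss R x @[x --> +oo] --> Num.sqrt pi / 2.
Proof.
have : Num.sqrt (@integral0_gauss R x ^+ 2) @[x --> +oo] --> Num.sqrt (pi / 4).
  apply: continuous_cvg => //; [exact: sqrt_continuous|exact: cvg_integral0_gauss_sqr].
rewrite sqrtrM ?pi_ge0// sqrtrV// (_ : 4 = 2 ^+ 2); last by rewrite expr2 -natrM.
rewrite sqrtr_sqr ger0_norm// (_ : (fun _ => Num.sqrt _) = @integral0_gauss R)//.
by apply/funext => r; rewrite sqrtr_sqr ger0_norm// integral0_gauss_ge0.
Qed.
(** This is [(2n-1)!! / 2^n], the moment of order [2n] of the density [exp(-x^2) / sqrt(pi)], whose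
    variance is 1/2. *)
Fixpoint gmom n : R := if n is n'.+1 then (n'.*2.+1)%:R / 2 * gmom n' else 1.
(* Iterated integration by parts yields primitives of [x^(2n) exp(-x^2)]. *)
Lemma gauss_moment_primitive (n : nat) : exists G : R -> R,
  [/\ forall x : R, 0 < x -> is_derive x (1 : R) G (x ^+ n.*2 * gauss_fun x),
      G x @[x --> 0^'+] --> G 0,
      G 0 = 0 & G x @[x --> +oo] --> gmom n * (Num.sqrt pi / 2)].
Proof.
have dgauss (x : R) : is_derive x (1 : R) gauss_fun (- (2 * x) * gauss_fun x).
  rewrite /gauss_fun; apply: is_derive_eq.
  by rewrite -[x%:A]/(x * 1); ring.
elim: n => [|n [G [dG cG G0 Gy]]].
  exists integral0_gauss; split.
  - move=> x x0; rewrite expr0 mul1r.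
    have [||||d1 d2] := @continuous_FTC1_closed R gauss_fun 0 x (x + 1).
    + by rewrite ltrDl.
    + apply: continuous_compact_integrable => //; first exact: segment_compact.
      by apply: continuous_subspaceT; exact: continuous_gauss_fun.
    + exact: x0.
    + exact: continuous_gauss_fun.
    + by apply: DeriveDef; [exact: d1|rewrite -derive1E d2].
  - rewrite /integral0_gauss set_itv1 Rintegral_set1.
    apply: cvg_at_right_filter.
    apply: (@parameterized_integral_cvg_left R 0 1 gauss_fun) => //.
    apply: continuous_compact_integrable => //; first exact: segment_compact.
    by apply: continuous_subspaceT; exact: continuous_gauss_fun.
  - by rewrite /integral0_gauss set_itv1 Rintegral_set1.
  - by rewrite mul1r; exact: cvg_integral0_gauss.
have c0 : (x ^+ n.*2.+1 * gauss_fun x) @[x --> 0^'+] --> (0 : R).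
  apply: cvg_at_right_filter.
  rewrite -[X in _ --> X](mul0r (gauss_fun (0 : R))); apply: cvgM; last exact: continuous_gauss_fun.
  by rewrite -[X in _ --> X](expr0n R n.*2.+1); exact: exprn_continuous.
exists (fun x => 2^-1 * ((n.*2.+1)%:R * G x - x ^+ n.*2.+1 * gauss_fun x)); split.
- move=> x x0; have dGx := dG _ x0; have dg := dgauss x.
  have dX : is_derive x (1 : R) ((@id R) ^+ n.*2.+1) (n.*2.+1%:R * x ^+ n.*2).
    by apply: is_derive_eq; rewrite -[LHS]/(_ * 1) mulr1.
  have -> : (fun x => 2^-1 * (n.*2.+1%:R * G x - x ^+ n.*2.+1 * gauss_fun x)) =
      2^-1 \*: (n.*2.+1%:R \*: G - (@id R) ^+ n.*2.+1 * gauss_fun).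
    by apply/funext => y; rewrite /GRing.scale /= !fctE.
  apply: is_derive_eq.
  by rewrite /GRing.scale /= !fctE doubleS !exprS; field.
- rewrite /= G0 expr0n /= mul0r mulr0 subr0 mulr0 -[X in _ --> X](mulr0 2^-1).
  apply: cvgMl_tmp; rewrite -[X in _ --> X]subr0; apply: cvgB => //.
  by rewrite -[X in _ --> X](mulr0 n.*2.+1%:R); apply: cvgMl_tmp; rewrite -{2}G0.
- by rewrite /= G0 expr0n /= mul0r mulr0 subr0 mulr0.
- have -> : gmom n.+1 * (Num.sqrt pi / 2) =
      2^-1 * (n.*2.+1%:R * (gmom n * (Num.sqrt pi / 2)) - 0) by rewrite /=; field.
  apply: cvgMl_tmp; apply: cvgB; last exact: cvg_exprn_gauss_fun.
  exact: cvgMl_tmp.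
Qed.
End gauss_moments.
Section normal_moments.
Context {R : realType}.
Notation mu := (@lebesgue_measure R).
Lemma continuous_exprn_gauss_fun n : continuous (fun x : R => x ^+ n * gauss_fun x).
Proof.
by move=> x; apply: cvgM; [exact: exprn_continuous|exact: continuous_gauss_fun].
Qed.
Lemma integral_gauss_moment n :
  (\int[mu]_x (x ^+ n.*2 * gauss_fun x)%:E)%E = (gmom n * Num.sqrt pi : R)%:E.
Proof.
have h0 (x : R) : 0 <= x ^+ n.*2 * gauss_fun x.
  by rewrite mulr_ge0 ?gauss_fun_ge0// -mul2n exprM exprn_ge0 ?sqr_ge0.
rewrite ge0_symfun_integralT//; last 2 first.
- exact: continuous_exprn_gauss_fun.
- by move=> x /=; rewrite /gauss_fun sqrrN -!mul2n !exprM sqrrN.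
have [G [dG cG G0 Gy]] := @gauss_moment_primitive R n.
rewrite -set_itvcy (ge0_continuous_FTC2y _ _ Gy _ cG)//.
- by rewrite G0 sube0 -EFinM; congr (_%:E); field.
- apply: continuous_subspaceT; exact: continuous_exprn_gauss_fun.
- by move=> x /dG [].
- by move=> x; rewrite in_itv/= andbT => /dG d; rewrite derive1E derive_val.
Qed.
Lemma integral_normal_moment n (s : R) : 0 < s ->
  (\int[mu]_x (x ^+ n.*2 * normal_pdf 0 s x)%:E)%E = (gmom n * (2 * s ^+ 2) ^+ n)%:E.
Proof.
(* The substitution [x |-> c x] maps the normal density of deviation [s] to the kernel
   [exp(-x^2)]. *)
move=> s0; pose c := (s * Num.sqrt 2)^-1 : R.
have q2 : 0 < Num.sqrt (2 : R) by rewrite sqrtr_gt0.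
have c0 : 0 < c by rewrite invr_gt0 mulr_gt0.
have qpi : 0 < Num.sqrt (pi : R) by rewrite sqrtr_gt0 pi_gt0.
have c2 : c ^+ 2 = (2 * s ^+ 2)^-1.
  by rewrite /c exprVn exprMn sqr_sqrtr// mulrC.
have dF (x : R) : is_derive x (1 : R) ( *%R^~ c) c.
  have -> : *%R^~ c = c \*: (@id R) by apply/funext => y; rewrite mulrC.
  by apply: is_derive_eq; rewrite /GRing.scale /= mulr1.
have F'E : (( *%R^~ c)^`())%classic = cst c.
  by apply/funext => x; rewrite derive1E derive_val.
have ev (x : R) : 0 <= x ^+ n.*2 by rewrite -mul2n exprM exprn_ge0 ?sqr_ge0.
have pdfE (x : R) : c * gauss_fun (c * x) = Num.sqrt pi * normal_pdf 0 s x.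
  have s0w := ltW s0; rewrite normal_pdfE ?lt0r_neq0// /normal_fun /normal_peak /gauss_fun subr0.
  rewrite -[s ^+ 2 * pi *+ 2]mulr_natr sqrtrM ?mulr_ge0 ?sqr_ge0 ?pi_ge0//.
  rewrite sqrtrM ?sqr_ge0// sqrtr_sqr ger0_norm// exprMn c2.
  have -> : - ((2 * s ^+ 2)^-1 * x ^+ 2) = - x ^+ 2 / (s ^+ 2 *+ 2).
    by field; rewrite lt0r_neq0.
  by rewrite /c; field; rewrite !lt0r_neq0.
have := integral_gauss_moment n.
rewrite (@increasing_ge0_integration_by_substitutionT R ( *%R^~ c) (fun x => x ^+ n.*2 * gauss_fun x)); first last.
- by move=> x; rewrite mulr_ge0 ?gauss_fun_ge0.
- exact: continuous_exprn_gauss_fun.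
- by apply/gt0_cvgMly => //; exact: cvg_id.
- by apply/gt0_cvgMlNy => //; exact: cvg_id.
- by [].
- by rewrite F'E; exact: is_cvg_cst.
- by rewrite F'E; exact: is_cvg_cst.
- by rewrite F'E => ?; exact: cvg_cst.
- by move=> x y xy; rewrite ltr_pM2r.
have -> : (fun x => ((((fun y : R => y ^+ n.*2 * gauss_fun y) \o *%R^~ c) *
    (( *%R^~ c)^`())%classic) x)%:E) = (fun x => (c ^+ n.*2 * Num.sqrt pi)%:E *
       (x ^+ n.*2 * normal_pdf 0 s x)%:E)%E.
  apply/funext => x; rewrite -EFinM; congr _%:E; rewrite F'E !fctE /=.
  by rewrite exprMn (mulrC x c) -mulrA (mulrC (gauss_fun _)) pdfE; ring.
rewrite ge0_integralZl//=; last 3 first.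
- apply/measurable_EFinP; apply: measurable_funM => //.
  exact: measurable_normal_pdf.
- by move=> x _; rewrite lee_fin mulr_ge0// normal_pdf_ge0.
- by rewrite lee_fin mulr_ge0.
have k0 : c ^+ n.*2 * Num.sqrt pi != 0 by rewrite mulf_neq0 ?expf_neq0 ?lt0r_neq0.
move/(congr1 (fun z => ((c ^+ n.*2 * Num.sqrt pi)^-1)%:E * z)%E).
rewrite muleA -!EFinM mulVf// mul1e => ->; congr _%:E.
by rewrite -mul2n exprM c2 exprVn; field; rewrite !lt0r_neq0// exprn_gt0 ?mulr_gt0 ?exprn_gt0.
Qed.
End normal_moments.

(** * Means of integrable random variables *)

Section has_mean.
Context d (T : measurableType d) {R : realType} (P : probability T R).
Implicit Types (f g : T -> R).
(** Integrability is bundled with the value, so that polynomial combinations of moments are computed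
    in [R] without side conditions. *)
Definition has_mean f (m : R) :=
  P.-integrable setT (EFin \o f) /\ (\int[P]_x (f x)%:E = m%:E)%E.
Lemma has_mean_measurable f m : has_mean f m -> measurable_fun setT f.
Proof. by move=> [/measurable_int/measurable_EFinP]. Qed.
Lemma has_mean_ge0 f m : measurable_fun setT f -> (forall x, 0 <= f x) ->
  (\int[P]_x (f x)%:E = m%:E)%E -> has_mean f m.
Proof.
move=> mf f0 h; split => //; apply/integrableP; split; first exact/measurable_EFinP.
by under eq_integral do rewrite /= ger0_norm//; rewrite h ltry.
Qed.
Lemma has_mean_dom f g m : measurable_fun setT f -> has_mean g m ->
  (forall x, `|f x| <= g x) -> exists k, has_mean f k.
Proof.
move=> mf [ig _] fg.
have fi : P.-integrable setT (EFin \o f).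
  apply: le_integrable ig => //; first exact/measurable_EFinP.
  by move=> x _ /=; rewrite lee_fin (le_trans (fg x))// ler_norm.
exists (fine (\int[P]_x (f x)%:E)%E); split => //; rewrite fineK//.
exact: integrable_fin_num.
Qed.
Lemma has_mean_cst c : has_mean (cst c) c.
Proof.
split; first by apply/finite_measure_integrable_cst.
by rewrite (integral_cst P measurableT c%:E) /= probability_setT mule1.
Qed.
Lemma has_meanD f g a b : has_mean f a -> has_mean g b ->
  has_mean (fun x => f x + g x) (a + b).
Proof.
move=> [fi fE] [gi gE]; split; first exact: (integrableD _ fi gi).
under eq_integral do rewrite EFinD.
by rewrite (integralD_EFin _ fi gi)// fE gE.
Qed.
Lemma has_meanZ c f a : has_mean f a -> has_mean (fun x => c * f x) (c * a).
Proof.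
move=> [fi fE]; split.
  exact: (integrableZl measurableT c fi).
by under eq_integral do rewrite EFinM; rewrite (integralZl measurableT fi) fE.
Qed.
Lemma has_meanB f g a b : has_mean f a -> has_mean g b ->
  has_mean (fun x => f x - g x) (a - b).
Proof.
move=> hf /(has_meanZ (-1)) hg.
have := has_meanD hf hg; rewrite mulN1r.
by have -> // : (fun x => f x + -1 * g x) = (fun x => f x - g x)
  by apply/funext => x; rewrite mulN1r.
Qed.
Lemma has_mean_sum I (r : seq I) (F : I -> T -> R) (a : I -> R) :
  (forall i, has_mean (F i) (a i)) ->
  has_mean (fun x => \sum_(i <- r) F i x) (\sum_(i <- r) a i).
Proof.
move=> h; elim: r => [|i r IH].
  rewrite big_nil (_ : (fun _ => _) = cst 0); first exact: has_mean_cst.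
  by apply/funext => x; rewrite big_nil.
rewrite big_cons (_ : (fun _ => _) = (fun x => F i x + \sum_(j <- r) F j x)).
  exact: has_meanD.
by apply/funext => x; rewrite big_cons.
Qed.
Lemma has_mean_eq f g a b : has_mean f a -> f =1 g -> a = b -> has_mean g b.
Proof. by move=> h /funext <- <-. Qed.
Lemma integral_le_mean (f : T -> R) g b : measurable_fun setT f ->
  (forall x, 0 <= f x) -> has_mean g b -> (forall x, f x <= g x) ->
  (\int[P]_x (f x)%:E <= b%:E)%E.
Proof.
move=> mf f0 [gi gE] fg; rewrite -gE; apply: ge0_le_integral => //.
- by move=> x _; rewrite lee_fin.
- exact/measurable_EFinP.
- exact: measurable_int gi.
- by move=> x _; rewrite lee_fin.
Qed.
(** Only the minorant has to be integrable: if [f] is not, its integral is infinite and the bound is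
    trivial. Hence ratios with a random denominator are allowed as [f]. *)
Lemma mean_le_integral (f : T -> R) g a : measurable_fun setT f ->
  (forall x, 0 <= f x) -> has_mean g a -> (forall x, g x <= f x) ->
  (a%:E <= \int[P]_x (f x)%:E)%E.
Proof.
move=> mf f0 [gi gE] gf.
have [fi|] := pselect (P.-integrable setT (EFin \o f)).
  by rewrite -gE; apply: le_integral => // x _; rewrite lee_fin.
move=> nfi; rewrite [leRHS](_ : _ = +oo%E) ?leey//.
apply/eqP; rewrite eq_le leey /= leNgt; apply/negP => h; apply: nfi.
apply/integrableP; split; first exact/measurable_EFinP.
by under eq_integral do rewrite /= ger0_norm//.
Qed.
End has_mean.
Section normal_law.
Context d (T : measurableType d) {R : realType} (P : probability T R).
Implicit Types (Y : T -> R).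
Notation mu := (@lebesgue_measure R).
Lemma normal_law_var_ge0 Y v : normal_law P Y 0 v -> 0 <= v.
Proof. by case=> [[->]|[/ltW]]. Qed.
(** Variance 0 is treated apart because the law is then a point mass and has no density. *)
Lemma integral_normal_law Y v (f : R -> R) : measurable_fun setT Y ->
  normal_law P Y 0 v -> measurable_fun setT f -> (forall x, 0 <= f x) ->
  (\int[P]_w (f (Y w))%:E = if (v == 0)%R then (f 0%R)%:E else
    \int[mu]_x (f x * normal_pdf 0%R (Num.sqrt v) x)%:E)%E.
Proof.
move=> mY + mf f0; case=> [[-> h]|[v0 h]]; rewrite ?eqxx.
  rewrite (_ : \int[P]_w _ = \int[P]_w (cst (f 0)%:E w))%E.
    by rewrite integral_cst//= probability_setT mule1.
  apply: ge0_ae_eq_integral => //.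
  - by apply/measurable_EFinP; exact: measurableT_comp.
  - by move=> x _; rewrite lee_fin.
  - by move=> x _; rewrite lee_fin.
  - have mY0 : measurable [set w | Y w = 0].
      by have := mY measurableT [set 0] (measurable_set1 0); rewrite setTI.
    exists (~` [set w | Y w = 0]); split.
    + exact: measurableC.
    + by rewrite [LHS](probability_setC P mY0) h subee.
    + by move=> w /= nw Yw; apply: nw => _; rewrite Yw.
rewrite gt_eqF//.
under [RHS]eq_integral do rewrite EFinM.
have mY' : measurable_fun setT (Y : T -> measurableTypeR R) by exact: mY.
pose Ym := isMeasurableFun.Build _ _ T (measurableTypeR R) Y mY'.
pose Yp : {mfun T >-> measurableTypeR R} := HB.pack Y Ym.
rewrite -(@ge0_integral_density _ _ _ mu (pushforward P Yp) (normal_pdf 0 (Num.sqrt v))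
  _ _ _ (EFin \o f)) //=.
- rewrite ge0_integral_pushforward //.
  + exact/measurable_EFinP.
  + by move=> y _; rewrite /= lee_fin.
- exact: measurable_normal_pdf.
- by move=> x; exact: normal_pdf_ge0.
- exact/measurable_EFinP.
Qed.
Lemma normal_law_moment Y v n : measurable_fun setT Y -> normal_law P Y 0 v ->
  has_mean P (fun w => Y w ^+ n.*2) (gmom n * (2 * v) ^+ n).
Proof.
move=> mY hY; have ev (x : R) : 0 <= x ^+ n.*2.
  by rewrite -mul2n exprM exprn_ge0 ?sqr_ge0.
have v0 := normal_law_var_ge0 hY.
apply: has_mean_ge0 => //; first by apply: measurable_funX.
rewrite (@integral_normal_law _ v (fun x => x ^+ n.*2)) //; case: eqP => [v00|/eqP vn0].
  by rewrite v00 mulr0 !expr0n; case: n {ev} => [|n] //=; rewrite ?mulr0 ?mulr1.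
by rewrite integral_normal_moment ?sqr_sqrtr// sqrtr_gt0 lt0r vn0.
Qed.
Lemma normal_law_mean2 Y v : measurable_fun setT Y -> normal_law P Y 0 v ->
  has_mean P (fun w => Y w ^+ 2) v.
Proof.
move=> mY /(normal_law_moment 1 mY) h; apply: has_mean_eq h _ _ => //=.
by rewrite double0; field.
Qed.
Lemma normal_law_mean4 Y v : measurable_fun setT Y -> normal_law P Y 0 v ->
  has_mean P (fun w => Y w ^+ 4) (3 * v ^+ 2).
Proof.
move=> mY /(normal_law_moment 2 mY) h; apply: has_mean_eq h _ _ => //=.
by rewrite doubleS double0; field.
Qed.
(** Only even moments have been computed. The mean vanishes by symmetry: [Y] and [- Y] have the same
    law, so [(1 + Y)^2] and [(1 - Y)^2] have the same mean, while their means differ by [4 m]. *)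
Lemma normal_law_mean1 Y v : measurable_fun setT Y -> normal_law P Y 0 v ->
  normal_law P (fun w => - Y w) 0 v -> has_mean P Y 0.
Proof.
move=> mY hY hNY; have h2 := normal_law_mean2 mY hY.
have [|m hm] := has_mean_dom mY (has_meanD (has_mean_cst P 1) h2).
  by move=> w /=; have := sqr_ge0 (`|Y w| - 1); rewrite -(real_normK (num_real (Y w))); nra.
suff m0 : m = 0 by rewrite m0 in hm.
have hp : has_mean P (fun w => (1 + Y w) ^+ 2) (1 + 2 * m + v).
  apply: has_mean_eq (has_meanD (has_meanD (has_mean_cst P 1) (has_meanZ 2 hm)) h2) _ _ => //.
  by move=> w /=; ring.
have hn : has_mean P (fun w => (1 - Y w) ^+ 2) (1 - 2 * m + v).
  apply: has_mean_eq (has_meanD (has_meanB (has_mean_cst P 1) (has_meanZ 2 hm)) h2) _ _ => //.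
  by move=> w /=; ring.
have mf : measurable_fun setT (fun x : R => (1 + x) ^+ 2).
  by apply: measurable_funX; apply: measurable_funD.
have f0 (x : R) : 0 <= (1 + x) ^+ 2 by exact: sqr_ge0.
have e : (\int[P]_w ((1 + Y w) ^+ 2)%:E = \int[P]_w ((1 - Y w) ^+ 2)%:E)%E.
  rewrite (integral_normal_law mY hY mf f0).
  rewrite -(integral_normal_law _ hNY mf f0) //.
  exact: measurableT_comp.
by move: e; rewrite hp.2 hn.2 => -[]; lra.
Qed.
End normal_law.
Section gauss_moments_def.
Context d (T : measurableType d) {R : realType} (P : probability T R) {p : nat}.
(* The moments of [N(0, S S^T)] up to order four that are needed. *)
Record gauss_moments (x : T -> 'cV[R]_p) (S : 'M[R]_p) : Prop := GaussMoments {
  gm_meas : forall j, measurable_fun setT (fun w => x w j 0);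
  gm1 : forall v : 'cV[R]_p, has_mean P (fun w => \tr (v^T *m x w)) 0;
  gm2 : forall m (B : 'M[R]_(m, p)),
    has_mean P (fun w => fsq (B *m x w)) (fsq (B *m S));
  gm4 : forall m m' (B : 'M[R]_(m, p)) (C : 'M[R]_(m', p)),
    has_mean P (fun w => fsq (B *m x w) * fsq (C *m x w))
      (fsq (B *m S) * fsq (C *m S) + 2 * fsq (B *m S *m (C *m S)^T)) }.
Lemma gm_bilin x S m (B C : 'M[R]_(m, p)) : gauss_moments x S ->
  has_mean P (fun w => \tr ((B *m x w)^T *m (C *m x w)))
    (\tr ((B *m S)^T *m (C *m S))).
Proof.
move=> h.
have trE q (A A' : 'M[R]_(m, q)) : \tr (A^T *m A') = 2^-1 * (fsq (A + A') - fsq A - fsq A').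
  by rewrite fsqD; field.
have h3 := has_meanZ 2^-1 (has_meanB (has_meanB (gm2 h (B + C)) (gm2 h B)) (gm2 h C)).
apply: has_mean_eq h3 _ _ => [w|]; rewrite trE -mulmxDl //.
Qed.
End gauss_moments_def.
Section gaussian_vec_moments.
Context d (T : measurableType d) {R : realType} (P : probability T R) {p : nat}.
Variables (Z : 'I_p -> T -> R) (S : 'M[R]_p).
Hypothesis mZ : forall i, measurable_fun setT (Z i).
Hypothesis hZ : gaussian_vec P Z (S *m S^T).
Let l (t : 'cV[R]_p) w := \sum_i t i 0 * Z i w.
Let ml t : measurable_fun setT (l t).
Proof. by apply: measurable_sum => i; apply: measurable_funM. Qed.
Let qE (t : 'cV[R]_p) : qform (S *m S^T) t = fsq (t^T *m S).
Proof.
rewrite /qform mulmxA -mulmxA -[X in _ *m X]trmxK trmx_mul trmxK -(fsq_tr (t^T *m S)).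
by rewrite -{1}(trmxK (t^T *m S)) fsq_cV1 mxE eqxx mulr1n.
Qed.
Let lE t w : l t w = \tr (t^T *m \col_i Z i w).
Proof. by rewrite /mxtrace big_ord1 mxE; apply: eq_bigr => i _; rewrite !mxE. Qed.
Let lD s t w : l (s + t) w = l s w + l t w.
Proof. by rewrite !lE linearD mulmxDl mxtraceD. Qed.
Let lB s t w : l (s - t) w = l s w - l t w.
Proof. by rewrite !lE linearB mulmxBl /= raddfB. Qed.
Let l1 t : has_mean P (l t) 0.
Proof.
apply: (normal_law_mean1 (ml t) (hZ t)).
have := hZ (- t); rewrite !qE linearN mulNmx fsqN.
congr normal_law; apply/funext => w; rewrite -sumrN; apply: eq_bigr => i _.
by rewrite mxE mulNr.
Qed.
Let l2 t : has_mean P (fun w => l t w ^+ 2) (fsq (t^T *m S)).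
Proof. by rewrite -qE; exact: normal_law_mean2 (ml t) (hZ t). Qed.
Let l4 t : has_mean P (fun w => l t w ^+ 4) (3 * fsq (t^T *m S) ^+ 2).
Proof. by rewrite -qE; exact: normal_law_mean4 (ml t) (hZ t). Qed.
(* Polarization: [12 a^2 b^2 = (a + b)^4 + (a - b)^4 - 2 a^4 - 2 b^4]. *)
Let l22 s t : has_mean P (fun w => l s w ^+ 2 * l t w ^+ 2)
  (fsq (s^T *m S) * fsq (t^T *m S) + 2 * \tr ((s^T *m S)^T *m (t^T *m S)) ^+ 2).
Proof.
have h := has_meanZ (12^-1) (has_meanB (has_meanB (has_meanD (l4 (s + t)) (l4 (s - t)))
  (has_meanZ 2 (l4 s))) (has_meanZ 2 (l4 t))).
apply: has_mean_eq h _ _ => [w|]; first by rewrite lD lB; field.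
have -> : (s + t)^T *m S = s^T *m S + t^T *m S by rewrite linearD mulmxDl.
have -> : (s - t)^T *m S = s^T *m S - t^T *m S by rewrite linearB mulmxBl.
by rewrite !fsqD fsqN mulmxN raddfN /=; field.
Qed.
Let rowE m (B : 'M[R]_(m, p)) i w : \sum_j (B *m \col_i Z i w) i j ^+ 2 = l (row i B)^T w ^+ 2.
Proof.
rewrite big_ord1 mxE; congr (_ ^+ 2); apply: eq_bigr => k _; by rewrite !mxE.
Qed.
Lemma gaussian_vec_moments : gauss_moments P (fun w => \col_i Z i w) S.
Proof.
split.
- by move=> j; under eq_fun do rewrite mxE; exact: mZ.
- by move=> v; apply: has_mean_eq (l1 v) _ _ => // w; rewrite lE.
- move=> m B; apply: has_mean_eq (has_mean_sum _ (fun i => l2 (row i B)^T)) _ _.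
    by move=> w /=; apply: eq_bigr => i _; rewrite rowE.
  by rewrite [RHS]fsq_row_sum; apply: eq_bigr => i _; rewrite trmxK row_mul.
- move=> m m' B C.
  apply: has_mean_eq (has_mean_sum _ (fun i => has_mean_sum _ (fun j => l22 (row i B)^T (row j C)^T))) _ _.
    move=> w /=; rewrite /fsq mulr_suml; apply: eq_bigr => i _.
    by rewrite mulr_sumr; apply: eq_bigr => j _; rewrite !rowE.
  rewrite (fsq_row_sum (B *m S)) mulr_suml /(fsq (_ *m _^T)) mulr_sumr -big_split.
  apply: eq_bigr => i _; rewrite (fsq_row_sum (C *m S)) !mulr_sumr -big_split.
  apply: eq_bigr => j _; rewrite !trmxK -!row_mul; congr (_ + _ * _ ^+ 2).
  rewrite mxtrace_mulC -mxtrace_tr trmx_mul trmxK.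
  by rewrite [LHS]big_ord1 !mxE; apply: eq_bigr => k _; rewrite !mxE.
Qed.
End gaussian_vec_moments.
(** * Square roots of positive semidefinite matrices *)
Section psd_sqrt.
Context {R : realType}.
Import complex.
Lemma poly_interpolation (F : fieldType) (s : seq F) (f : F -> F) :
  exists q : {poly F}, forall x, x \in s -> q.[x] = f x.
Proof.
elim: s => [|a s [q qs]]; first by exists 0.
have [as_|nas] := boolP (a \in s).
  by exists q => x; rewrite inE => /predU1P[->|]; exact: qs.
pose r : {poly F} := \prod_(b <- s) ('X - b%:P).
have ra : r.[a] != 0.
  by rewrite -[_ == 0]/(root r a) root_prod_XsubC.
exists (q + ((f a - q.[a]) / r.[a]) *: r) => x; rewrite inE hornerD hornerZ.
case/predU1P => [->|xs]; first by rewrite mulfVK // addrC subrK.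
by rewrite qs // (_ : r.[x] = 0) ?mulr0 ?addr0 //; apply/eqP; rewrite -[_ == 0]/(root r x) root_prod_XsubC.
Qed.
Lemma horner_mx_sym n (A : 'M[R]_n.+1) (q : {poly R}) :
  A^T = A -> (mxpoly.horner_mx A q)^T = mxpoly.horner_mx A q.
Proof.
move=> sA; elim/poly_ind: q => [|q c IH]; first by rewrite rmorph0 trmx0.
rewrite rmorphD rmorphM /= mxpoly.horner_mx_X mxpoly.horner_mx_C.
rewrite linearD /= tr_scalar_mx -[_ * A]/(_ *m A) trmx_mul IH sA; congr (_ + _).
by rewrite -[LHS]/(A * _); apply: mxpoly.comm_mx_horner.
Qed.
Lemma psd_eigenvalue_ge0 n (A : 'M[R]_n) a : psd A -> eigenvalue A a -> 0 <= a.
Proof.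
move=> [sA pA] /eigenvalueP[v vA v0].
have := pA v^T; rewrite /qform trmxK vA -scalemxAl mxE.
rewrite -{1}(trmxK v) fsq_cV1 mxE eqxx mulr1n fsq_tr => h.
have fv : 0 < fsq v by rewrite lt_def fsq_eq0 v0 fsq_ge0.
by rewrite -(pmulr_lge0 _ fv).
Qed.
(** [A] is diagonalised over the complex numbers, but the root is a real polynomial in [A]: [q]
    interpolates the fourth roots of the eigenvalues and the root is [q(A)^2]. Fourth roots are
    taken because the square of a symmetric matrix is visibly positive semidefinite. *)
Lemma psd_sqrt_exists n (A : 'M[R]_n) : psd A -> exists S, psd S /\ S *m S = A.
Proof.
case: n A => [|n] A psdA.
  exists 0; split; last by apply/matrixP => -[].
  by split=> [|x]; [rewrite trmx0|rewrite /qform mulmx0 mul0mx mxE].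
have sA := psdA.1.
pose toC : R -> complex.complex R := real_complex R.
pose B : 'M[complex.complex R]_n.+1 := map_mx (real_complex R) A.
have Bherm : B \is sesquilinear.hermitianmx _ false Num.conj.
  apply: spectral.realsym_hermsym.
    by apply/sesquilinear.is_hermitianmxP; rewrite expr0 scale1r map_mx_id // /B map_trmx sA.
  by apply/mxOverP => i j; rewrite mxE; apply/complex.complex_realP; exists (A i j).
have /spectral.orthomx_spectralP BE := spectral.hermitian_normalmx Bherm.
have Dreal := spectral.hermitian_spectral_diag_real Bherm.
set D := spectral.spectral_diag B in BE Dreal.
set V := spectral.spectralmx B in BE.
have Vu : V \in unitmx := spectral.spectral_unit B.
pose lam (j : 'I_n.+1) : R := complex.Re (D 0 j).
have lamE j : toC (lam j) = D 0 j by apply: complex.RRe_real; move/mxOverP: Dreal; exact.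
have lam0 j : 0 <= lam j.
  apply: (psd_eigenvalue_ge0 psdA); rewrite mxpoly.eigenvalue_root_char.
  rewrite -(fmorph_root (real_complex R)) mxpoly.map_char_poly -mxpoly.eigenvalue_root_char.
  apply/eigenvalueP; exists (row j V).
    rewrite -[map_mx _ A]/B [X in _ *m X]BE -row_mul !mulmxA mulmxV // mul1mx.
    by rewrite row_mul row_diag_mx -scalemxAl -rowE -lamE.
  apply/eqP => /(congr1 (fun u => u *m invmx V)); rewrite mul0mx -row_mul mulmxV //.
  by move/rowP/(_ j); rewrite !mxE eqxx => /eqP; rewrite oner_eq0.
have [q qE] := poly_interpolation [seq lam j | j <- enum 'I_n.+1] (fun x => Num.sqrt (Num.sqrt x)).
pose Q := mxpoly.horner_mx A q.
have sQ : Q^T = Q by exact: horner_mx_sym.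
exists (Q *m Q); split.
  split; first by rewrite trmx_mul sQ.
  move=> x; rewrite /qform mulmxA -mulmxA -{1}sQ -trmx_mul fsq_cV1 mxE eqxx mulr1n.
  exact: fsq_ge0.
have -> : Q *m Q *m (Q *m Q) = mxpoly.horner_mx A (q ^+ 4).
  by rewrite rmorphXn /= -/Q -[4%N]/(2 * 2)%N exprM !expr2.
apply: (@map_mx_inj _ _ (real_complex R)).
rewrite mxpoly.map_horner_mx -/B.
rewrite [in LHS]BE.
rewrite (mxpoly.horner_mx_uconjC _ _ Vu).
rewrite [in RHS]BE.
rewrite mxpoly.horner_mx_diag.
apply: (f_equal (fun r => invmx V *m diag_mx r *m V)).
apply/rowP => j; rewrite mxE -lamE horner_map /= horner_exp; congr (toC _).
rewrite qE ?map_f ?mem_enum // -[4%N]/(2 * 2)%N exprM !sqr_sqrtr //.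
Qed.
Lemma sqrtmP n (A : 'M[R]_n) : psd A -> psd (sqrtm A) /\ sqrtm A *m sqrtm A = A.
Proof. by move=> /psd_sqrt_exists[S hS]; exact: (@xgetPex _ 0 [set S | _] (ex_intro _ S hS)). Qed.
End psd_sqrt.
(** * Independence *)
Section decoupling.
Context d (T : measurableType d) {R : realType} (P : probability T R).
Context {I J : Type} (F : I -> T -> R) (G : J -> T -> R).
Hypothesis mF : forall i, measurable_fun setT (F i).
Hypothesis mG : forall j, measurable_fun setT (G j).
Hypothesis FG : indep2 P (gen_sigma F) (gen_sigma G).
Let gens {K} (H : K -> T -> R) : set (set T) :=
  [set A | exists k (B : set R), measurable B /\ A = H k @^-1` B].
Let gens_measurable K (H : K -> T -> R) : (forall k, measurable_fun setT (H k)) ->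
  <<s gens H >> `<=` measurable.
Proof.
move=> mH; apply: smallest_sub; first exact: sigma_algebra_measurable.
by move=> _ [k [B [mB ->]]]; have := mH k measurableT B mB; rewrite setTI.
Qed.
Let TF : measurableType _ := g_sigma_algebraType (gens F).
Let TG : measurableType _ := g_sigma_algebraType (gens G).
Let mF' i : measurable_fun setT (F i : TF -> R).
Proof.
by move=> _ B mB; rewrite setTI; apply: sub_sigma_algebra; exists i, B.
Qed.
Let mG' j : measurable_fun setT (G j : TG -> R).
Proof.
by move=> _ B mB; rewrite setTI; apply: sub_sigma_algebra; exists j, B.
Qed.
Let iF : T -> TF := id.
Let iG : T -> TG := id.
Let miF : measurable_fun setT iF.
Proof. by move=> _ B mB; rewrite setTI; exact: (gens_measurable mF). Qed.
Let miG : measurable_fun setT iG.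
Proof. by move=> _ B mB; rewrite setTI; exact: (gens_measurable mG). Qed.
Let phi w : TF * TG := (iF w, iG w).
Let mphi : measurable_fun setT phi.
Proof. exact: measurable_fun_pair. Qed.
(** View [T] with the two generated sigma-algebras as two measurable spaces. Independence says that
    the diagonal map sends [P] to the product of its restrictions, and Tonelli applies.
    Measurability of [g] is required through composition with arbitrary measurable families, so that
    no sigma-algebra on the function spaces is needed. *)
Lemma integral_decouple (g : (I -> R) -> (J -> R) -> \bar R) :
  (forall f h, 0 <= g f h)%E ->
  (forall dU (U : measurableType dU) (f : U -> I -> R) (h : U -> J -> R),
    (forall i, measurable_fun setT (f^~ i)) -> (forall j, measurable_fun setT (h^~ j)) ->
    measurable_fun setT (fun u => g (f u) (h u))) ->
  (\int[P]_w g (F^~ w) (G^~ w) = \int[P]_w \int[P]_w' g (F^~ w) (G^~ w'))%E.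
Proof.
move=> g0 mg.
pose pF : {mfun T >-> TF} := HB.pack iF (isMeasurableFun.Build _ _ T TF iF miF).
pose pG : {mfun T >-> TG} := HB.pack iG (isMeasurableFun.Build _ _ T TG iG miG).
pose pphi : {mfun T >-> (TF * TG)%type} :=
  HB.pack phi (isMeasurableFun.Build _ _ T (TF * TG)%type phi mphi).
pose h (z : TF * TG) := g (F^~ z.1) (G^~ z.2).
have mh : measurable_fun setT h.
  apply: mg => [i|j].
    by apply: (measurableT_comp (mF' i)); exact: measurable_fst.
  by apply: (measurableT_comp (mG' j)); exact: measurable_snd.
have h0 z : (0 <= h z)%E by exact: g0.
transitivity (\int[pushforward P pphi]_z h z)%E.
  by rewrite ge0_integral_pushforward // => z _; exact: h0.
transitivity (\int[distribution P pF \x distribution P pG]_z h z)%E.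
  apply: eq_measure_integral => A mA _; apply/esym.
  have mE (A1 : set TF) (A2 : set TG) : measurable A1 -> measurable A2 ->
      pushforward P pphi (A1 `*` A2) = (distribution P pF A1 * distribution P pG A2)%E.
    by move=> mA1 mA2; rewrite /distribution /pushforward -(FG mA1 mA2).
  exact: (product_measure_unique mE mA).
rewrite fubini_tonelli1 //.
rewrite ge0_integral_pushforward //=.
- apply: eq_integral => w _; rewrite /fubini_F /= ge0_integral_pushforward //=.
  by apply: measurable_fun_pair2.
- exact: measurable_fun_fubini_tonelli_F.
- by move=> w _; apply: integral_ge0.
Qed.
End decoupling.
Section independence.
Context d (T : measurableType d) {R : realType} (P : probability T R).
Lemma gen_sigma_measurable {K : Type} (F : K -> T -> R) :
  (forall k, measurable_fun setT (F k)) -> gen_sigma F `<=` measurable.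
Proof.
move=> mF; apply: smallest_sub; first exact: sigma_algebra_measurable.
by move=> _ [k [B [mB ->]]]; have := mF k measurableT B mB; rewrite setTI.
Qed.
Lemma gen_sigmaI {K : Type} (F : K -> T -> R) A B :
  gen_sigma F A -> gen_sigma F B -> gen_sigma F (A `&` B).
Proof.
move=> FA FB; have sF : sigma_algebra setT (gen_sigma F) by exact: smallest_sigma_algebra.
have [s0 sC sU] := sF.
have cc C : gen_sigma F C -> gen_sigma F (~` C) by rewrite -setTD; exact: sC.
rewrite -(setCK (A `&` B)) setCI; apply: (cc).
rewrite -bigcup2E; apply: sU => -[|[|n]] /=; [exact: cc|exact: cc|exact: s0].
Qed.
Lemma gen_sigmaT {K : Type} (F : K -> T -> R) : gen_sigma F setT.
Proof.
have [s0 sC _] : sigma_algebra setT (gen_sigma F) by exact: smallest_sigma_algebra.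
by rewrite -(setD0 setT); exact: sC.
Qed.
(* Since [indep2] ignores constants, masking the [k]-th family by [0] leaves the
   sigma-algebra generated by the others. *)
Lemma indep_family_others (I : finType) (K : Type) (X : I -> K -> T -> R) (k : I) :
  (forall i j, measurable_fun setT (X i j)) ->
  indep_family P (fun i => gen_sigma (X i)) ->
  indep2 P (gen_sigma (fun ij : I * K => if ij.1 == k then cst 0 else X ij.1 ij.2))
    (gen_sigma (X k)).
Proof.
move=> mX hX A B hA hB.
(* The cylinders that do not constrain the [k]-th family form a pi-system generating the left
   sigma-algebra. *)
pose C := [set A | exists E : I -> set T,
  [/\ forall i, gen_sigma (X i) (E i), E k = setT & A = \bigcap_(i in [set: I]) E i]].
have mB : measurable B by exact: (gen_sigma_measurable (mX k)).
have mC : C `<=` measurable.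
  move=> _ [E [hE _ ->]]; apply: fin_bigcap_measurable => // i _.
  exact: (gen_sigma_measurable (mX i)).
have PBoo : P B \is a fin_num by rewrite fin_num_measure.
have CI : setI_closed C.
  move=> _ _ [E [hE Ek ->]] [E' [hE' Ek' ->]]; exists (fun i => E i `&` E' i); split.
  - by move=> i; apply: gen_sigmaI.
  - by rewrite Ek Ek' setTI.
  - by rewrite bigcapI.
have PC A' : C A' -> P (A' `&` B) = (P A' * P B)%E.
  move=> [E [hE Ek ->]].
  pose E' i := if i == k then B else E i.
  have -> : \bigcap_(i in [set: I]) E i `&` B = \bigcap_(i in [set: I]) E' i.
    apply/seteqP; split => w.
      by move=> [Ew Bw] i _; rewrite /E'; case: eqP => // _; exact: Ew.
    move=> Ew; split => [i _|]; last by have := Ew k Logic.I; rewrite /E' eqxx.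
    by have := Ew i Logic.I; rewrite /E'; case: eqP => // ->; rewrite Ek.
  rewrite (hX E'); last by move=> i; rewrite /E'; case: eqP => // ->.
  rewrite (hX E) // (bigD1 k) //= [in RHS](bigD1 k) //= {1}/E' eqxx Ek.
  rewrite probability_setT mul1e muleC; congr (_ * _)%E.
  by apply: eq_bigr => i /negPf ik; rewrite /E' ik.
have sub : gen_sigma (fun ij : I * K => if ij.1 == k then cst 0 else X ij.1 ij.2) `<=` <<s C >>.
  apply: smallest_sub; first exact: smallest_sigma_algebra.
  move=> _ [[i j] [D [mD ->]]] /=; case: eqP => [_|/eqP ik].
    have [s0 sC _] : sigma_algebra setT <<s C >> by exact: smallest_sigma_algebra.
    have [D0|D0] := pselect (D 0).
      have -> : cst 0 @^-1` D = [set: T] by apply/seteqP; split.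
      by have := sC set0 s0; rewrite setD0.
    by rewrite (_ : _ @^-1` _ = set0)//; apply/seteqP; split.
  apply: sub_sigma_algebra; exists (fun i' => if i' == i then X i j @^-1` D else setT); split.
  - move=> i'; case: eqP => [->|_]; last exact: gen_sigmaT.
    by apply: sub_sigma_algebra; exists j, D.
  - by rewrite eq_sym (negPf ik).
  - apply/seteqP; split => w /=; first by move=> Dw i' _; case: eqP.
    by move/(_ i Logic.I); rewrite eqxx.
have CA : <<s C >> A by exact: sub hA.
pose c := NngNum (fine_ge0 (measure_ge0 P B)).
have cE : (c%:num)%:E = P B by rewrite /c /= fineK.
have sE X' : mscale c P X' = (P B * P X')%E by rewrite -cE.
(* Two finite measures, [P] restricted to [B] and [P B] times [P], agree on the pi-system and hence
   on the sigma-algebra that it generates. *)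
have h : mrestr P mB A = mscale c P A.
  apply: (@g_sigma_algebra_measure_unique _ R T C mC (fun=> setT)) => //.
  - move=> _; exists (fun=> setT); split => //; first by move=> i; exact: gen_sigmaT.
    by rewrite bigcap_const //; exists k.
  - by rewrite bigcup_const //; exists 0%N.
  - by move=> A' CA'; apply: (etrans (PC _ CA')); rewrite muleC; exact/esym/sE.
  - by move=> _; rewrite /= /mrestr setTI ltey_eq PBoo.
by move: h; rewrite sE /mrestr muleC.
Qed.
End independence.

(** * Measurability of functions of the rows *)

Section row_measurability.
Context {R : realType} {p : nat}.
Implicit Types (f g : (nat -> 'cV[R]_p) -> R).
(* Borel measurability of a function of finitely or countably many rows, stated
   through composition with arbitrary random rows. *)
Definition rmeas f := forall dU (U : measurableType dU) (A : U -> nat -> 'cV[R]_p),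
  (forall i j, measurable_fun setT (fun u => A u i j 0)) ->
  measurable_fun setT (fun u => f (A u)).
Definition mxmeas {m q} (F : (nat -> 'cV[R]_p) -> 'M[R]_(m, q)) :=
  forall i j, rmeas (fun a => F a i j).
Lemma rmeas_eq f g : rmeas f -> f =1 g -> rmeas g.
Proof. by move=> mf /funext <-. Qed.
Lemma rmeas_cst c : rmeas (fun=> c).
Proof. by move=> dU U A mA. Qed.
Lemma rmeasD f g : rmeas f -> rmeas g -> rmeas (fun a => f a + g a).
Proof. by move=> mf mg dU U A mA; apply: measurable_funD; [exact: mf|exact: mg]. Qed.
Lemma rmeasN f : rmeas f -> rmeas (fun a => - f a).
Proof. by move=> mf dU U A mA; apply: measurableT_comp => //; exact: mf. Qed.
Lemma rmeasB f g : rmeas f -> rmeas g -> rmeas (fun a => f a - g a).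
Proof. by move=> mf mg; apply: rmeasD => //; exact: rmeasN. Qed.
Lemma rmeasM f g : rmeas f -> rmeas g -> rmeas (fun a => f a * g a).
Proof. by move=> mf mg dU U A mA; apply: measurable_funM; [exact: mf|exact: mg]. Qed.
Lemma measurable_inv d (T : measurableType d) (h : T -> R) :
  measurable_fun setT h -> measurable_fun setT (fun x => (h x)^-1).
Proof.
(* The identity [powR_inv1] asks for a nonnegative base, hence the detour through [h^2]; where [h]
   vanishes both sides are 0. *)
move=> mh; have -> : (fun x => (h x)^-1) = (fun x => h x * powR (h x ^+ 2) (-1)).
  apply/funext => x; rewrite powR_inv1 ?sqr_ge0 // expr2 invfM mulrA.
  by have [->|h0] := eqVneq (h x) 0; rewrite ?invr0 ?mulr0 // mulfV // mul1r.
apply: measurable_funM => //.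
by apply: (measurableT_comp (measurable_powR (-1))); exact: measurable_funX.
Qed.
Lemma rmeasV f : rmeas f -> rmeas (fun a => (f a)^-1).
Proof. by move=> mf dU U A mA; apply: measurable_inv; exact: mf. Qed.
Lemma rmeas_sum I (r : seq I) (F : I -> (nat -> 'cV[R]_p) -> R) :
  (forall i, rmeas (F i)) -> rmeas (fun a => \sum_(i <- r) F i a).
Proof.
by move=> mF dU U A mA; apply: measurable_sum => i; exact: mF.
Qed.
Lemma rmeas_prod I (r : seq I) (F : I -> (nat -> 'cV[R]_p) -> R) :
  (forall i, rmeas (F i)) -> rmeas (fun a => \prod_(i <- r) F i a).
Proof.
move=> mF; elim: r => [|i r IH].
  by apply: (rmeas_eq (rmeas_cst 1)) => a; rewrite big_nil.
by apply: (rmeas_eq (rmeasM (mF i) IH)) => a; rewrite big_cons.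
Qed.
Lemma measurable_ler_ind d (T : measurableType d) (f g : T -> R) :
  measurable_fun setT f -> measurable_fun setT g ->
  measurable_fun setT (fun x => (f x <= g x)%R%:R : R).
Proof.
move=> mf mg.
have -> : (fun x => (f x <= g x)%R%:R : R) = (fun x => if f x <= g x then 1 else 0).
  by apply/funext => x; case: ifP.
by apply: measurable_fun_ifT => //; exact: measurable_fun_ler.
Qed.
Lemma measurable_ltr_ind d (T : measurableType d) (f g : T -> R) :
  measurable_fun setT f -> measurable_fun setT g ->
  measurable_fun setT (fun x => (f x < g x)%R%:R : R).
Proof.
move=> mf mg; rewrite (_ : (fun x => _) = (fun x => 1 - (g x <= f x)%R%:R)).
  by apply: measurable_funB; [exact: measurable_cst|exact: measurable_ler_ind].
by apply/funext => x; rewrite ltNge; case: (_ <= _); rewrite ?subrr ?subr0.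
Qed.
Lemma rmeas_le f g : rmeas f -> rmeas g -> rmeas (fun a => (f a <= g a)%R%:R).
Proof. by move=> mf mg dU U A mA; apply: measurable_ler_ind; [exact: mf|exact: mg]. Qed.
Lemma rmeas_ind_not (b : (nat -> 'cV[R]_p) -> bool) :
  rmeas (fun a => (b a)%:R) -> rmeas (fun a => (~~ b a)%:R).
Proof.
move=> mb; apply: (rmeas_eq (rmeasB (rmeas_cst 1) mb)) => a.
by case: (b a); rewrite ?subrr ?subr0.
Qed.
Lemma rmeas_min f g : rmeas f -> rmeas g -> rmeas (fun a => Num.min (f a) (g a)).
Proof. by move=> mf mg dU U A mA; apply: measurable_minr; [exact: mf|exact: mg]. Qed.
Lemma mxmeas_cst m q (C : 'M[R]_(m, q)) : mxmeas (fun=> C).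
Proof. by move=> i j; exact: rmeas_cst. Qed.
Lemma mxmeas_row k : mxmeas (fun a => a k).
Proof. by move=> i j dU U A mA; rewrite ord1; exact: mA. Qed.
Lemma mxmeasD m q (F G : _ -> 'M[R]_(m, q)) :
  mxmeas F -> mxmeas G -> mxmeas (fun a => F a + G a).
Proof.
by move=> mF mG i j; apply: (rmeas_eq (rmeasD (mF i j) (mG i j))) => a; rewrite mxE.
Qed.
Lemma mxmeasN m q (F : _ -> 'M[R]_(m, q)) : mxmeas F -> mxmeas (fun a => - F a).
Proof.
by move=> mF i j; apply: (rmeas_eq (rmeasN (mF i j))) => a; rewrite mxE.
Qed.
Lemma mxmeasB m q (F G : _ -> 'M[R]_(m, q)) :
  mxmeas F -> mxmeas G -> mxmeas (fun a => F a - G a).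
Proof. by move=> mF mG; apply: mxmeasD => //; exact: mxmeasN. Qed.
Lemma mxmeasZ m q f (F : _ -> 'M[R]_(m, q)) :
  rmeas f -> mxmeas F -> mxmeas (fun a => f a *: F a).
Proof.
by move=> mf mF i j; apply: (rmeas_eq (rmeasM mf (mF i j))) => a; rewrite mxE.
Qed.
Lemma mxmeas_tr m q (F : _ -> 'M[R]_(m, q)) : mxmeas F -> mxmeas (fun a => (F a)^T).
Proof.
by move=> mF i j; apply: (rmeas_eq (mF j i)) => a; rewrite mxE.
Qed.
Lemma mxmeasM m q r (F : _ -> 'M[R]_(m, q)) (G : _ -> 'M[R]_(q, r)) :
  mxmeas F -> mxmeas G -> mxmeas (fun a => F a *m G a).
Proof.
move=> mF mG i j.
apply: (rmeas_eq (rmeas_sum _ (fun k => rmeasM (mF i k) (mG k j)))) => a.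
by rewrite mxE.
Qed.
Lemma rmeas_fsq m q (F : _ -> 'M[R]_(m, q)) : mxmeas F -> rmeas (fun a => fsq (F a)).
Proof.
move=> mF; apply: rmeas_sum => i; apply: rmeas_sum => j.
by apply: (rmeas_eq (rmeasM (mF i j) (mF i j))) => a; rewrite expr2.
Qed.
Lemma mxmeas_pj m (l : seq nat) (V : nat -> (nat -> 'cV[R]_p) -> 'cV[R]_m) :
  (forall i, mxmeas (V i)) -> mxmeas (fun a => pj [seq V i a | i <- l]).
Proof.
move=> mV; elim: l => [|i l IH]; first exact: mxmeas_cst.
have mu : mxmeas (fun a => pj [seq V i a | i <- l] *m V i a) by exact: mxmeasM.
apply: mxmeasB => //; apply: mxmeasZ; first by apply: rmeasV; exact: rmeas_fsq.
by apply: mxmeasM => //; exact: mxmeas_tr.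
Qed.
End row_measurability.
(** * The row-by-row recursion for the minimal-norm interpolator *)
Section minimal_norm_process.
Context {R : realFieldType} {p q : nat}.
Variables (S : 'M[R]_p) (Wst : 'M[R]_(p, q)) (s : nat -> 'rV[R]_q).
Implicit Types (a : nat -> 'cV[R]_p) (k : nat).
(** Reversed because [pj] processes the head of its list last: passing from [k] to [k.+1] is then a
    single update of the projection. *)
Definition prefix_idx k : seq nat := rev (iota 0 k).
Lemma prefix_idxS k : prefix_idx k.+1 = k :: prefix_idx k.
Proof. by rewrite /prefix_idx -[k.+1]addn1 iotaD rev_cat. Qed.
Lemma mem_prefix_idx k i : (i \in prefix_idx k) = (i < k)%N.
Proof. by rewrite mem_rev mem_iota. Qed.
Definition Mk a k := pj [seq a i | i <- prefix_idx k].
Definition uk a k := Mk a k *m a k.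
Definition bk a k := fsq (uk a k).
Definition resp a k : 'rV[R]_q := (a k)^T *m Wst + s k.
(* [Wk a k] is the minimal-norm interpolator of the first [k] responses. *)
Fixpoint Wk a k : 'M[R]_(p, q) :=
  if k is k'.+1 then
    Wk a k' + (bk a k')^-1 *: (uk a k' *m (resp a k' - (a k')^T *m Wk a k'))
  else 0.
Definition Dk a k := Wk a k - Wst.
Definition ek a k : 'rV[R]_q := s k - (a k)^T *m Dk a k.
(* Given the first [k] rows, [tk] is the mean of [bk] and [2 * Qk] its variance;
   [Phik] is the excess risk of [Wk]. *)
Definition tk a k := fsq (Mk a k *m S).
Definition Qk a k := fsq (S *m Mk a k *m S).
Definition Phik a k := fsq (S *m Dk a k).
Lemma MkS a k : Mk a k.+1 = pupd (a k) (Mk a k).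
Proof. by rewrite /Mk prefix_idxS. Qed.
Lemma Mk_sym a k : (Mk a k)^T = Mk a k. Proof. exact: pj_sym. Qed.
Lemma Mk_idem a k : Mk a k *m Mk a k = Mk a k. Proof. exact: pj_idem. Qed.
Lemma ekE a k : ek a k = resp a k - (a k)^T *m Wk a k.
Proof. by rewrite /ek /resp /Dk mulmxBr opprB addrA (addrC (s k)). Qed.
Lemma WkS a k : Wk a k.+1 = Wk a k + (bk a k)^-1 *: (uk a k *m ek a k).
Proof. by rewrite /= ekE. Qed.
Lemma DkS a k : Dk a k.+1 = Dk a k + (bk a k)^-1 *: (uk a k *m ek a k).
Proof. by rewrite /Dk WkS addrAC. Qed.
Lemma Mk_uk a k : Mk a k *m uk a k = uk a k.
Proof. by rewrite /uk mulmxA Mk_idem. Qed.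
(** The columns of [Wk a k] lie in the span of the first [k] rows. This makes the increments of the
    process orthogonal to its past. *)
Lemma Mk_Wk a k : Mk a k *m Wk a k = 0.
Proof.
elim: k => [|k IH]; first by rewrite mulmx0.
have h (v : 'cV[R]_p) : v \in [seq a i | i <- prefix_idx k.+1] -> v^T *m Mk a k.+1 = 0.
  by move=> vl; rewrite -(trmxK (v^T *m _)) trmx_mul trmxK Mk_sym pj_mem ?trmx0.
rewrite WkS mulmxDr -scalemxAr.
have -> : Mk a k.+1 *m Wk a k = 0.
  rewrite -[Mk a k.+1](@pj_subr _ _ [seq a i | i <- prefix_idx k]) -?mulmxA ?IH ?mulmx0 //.
  by move=> v; rewrite prefix_idxS inE => ->; rewrite orbT.
rewrite mulmxA /uk mulmxA (_ : Mk a k.+1 *m Mk a k = Mk a k.+1); last first.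
  by apply: pj_subr => v; rewrite prefix_idxS inE => ->; rewrite orbT.
by rewrite pj_mem ?prefix_idxS ?inE ?eqxx // mul0mx scaler0 addr0.
Qed.
(** Pythagoras for the rank-one increment. If [bk a k] is 0, so are [uk a k] and, by the convention
    for inverses, the quotient. *)
Lemma fsq_WkS a k : fsq (Wk a k.+1) = fsq (Wk a k) + fsq (ek a k) / bk a k.
Proof.
rewrite WkS fsqD -scalemxAr mxtraceZ mulmxA -{1}(Mk_uk a k) mulmxA.
rewrite -{1}(Mk_sym a k) -trmx_mul Mk_Wk trmx0 !mul0mx mxtrace0 !mulr0 addr0; congr (_ + _).
rewrite fsqZ fsqE trmx_mul -mulmxA (mulmxA (uk a k)^T) fsq_cV1 mul_scalar_mx -scalemxAr.
rewrite mxtraceZ -fsqE -/(bk a k) exprVn.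
have [->|b0] := eqVneq (bk a k) 0; first by rewrite invr0 mul0r !mulr0.
by field.
Qed.
Lemma fsq_Wk_sum a k0 n : (k0 <= n)%N ->
  \sum_(k0 <= k < n) fsq (ek a k) / bk a k <= fsq (Wk a n).
Proof.
move=> k0n; have -> : \sum_(k0 <= k < n) fsq (ek a k) / bk a k = fsq (Wk a n) - fsq (Wk a k0).
  rewrite -(telescope_sumr (fun k => fsq (Wk a k)) k0n); apply: eq_bigr => k _.
  by rewrite fsq_WkS addrAC subrr add0r.
by rewrite gerBl fsq_ge0.
Qed.
(* The linear part of [Phik] in the rank-one update. *)
Definition hk a k := \tr (s k *m ((S *m Dk a k)^T *m S *m Mk a k) *m a k)
  - \tr (((Dk a k)^T *m a k)^T *m ((Dk a k)^T *m S *m S *m Mk a k *m a k)).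
Hypothesis sS : S^T = S.
Lemma hkE a k : hk a k = \tr ((S *m Dk a k)^T *m (S *m (uk a k *m ek a k))).
Proof.
have -> : \tr ((S *m Dk a k)^T *m (S *m (uk a k *m ek a k))) =
    \tr (ek a k *m ((S *m Dk a k)^T *m S *m uk a k)).
  by rewrite [RHS]mxtrace_mulC !mulmxA.
rewrite /ek mulmxBl raddfB /= /uk /hk; congr (_ - _).
  by rewrite !mulmxA.
by rewrite !trmx_mul trmxK sS !mulmxA.
Qed.
Lemma PhikS a k : Phik a k.+1 <=
  Phik a k + 2 * (bk a k)^-1 * hk a k + fsq (ek a k) * fsq (S *m Mk a k *m a k) / bk a k ^+ 2.
Proof.
rewrite /Phik DkS mulmxDr -scalemxAr fsqD -scalemxAr mxtraceZ fsqZ -hkE.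
rewrite mulrA lerD2l mulmxA exprVn mulrC ler_wpM2r ?invr_ge0 ?sqr_ge0 //.
by rewrite mulrC /uk mulmxA fsqM_le.
Qed.
Lemma trQ a k : Qk a k = fsq (Mk a k *m S *m (Mk a k *m S)^T).
Proof.
have e : fsq (Mk a k *m S *m (Mk a k *m S)^T) =
    \tr (Mk a k *m (S *m S) *m Mk a k *m (S *m S)).
  rewrite fsqE !trmx_mul !trmxK sS Mk_sym !mulmxA -(mulmxA _ (Mk a k) (Mk a k)) Mk_idem.
  rewrite mxtrace_mulC !mulmxA Mk_idem mxtrace_mulC.
  by rewrite -!mulmxA.
rewrite e /Qk fsqE !trmx_mul sS Mk_sym -!mulmxA mxtrace_mulC -!mulmxA.
by rewrite mxtrace_mulC -!mulmxA.
Qed.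
(** Telescoping this identity is what later bounds the sum of the [Qk], since the decrement has a
    conditional mean of order [Qk / tk]. *)
Lemma tkS a k : tk a k.+1 = tk a k - fsq (S *m Mk a k *m a k) / bk a k.
Proof.
have tE j : tk a j = \tr (S *m Mk a j *m S).
  by rewrite /tk fsqE trmx_mul sS Mk_sym !mulmxA -(mulmxA S (Mk a j) (Mk a j)) Mk_idem.
rewrite !tE MkS /pupd -/(uk a k) mulmxBr mulmxBl raddfB /= -scalemxAr -scalemxAl mxtraceZ.
congr (_ - _); rewrite mulrC; congr (_ * _).
have -> : S *m (uk a k *m (uk a k)^T) *m S = (S *m uk a k) *m (S *m uk a k)^T.
  by rewrite [(S *m _)^T]trmx_mul sS !mulmxA.
by rewrite mxtrace_mulC -fsqE /uk mulmxA.
Qed.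
End minimal_norm_process.
Section process_dependence.
Context {R : realFieldType} {p q : nat}.
Variables (S : 'M[R]_p) (Wst : 'M[R]_(p, q)) (s : nat -> 'rV[R]_q).
Implicit Types (a : nat -> 'cV[R]_p) (k : nat).
(** Conditioning on the other rows is realised as integration over a fresh row [x] with [a] fixed;
    the lemmas below say which quantities the substitution leaves unchanged. *)
Definition updr a k (x : 'cV[R]_p) := fun i => if i == k then x else a i.
Lemma updr_id a k x : updr a k x k = x. Proof. by rewrite /updr eqxx. Qed.
Lemma map_updr a k x (l : seq nat) : k \notin l ->
  [seq updr a k x i | i <- l] = [seq a i | i <- l].
Proof.
move=> kl; apply/eq_in_map => i il; rewrite /updr; case: eqP => // ik.
by rewrite -ik il in kl.
Qed.
Lemma Mk_updr a j k x : (j <= k)%N -> Mk (updr a k x) j = Mk a j.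
Proof. by move=> jk; rewrite /Mk map_updr // mem_prefix_idx ltnNge jk. Qed.
Lemma Wk_updr a j k x : (j <= k)%N -> Wk Wst s (updr a k x) j = Wk Wst s a j.
Proof.
elim: j => // j IH jk.
by rewrite /= IH ?(ltnW jk) // /bk /uk /resp Mk_updr ?(ltnW jk) // /updr ltn_eqF.
Qed.
Lemma Dk_updr a j k x : (j <= k)%N -> Dk Wst s (updr a k x) j = Dk Wst s a j.
Proof. by move=> jk; rewrite /Dk Wk_updr. Qed.
Lemma tk_updr a j k x : (j <= k)%N -> tk S (updr a k x) j = tk S a j.
Proof. by move=> jk; rewrite /tk Mk_updr. Qed.
Lemma Qk_updr a j k x : (j <= k)%N -> Qk S (updr a k x) j = Qk S a j.
Proof. by move=> jk; rewrite /Qk Mk_updr. Qed.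
Lemma Phik_updr a j k x : (j <= k)%N -> Phik S Wst s (updr a k x) j = Phik S Wst s a j.
Proof. by move=> jk; rewrite /Phik Dk_updr. Qed.
Lemma bk_updr a j k x : (j < k)%N -> bk (updr a k x) j = bk a j.
Proof. by move=> jk; rewrite /bk /uk Mk_updr ?(ltnW jk) // /updr ltn_eqF. Qed.
Lemma bk_updr_id a k x : bk (updr a k x) k = fsq (Mk a k *m x).
Proof. by rewrite /bk /uk Mk_updr // updr_id. Qed.
Lemma ek_updr_id a k x : ek Wst s (updr a k x) k = s k - x^T *m Dk Wst s a k.
Proof. by rewrite /ek Dk_updr // updr_id. Qed.
(** Any exact solution projects to the process. Applied to an explicit solution it bounds the norm
    of [Wk]; applied to a solution of the original system it shows that the process has minimal
    norm. *)
Lemma Wk_solution a k (Z : 'M[R]_(p, q)) :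
  (forall i, (i < k)%N -> (a i)^T *m Z = resp Wst s a i) ->
  Wk Wst s a k = (1%:M - Mk a k) *m Z.
Proof.
elim: k => [_|k IH hZ]; first by rewrite /Mk /= subrr mul0mx.
rewrite /= IH => [|i ik]; last by rewrite hZ // ltnS ltnW.
rewrite -hZ // MkS /pupd -/(uk a k) opprB addrCA [X in _ = X *m _]addrC.
rewrite [RHS]mulmxDl; congr (_ + _); rewrite -scalemxAl -mulmxA; congr (_ *: (_ *m _)).
rewrite mulmxBl mul1mx mulmxBr opprB addrCA subrr addr0.
by rewrite /uk trmx_mul Mk_sym mulmxA.
Qed.
End process_dependence.
(** * Moment bounds for one new row *)
Section one_step.
Context d (T : measurableType d) {R : realType} (P : probability T R) {p q : nat}.
Variables (x : T -> 'cV[R]_p) (S : 'M[R]_p).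
Hypothesis sS : S^T = S.
Hypothesis hx : gauss_moments P x S.
Variable M : 'M[R]_p.
Hypothesis sM : M^T = M.
Hypothesis iM : M *m M = M.
Notation t := (fsq (M *m S)).
Notation Q := (fsq (S *m M *m S)).
Notation b := (fun w => fsq (M *m x w)).
Lemma MS_gram : M *m S *m (M *m S)^T = M *m S *m S *m M.
Proof. by rewrite trmx_mul sS sM !mulmxA. Qed.
Lemma fsq_MSSM : fsq (M *m S *m (M *m S)^T) = Q.
Proof.
rewrite !fsqE !trmx_mul !trmxK sS sM !mulmxA -(mulmxA _ M M) iM.
rewrite [LHS]mxtrace_mulC !mulmxA iM.
by rewrite [LHS]mxtrace_mulC !mulmxA.
Qed.
Lemma fsq_SMS_le : Q <= t ^+ 2.
Proof. by rewrite -fsq_MSSM; apply: le_trans (fsqM_le _ _) _; rewrite fsq_tr expr2. Qed.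
Lemma proj_meas : measurable_fun setT b.
Proof. exact: has_mean_measurable (gm2 hx M). Qed.
Lemma proj_mean : has_mean P b t. Proof. exact: (gm2 hx M). Qed.
Lemma proj_var c : has_mean P (fun w => (b w - c) ^+ 2) (2 * Q + (t - c) ^+ 2).
Proof.
have h := has_meanD (has_meanB (gm4 hx M M) (has_meanZ (2 * c) proj_mean)) (has_mean_cst P (c ^+ 2)).
apply: has_mean_eq h _ _ => [w /=|]; first by ring.
rewrite fsq_MSSM; ring.
Qed.
Lemma chebyshev_lower (c r : R) : 0 < r -> c + r <= t ->
  (\int[P]_w ((b w <= c)%R%:R : R)%:E <= (2 * Q / r ^+ 2)%:E)%E.
Proof.
move=> r0 cr; have h := has_meanZ (r ^- 2) (proj_var t).
have -> : 2 * Q / r ^+ 2 = r ^- 2 * (2 * Q + (t - t) ^+ 2).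
  by rewrite subrr expr0n /= addr0 mulrC.
apply: integral_le_mean h _ => [||w].
- by apply: measurable_ler_ind => //; exact: proj_meas.
- by move=> w; exact: ler0n.
- case: (leP (b w) c) => [bc|_]; last by rewrite mulr_ge0 ?invr_ge0 ?sqr_ge0.
  rewrite mulrC ler_pdivlMr ?exprn_gt0 // mul1r -(sqrrN (b w - t)) opprB.
  by rewrite ler_sqr ?nnegrE ?(ltW r0) //; lra.
Qed.
Lemma chebyshev_upper (c r : R) : 0 < r -> t + r <= c ->
  (\int[P]_w ((c <= b w)%R%:R : R)%:E <= (2 * Q / r ^+ 2)%:E)%E.
Proof.
move=> r0 cr; have h := has_meanZ (r ^- 2) (proj_var t).
have -> : 2 * Q / r ^+ 2 = r ^- 2 * (2 * Q + (t - t) ^+ 2).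
  by rewrite subrr expr0n /= addr0 mulrC.
apply: integral_le_mean h _ => [||w].
- by apply: measurable_ler_ind => //; exact: proj_meas.
- by move=> w; exact: ler0n.
- case: (leP c (b w)) => [bc|_]; last by rewrite mulr_ge0 ?invr_ge0 ?sqr_ge0.
  rewrite mulrC ler_pdivlMr ?exprn_gt0 // mul1r.
  by rewrite ler_sqr ?nnegrE ?(ltW r0) //; lra.
Qed.
(* Paley-Zygmund, from [1_{z > 0} >= 2 c z - c^2 z^2]. *)
Lemma small_ball (th : R) : 0 < t -> 0 <= th <= 1 ->
  (((1 - th) ^+ 2 / 3)%:E <= \int[P]_w ((~~ (b w <= th * t)%R)%:R : R)%:E)%E.
Proof.
(* This [c] maximises [2 c (1 - th) t - 3 c^2 t^2], where [3 t^2] bounds the second moment because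
   [Q <= t^2]. *)
move=> t0 /andP[th0 th1]; pose c := (1 - th) / (3 * t).
have c0 : 0 <= c by rewrite divr_ge0 ?mulr_ge0 ?(ltW t0) //; lra.
have h1 := has_meanB proj_mean (has_mean_cst P (th * t)).
have h := has_meanB (has_meanZ (2 * c) h1) (has_meanZ (c ^+ 2) (proj_var (th * t))).
apply: (@le_trans _ _ (2 * c * (t - th * t) - c ^+ 2 * (2 * Q + (t - th * t) ^+ 2))%:E).
  rewrite lee_fin; have := fsq_SMS_le; set q2 := Q => q2t.
  have h3 : c ^+ 2 * (2 * q2 + (t - th * t) ^+ 2) <= c ^+ 2 * (3 * t ^+ 2).
    apply: ler_wpM2l; first exact: sqr_ge0.
    have : (t - th * t) ^+ 2 <= t ^+ 2.
      rewrite ler_sqr ?nnegrE ?(ltW t0) //; nra.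
    by lra.
  have e1 : c ^+ 2 * (3 * t ^+ 2) = (1 - th) ^+ 2 / 3.
    by rewrite /c; field; rewrite lt0r_neq0.
  have e2 : 2 * c * (t - th * t) = 2 * ((1 - th) ^+ 2 / 3).
    by rewrite /c; field; rewrite lt0r_neq0.
  by lra.
apply: mean_le_integral h _ => [||w].
- have -> : (fun w => ((~~ (b w <= th * t))%:R : R)) = (fun w => 1 - ((b w <= th * t)%R)%:R).
    by apply/funext => w; case: (_ <= _); rewrite ?subr0 ?subrr.
  by apply: measurable_funB => //; apply: measurable_ler_ind => //; exact: proj_meas.
- by move=> w; exact: ler0n.
- set z := b w - th * t; have := sqr_ge0 (c * z - 1).
  case: (leP (b w) (th * t)) => [bt|bt] /= h2; last by rewrite mulr1n; nra.
  have z0 : z <= 0 by rewrite subr_le0.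
  have : c * z <= 0 by rewrite mulr_ge0_le0.
  by have := sqr_ge0 (c * z); rewrite exprMn; nra.
Qed.
(** The tangent to [1 / b] at [b = 3 t] gives [1 / b >= 2 c - c^2 b] with [c = 1 / (3 t)], so only
    the means of [v] and [v b] are needed, where [v] is the numerator; the latter is at most
    [3 Q t]. Where [b] vanishes, so does [v]. *)
Lemma ratio_mean_ge (f : T -> R) : 0 < t -> measurable_fun setT f ->
  (forall w, f w = fsq (S *m M *m x w) / b w) ->
  ((Q / (3 * t))%:E <= \int[P]_w (f w)%:E)%E.
Proof.
move=> t0 mf fE; pose c := (3 * t)^-1.
have h := has_meanB (has_meanZ (2 * c) (gm2 hx (S *m M))) (has_meanZ (c ^+ 2) (gm4 hx (S *m M) M)).
apply: (@le_trans _ _ (2 * c * Q - c ^+ 2 * (Q * t + 2 * fsq (S *m M *m S *m (M *m S)^T)))%:E).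
  rewrite lee_fin; have h3 : fsq (S *m M *m S *m (M *m S)^T) <= Q * t.
    by apply: le_trans (fsqM_le _ _) _; rewrite fsq_tr.
  have : c ^+ 2 * (Q * t + 2 * fsq (S *m M *m S *m (M *m S)^T)) <= c ^+ 2 * (3 * Q * t).
    by apply: ler_wpM2l; [exact: sqr_ge0|lra].
  have -> : c ^+ 2 * (3 * Q * t) = Q / (3 * t) by rewrite /c; field; rewrite lt0r_neq0.
  have -> : 2 * c * Q = 2 * (Q / (3 * t)) by rewrite /c; field; rewrite lt0r_neq0.
  by lra.
apply: mean_le_integral h _ => [//||w]; first by move=> w; rewrite fE divr_ge0 ?fsq_ge0.
rewrite fE; set v := fsq _; have v0 : 0 <= v by exact: fsq_ge0.
have [b0|b0] := eqVneq (b w) 0.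
  have : v = 0.
    by move/eqP: b0; rewrite fsq_eq0 /v -mulmxA => /eqP ->; rewrite mulmx0 fsq0.
  by move=> ->; rewrite !(mul0r, mulr0) subrr.
have bp : 0 < b w by rewrite lt_def b0 fsq_ge0.
rewrite -subr_ge0.
have -> : v / b w - (2 * c * v - c ^+ 2 * (v * b w)) = v / b w * (1 - c * b w) ^+ 2.
  by field; rewrite lt0r_neq0.
by rewrite mulr_ge0 ?sqr_ge0 // divr_ge0 ?fsq_ge0.
Qed.
Variables (D : 'M[R]_(p, q)) (s : 'rV[R]_q).
Hypothesis s1 : fsq s <= 1.
Notation Phi := (fsq (S *m D)).
Notation e := (fun w => s - (x w)^T *m D).
Lemma fsq_DTS m (B : 'M[R]_(p, m)) : fsq (B^T *m S) = fsq (S *m B).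
Proof. by rewrite -fsq_tr trmx_mul trmxK sS. Qed.
Lemma fsq_resid w : fsq (e w) =
  fsq s + fsq (D^T *m x w) - 2 * \tr ((D *m s^T)^T *m x w).
Proof.
rewrite fsqD fsqN mulmxN raddfN /= -(fsq_tr (_ *m D)) trmx_mul trmxK.
have -> : \tr (s^T *m ((x w)^T *m D)) = \tr ((D *m s^T)^T *m x w).
  rewrite -mxtrace_tr !trmx_mul !trmxK -[RHS]mxtrace_tr !trmx_mul !trmxK.
  by rewrite mxtrace_mulC -[RHS]mxtrace_tr !trmx_mul !trmxK !mulmxA.
by rewrite mulrN addrAC.
Qed.
Lemma resid_mean : has_mean P (fun w => fsq (e w)) (fsq s + Phi).
Proof.
have h := has_meanB (has_meanD (has_mean_cst P (fsq s)) (gm2 hx D^T))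
  (has_meanZ 2 (gm1 hx (D *m s^T))).
apply: has_mean_eq h _ _ => [w|]; first by rewrite fsq_resid.
by rewrite mulr0 subr0 fsq_DTS.
Qed.
Lemma resid_meas : measurable_fun setT (fun w => fsq (e w)).
Proof. exact: has_mean_measurable resid_mean. Qed.
Lemma fsq_resid_le w : fsq (e w) <= 2 + 2 * fsq (D^T *m x w).
Proof.
apply: le_trans (fsqD_le _ _) _; rewrite fsqN -(fsq_tr (_ *m D)) trmx_mul trmxK.
by rewrite lerD2r -[leRHS]mulr1 ler_wpM2l.
Qed.
Lemma resid_mean4 : (\int[P]_w (fsq (e w) ^+ 2)%:E <= (12 * (1 + Phi) ^+ 2)%:E)%E.
Proof.
have h := has_meanD (has_meanD (has_mean_cst P 4) (has_meanZ 8 (gm2 hx D^T)))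
  (has_meanZ 4 (gm4 hx D^T D^T)).
apply: (@le_trans _ _ (4 + 8 * fsq (D^T *m S) +
  4 * (fsq (D^T *m S) * fsq (D^T *m S) + 2 * fsq (D^T *m S *m (D^T *m S)^T)))%:E).
  apply: integral_le_mean h _ => [||w].
  - by apply: measurable_funX; exact: resid_meas.
  - by move=> w; exact: sqr_ge0.
  - have := fsq_resid_le w; have := fsq_ge0 (e w); set f := fsq (D^T *m _) => e0 ef.
    have : fsq (e w) ^+ 2 <= (2 + 2 * f) ^+ 2.
      by rewrite ler_sqr ?nnegrE // (le_trans e0).
    by rewrite /=; lra.
rewrite lee_fin; have := fsqM_le (D^T *m S) (D^T *m S)^T; rewrite fsq_tr fsq_DTS.
have := fsq_ge0 (S *m D); nra.
Qed.
(** Cauchy-Schwarz bounds the left norm by [Phi] times the root of [Q]; the free parameter [c]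
    removes the root by the arithmetic-geometric inequality. *)
Lemma fsq_DSSM_le (c : R) : 0 < c ->
  2 * fsq (D^T *m S *m (M *m S)^T) <= Phi * (c + Q / c).
Proof.
move=> c0; have F0 := fsq_ge0 (S *m D); have Q0 := fsq_ge0 (S *m M *m S).
set X := fsq _; have X0 : 0 <= X by exact: fsq_ge0.
have cQ : 4 * Q <= (c + Q / c) ^+ 2.
  rewrite -subr_ge0; have -> : (c + Q / c) ^+ 2 - 4 * Q = (c - Q / c) ^+ 2.
    by field; rewrite lt0r_neq0.
  exact: sqr_ge0.
have cp : 0 <= c + Q / c by rewrite addr_ge0 ?divr_ge0 // ltW.
have X2 : X ^+ 2 <= Phi ^+ 2 * Q.
  have -> : X = \tr ((S *m D *m (S *m D)^T)^T *m (S *m M *m S)).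
    transitivity (\tr (D^T *m S *m S *m M *m S *m (S *m D))).
      rewrite /X fsqE [LHS]mxtrace_mulC !trmx_mul !trmxK sS sM !mulmxA.
      by rewrite -(mulmxA _ M M) iM.
    by rewrite mxtrace_mulC !trmx_mul !trmxK sS !mulmxA.
  apply: le_trans (tr_mul_sq_le _ _) _; apply: ler_wpM2r => //.
  by apply: le_trans (fsqM_le _ _) _; rewrite fsq_tr expr2.
rewrite -ler_sqr ?nnegrE ?mulr_ge0 //.
have := ler_wpM2l (sqr_ge0 Phi) cQ.
by rewrite !exprMn; lra.
Qed.
(** The term of odd degree, [- 2 l b] with [l] linear in the row, is a third moment and is not among
    the available ones. It is split as [- 2 l t], of mean 0, plus [- 2 l (b - t)], which is at most
    [c l^2 + (b - t)^2 / c]. *)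
Lemma resid_proj_mean_le (c : R) : 0 < c ->
  (\int[P]_w (fsq (e w) * b w)%:E <= ((1 + Phi) * (t + 2 * c + 3 * Q / c))%:E)%E.
Proof.
move=> c0; pose v := D *m s^T.
have h := has_meanD (has_meanD (has_meanD (has_meanZ (fsq s) proj_mean) (gm4 hx D^T M))
  (has_meanZ (- 2 * t) (gm1 hx v)))
  (has_meanD (has_meanZ c (gm2 hx v^T)) (has_meanZ c^-1 (proj_var t))).
have F0 := fsq_ge0 (S *m D); have Q0 := fsq_ge0 (S *m M *m S).
have t0 := fsq_ge0 (M *m S).
apply: (@le_trans _ _ (fsq s * t + (fsq (D^T *m S) * t + 2 * fsq (D^T *m S *m (M *m S)^T)) +
    (-2 * t * 0) + (c * fsq (v^T *m S) + c^-1 * (2 * Q + (t - t) ^+ 2)))%:E).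
  apply: integral_le_mean h _ => [||w].
  - by apply: measurable_funM; [exact: resid_meas|exact: proj_meas].
  - by move=> w; rewrite mulr_ge0 ?fsq_ge0.
  - rewrite fsq_resid -/v; set l := \tr _.
    have -> : fsq (v^T *m x w) = l ^+ 2.
      by rewrite /fsq big_ord1 big_ord1 /l /mxtrace big_ord1.
    have : - (2 * l * (b w - t)) <= c * l ^+ 2 + c^-1 * (b w - t) ^+ 2.
      rewrite -subr_ge0.
      have -> : c * l ^+ 2 + c^-1 * (b w - t) ^+ 2 - - (2 * l * (b w - t)) =
        c^-1 * (c * l + (b w - t)) ^+ 2 by field; rewrite lt0r_neq0.
      by rewrite mulr_ge0 ?invr_ge0 ?sqr_ge0 // ltW.
    by rewrite /=; lra.
rewrite lee_fin subrr expr0n /= addr0 mulr0 addr0 fsq_DTS.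
have h1 := fsq_DSSM_le c0.
have h2 : fsq (v^T *m S) <= Phi.
  rewrite fsq_DTS /v mulmxA; apply: le_trans (fsqM_le _ _) _.
  by rewrite fsq_tr -[leRHS]mulr1 ler_wpM2l.
have h3 : c * fsq (v^T *m S) <= c * Phi by rewrite ler_wpM2l // ltW.
have h4 : fsq s * t <= t by rewrite ler_piMl.
have Qc : 0 <= Q / c by rewrite divr_ge0 // ltW.
have -> : c^-1 * (2 * Q) = 2 * (Q / c) by field; rewrite lt0r_neq0.
have -> : 3 * Q / c = 3 * (Q / c) by rewrite mulrA.
by nra.
Qed.
Let lin w := \tr (s *m ((S *m D)^T *m S *m M) *m x w).
Let cross w := \tr ((D^T *m x w)^T *m (D^T *m S *m S *m M *m x w)).
Notation h := (fun w => lin w - cross w).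
(** The linear part [h] of the risk update thus has nonpositive mean: on average it lowers the risk,
    and only second-order terms can raise it. *)
Let cross_mean_ge0 : 0 <= \tr ((D^T *m S)^T *m (D^T *m S *m S *m M *m S)).
Proof.
have -> : \tr ((D^T *m S)^T *m (D^T *m S *m S *m M *m S)) = fsq (M *m S *m S *m D).
  rewrite mxtrace_mulC fsqE !trmx_mul !trmxK sS sM !mulmxA.
  by rewrite -(mulmxA _ M M) iM.
exact: fsq_ge0.
Qed.
Let h_sqr_le w : h w ^+ 2 <= (2 + 2 * fsq (D^T *m x w)) * fsq (D^T *m S *m S *m M *m x w).
Proof.
have -> : h w = \tr (((e w)^T)^T *m (D^T *m S *m S *m M *m x w)).
  by rewrite /lin /cross trmxK mulmxBl raddfB /= !trmx_mul !trmxK sS !mulmxA.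
apply: le_trans (tr_mul_sq_le _ _) _; rewrite fsq_tr.
by apply: ler_wpM2r; [exact: fsq_ge0|exact: fsq_resid_le].
Qed.
(** The factor [1 / b] depends on the same row as [h]. Replacing it by [1 / t] leaves a term of
    nonpositive mean, and the error, of size [|h| |b - t| / (b t)], is quadratic in fluctuations and
    hence of order [(1 + Phi) Q / tau^2]. *)
Lemma drift_bound (tau : R) (Phn : T -> R) : 0 < tau -> 3 / 4 * tau <= t ->
  measurable_fun setT Phn -> (forall w, 0 <= Phn w) ->
  (forall w, Phn w <= Phi + 2 * (b w)^-1 * h w +
     fsq (e w) * fsq (S *m M *m x w) / b w ^+ 2) ->
  (\int[P]_w ((tau / 2 <= b w)%R%:R * (1 + Phn w))%:E <=
     ((1 + Phi) * (1 + 72 * Q / tau ^+ 2))%:E)%E.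
Proof.
move=> tau0 ht mPhn Phn0 PhnE.
have F0 := fsq_ge0 (S *m D); have Q0 := fsq_ge0 (S *m M *m S).
have t0 : 0 < t by apply: lt_le_trans ht; rewrite mulr_gt0.
pose g w := fsq (D^T *m S *m S *m M *m x w).
pose f w := fsq (D^T *m x w).
pose v w := fsq (S *m M *m x w).
have h1 := has_meanZ (2 / t) (has_meanB (gm1 hx (s *m ((S *m D)^T *m S *m M))^T)
   (gm_bilin D^T (D^T *m S *m S *m M) hx)).
have h2 := has_meanZ (1 + Phi)^-1 (has_meanD (has_meanZ 2 (gm2 hx (D^T *m S *m S *m M)))
   (has_meanZ 2 (gm4 hx D^T (D^T *m S *m S *m M)))).
have h3 := has_meanZ (6 / tau ^+ 2) (has_meanD h2 (has_meanZ (1 + Phi) (proj_var t))).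
have h4 := has_meanZ (4 / tau ^+ 2) (has_meanD (has_meanZ 2 (gm2 hx (S *m M)))
   (has_meanZ 2 (gm4 hx D^T (S *m M)))).
have H := has_meanD (has_meanD (has_mean_cst P (1 + Phi)) h1) (has_meanD h3 h4).
pose Bnd := (1 + Phi) * (1 + 72 * Q / tau ^+ 2).
move: H; set m := (X in has_mean _ _ X); move=> H.
apply: (@le_trans _ _ m%:E); last first.
  (* In units of [1 / tau^2] the contributions in [Phi Q] are 36 and 12 from the error of replacing
     [b] by [t] and 24 from the quadratic term: together 72, while those in [Q] alone add up to
     20. *)
  rewrite lee_fin /m subrr expr0n /= addr0 sub0r fsq_DTS.
  have := cross_mean_ge0; set cm := \tr _ => cm0.
  have gQ : fsq (D^T *m S *m S *m M *m S) <= Phi * Q.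
    have -> : D^T *m S *m S *m M *m S = (D^T *m S) *m (S *m M *m S) by rewrite !mulmxA.
    by apply: le_trans (fsqM_le _ _) _; rewrite fsq_DTS.
  have i1 : (1 + Phi)^-1 * (2 * fsq (D^T *m S *m S *m M *m S) +
      2 * (Phi * fsq (D^T *m S *m S *m M *m S) +
      2 * fsq (D^T *m S *m (D^T *m S *m S *m M *m S)^T))) <= 6 * Phi * Q.
    rewrite mulrC ler_pdivrMr; last by lra.
    have : fsq (D^T *m S *m (D^T *m S *m S *m M *m S)^T) <=
        Phi * fsq (D^T *m S *m S *m M *m S).
      by apply: le_trans (fsqM_le _ _) _; rewrite fsq_tr fsq_DTS.
    have := ler_wpM2l F0 gQ; have := mulr_ge0 F0 Q0.
    by nra.
  have i2 : fsq (D^T *m S *m (S *m M *m S)^T) <= Phi * Q.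
    by apply: le_trans (fsqM_le _ _) _; rewrite fsq_tr fsq_DTS.
  have y0 : 0 <= tau ^- 2 by rewrite invr_ge0 sqr_ge0.
  have i3 : 0 <= 2 / t * cm by rewrite mulr_ge0 // divr_ge0 // ltW.
  have i4 := ler_wpM2l y0 i1; have i5 := ler_wpM2l y0 i2.
  have i6 : 0 <= tau ^- 2 * Q by rewrite mulr_ge0.
  by nra.
have tt := sqr_ge0 tau.
apply: integral_le_mean H _ => [||w].
- apply: measurable_funM; last by apply: measurable_funD.
  by apply: measurable_ler_ind => //; exact: proj_meas.
- by move=> w; rewrite mulr_ge0 ?ler0n // addr_ge0.
- rewrite /= trmxK -/(lin w) -/(cross w).
  have hs := h_sqr_le w; move: (PhnE w) hs (fsq_resid_le w); rewrite -/(f w) -/(g w) -/(v w).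
  move: (lin w - cross w) => hw; move: (Phn w) (fsq_ge0 (e w)) => ph.
  move: (fsq (e w)) => ee ee0 phE hs ee2.
  have f0 : 0 <= f w by exact: fsq_ge0.
  have g0 : 0 <= g w by exact: fsq_ge0.
  have v0 : 0 <= v w by exact: fsq_ge0.
  (* The weight [1 + Phi] in the arithmetic-geometric inequality balances the two means: both become
     of order [(1 + Phi) Q]. *)
  have key : 12 / tau ^+ 2 * (`|hw| * `|b w - t|) <= 6 / tau ^+ 2 *
      ((1 + Phi)^-1 * (2 * g w + 2 * (f w * g w)) + (1 + Phi) * (b w - t) ^+ 2).
    have P1 : 0 < 1 + Phi by lra.
    have : 2 * (`|hw| * `|b w - t|) <= (1 + Phi)^-1 * hw ^+ 2 + (1 + Phi) * (b w - t) ^+ 2.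
      rewrite -(real_normK (num_real hw)) -(real_normK (num_real (b w - t))) -subr_ge0.
      have -> : (1 + Phi)^-1 * `|hw| ^+ 2 + (1 + Phi) * `|b w - t| ^+ 2 - 2 * (`|hw| * `|b w - t|)
        = (1 + Phi)^-1 * (`|hw| - (1 + Phi) * `|b w - t|) ^+ 2 by field; rewrite lt0r_neq0.
      by rewrite mulr_ge0 ?sqr_ge0 // invr_ge0 ltW.
    have iP : 0 <= (1 + Phi)^-1 by rewrite invr_ge0 ltW.
    have := ler_wpM2l iP hs => hs' k1.
    have k2 : 2 * (`|hw| * `|b w - t|) <= (1 + Phi)^-1 * (2 * g w + 2 * (f w * g w)) +
        (1 + Phi) * (b w - t) ^+ 2 by nra.
    have y0 : 0 <= 6 / tau ^+ 2 by rewrite divr_ge0.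
    have := ler_wpM2l y0 k2; lra.
  have k3 : 0 <= 4 / tau ^+ 2 * (2 * v w + 2 * (f w * v w)).
    by rewrite mulr_ge0 ?divr_ge0 // addr_ge0 // mulr_ge0 // mulr_ge0.
  have hn := ler_norm hw; have hn' : - `|hw| <= hw by rewrite lerNnormlW.
  case: (leP (tau / 2) (b w)) => bw /=; rewrite ?mul1r ?mul0r.
    have bp : 0 < b w by apply: lt_le_trans bw; rewrite divr_gt0.
    (* Here [b >= tau / 2] and [t >= 3 tau / 4], so [2 / (b t)] is at most [16 / (3 tau^2)]; the
       larger constant 12 is dictated by the case of small [b]. *)
    have k4 : 2 * (b w)^-1 * hw <= 2 / t * hw + 12 / tau ^+ 2 * (`|hw| * `|b w - t|).
      have ibt : (b w * t)^-1 <= 8 / 3 / tau ^+ 2.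
        have -> : 8 / 3 / tau ^+ 2 = (tau / 2 * (3 / 4 * tau))^-1 by field; rewrite lt0r_neq0.
        rewrite lef_pV2 ?posrE ?mulr_gt0 ?divr_gt0 //.
        by apply: ler_pM => //; rewrite ?mulr_ge0 ?divr_ge0 // ltW.
      have -> : 2 * (b w)^-1 * hw = 2 / t * hw + 2 * (hw * (t - b w)) * (b w * t)^-1.
        by field; rewrite !lt0r_neq0.
      rewrite lerD2l; apply: (@le_trans _ _ (2 * (`|hw| * `|b w - t|) * (b w * t)^-1)).
        apply: ler_wpM2r; first by rewrite invr_ge0 ltW // mulr_gt0.
        by rewrite ler_wpM2l // distrC -normrM ler_norm.
      apply: (@le_trans _ _ (2 * (`|hw| * `|b w - t|) * (8 / 3 / tau ^+ 2))).
        by apply: ler_wpM2l => //; rewrite !mulr_ge0.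
      have y0 : 0 <= tau ^- 2 * (`|hw| * `|b w - t|) by rewrite !mulr_ge0 ?invr_ge0.
      by lra.
    have k5 : ee * v w / b w ^+ 2 <= 4 / tau ^+ 2 * (2 * v w + 2 * (f w * v w)).
      have ib : (b w ^+ 2)^-1 <= 4 / tau ^+ 2.
        have -> : 4 / tau ^+ 2 = ((tau / 2) ^+ 2)^-1 by field; rewrite lt0r_neq0.
        rewrite lef_pV2 ?posrE ?exprn_gt0 ?divr_gt0 // ler_sqr ?nnegrE // ltW //.
        by rewrite divr_gt0.
      rewrite [leRHS]mulrC; apply: ler_pM => //; first by rewrite mulr_ge0.
        by rewrite invr_ge0 sqr_ge0.
      by have := ler_wpM2r v0 ee2; lra.
    by lra.
  (* For small [b] the left side is 0 and the majorant must only be nonnegative. Then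
     [|b - t| >= tau / 4], so the error term is at least [3 |h| / tau], which exceeds
     [2 |h| / t]. *)
  have k6 : 0 <= 2 / t * hw + 12 / tau ^+ 2 * (`|hw| * `|b w - t|).
    have d1 : tau / 4 <= `|b w - t|.
      by rewrite distrC (le_trans _ (ler_norm _)) //; lra.
    have d2 : 2 / t <= 8 / 3 / tau.
      have -> : 8 / 3 / tau = 2 / (3 / 4 * tau) by field; rewrite lt0r_neq0.
      by rewrite ler_pM2l // lef_pV2 ?posrE // mulr_gt0.
    have d3 : 2 / t * `|hw| <= 8 / 3 / tau * `|hw| by rewrite ler_wpM2r.
    have d4 : 12 / tau ^+ 2 * (`|hw| * (tau / 4)) <= 12 / tau ^+ 2 * (`|hw| * `|b w - t|).
      by rewrite ler_wpM2l ?divr_ge0 // ler_wpM2l.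
    have d5 : 12 / tau ^+ 2 * (`|hw| * (tau / 4)) = 3 / tau * `|hw|.
      by field; rewrite lt0r_neq0.
    have d6 : - (2 / t * `|hw|) <= 2 / t * hw.
      by rewrite -mulrN ler_wpM2l // divr_ge0 // ltW.
    have d7 : 0 <= tau^-1 * `|hw| by rewrite mulr_ge0 // invr_ge0 ltW.
    by lra.
  by lra.
Qed.
End one_step.
(** * Averaging over the rows *)
Section random_rows.
Context d (T : measurableType d) {R : realType} (P : probability T R) {n p : nat}.
Variables (X : 'I_n -> 'I_p -> T -> R) (S : 'M[R]_p).
Hypothesis mX : forall i j, measurable_fun setT (X i j).
Hypothesis sS : S^T = S.
Hypothesis hXrow : forall i, gaussian_vec P (X i) (S *m S).
Hypothesis hXindep : indep_family P (fun i => gen_sigma (X i)).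
(** Padding by 0 beyond [n] lets the recursion run over [nat]. *)
Definition rows w (k : nat) : 'cV[R]_p :=
  if insub k is Some i then \col_j X i j w else 0.
Lemma rowsE w (k : nat) (kn : (k < n)%N) : rows w k = \col_j X (Ordinal kn) j w.
Proof. by rewrite /rows insubT. Qed.
Lemma rows_meas i j : measurable_fun setT (fun w => rows w i j 0).
Proof.
rewrite /rows; case: insubP => [k _ _|_]; last exact: measurable_cst.
by under eq_fun do rewrite mxE; exact: mX.
Qed.
Lemma rmeas_rows f : rmeas f -> measurable_fun setT (fun w => f (rows w)).
Proof. by move=> mf; apply: mf; exact: rows_meas. Qed.
Lemma rows_moments k : (k < n)%N -> gauss_moments P (fun w => rows w k) S.
Proof.
move=> kn; have -> : (fun w => rows w k) = (fun w => \col_j X (Ordinal kn) j w).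
  by apply/funext => w; rewrite rowsE.
by apply: gaussian_vec_moments => //; rewrite sS.
Qed.
(** Row [k] may be replaced by an independent copy drawn from a second sample point, which makes the
    conditional expectation an inner integral. *)
Lemma decouple_rows k (F : (nat -> 'cV[R]_p) -> R) : (k < n)%N ->
  (forall a, 0 <= F a) -> rmeas F ->
  (\int[P]_w (F (rows w))%:E =
   \int[P]_w \int[P]_w' (F (updr (rows w) k (rows w' k)))%:E)%E.
Proof.
move=> kn F0 mF; pose k0 := Ordinal kn.
have ind := indep_family_others (k := k0) mX hXindep.
pose build (f : 'I_n * 'I_p -> R) (h : 'I_p -> R) (i : nat) : 'cV[R]_p :=
  if insub i is Some i' then \col_j (if i' == k0 then h j else f (i', j)) else 0.
have mm ij : measurable_fun setT (if ij.1 == k0 then cst 0 else X ij.1 ij.2).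
  by case: eqP.
have := @integral_decouple _ T R P _ _ _ _ mm (mX k0) ind (fun f h => (F (build f h))%:E).
have -> : (fun w => (F (build ((fun ij : 'I_n * 'I_p => if ij.1 == k0 then cst 0 else X ij.1 ij.2)^~ w) ((X k0)^~ w)))%:E) =
    (fun w => (F (rows w))%:E).
  apply/funext => w; congr (F _)%:E; apply/funext => i; rewrite /build /rows.
  case: insubP => // i' _ _; apply/colP => j; rewrite !mxE.
  by case: eqP => // ->.
have -> : (fun w => \int[P]_w' (F (build ((fun ij : 'I_n * 'I_p => if ij.1 == k0 then cst 0 else X ij.1 ij.2)^~ w) ((X k0)^~ w')))%:E)%E =
    (fun w => \int[P]_w' (F (updr (rows w) k (rows w' k)))%:E)%E.
  apply/funext => w; apply: eq_integral => w' _; congr (F _)%:E; apply/funext => i.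
  rewrite /build /updr (rowsE w' kn) /rows.
  case: insubP => [i' _ ii'|ni]; last by case: eqP => // ik; rewrite ik kn in ni.
  apply/colP => j; rewrite !mxE -ii' -(inj_eq val_inj) /=.
  by case: eqP => ik; rewrite !mxE // ifF //; apply/eqP => /(congr1 val).
apply.
- by move=> f h; rewrite lee_fin.
- move=> dU U f h mf mh; apply/measurable_EFinP; apply: mF => i j.
  rewrite /build; case: insubP => [i' _ _|_]; last exact: measurable_cst.
  under eq_fun do rewrite mxE.
  by case: (i' == k0); [exact: mh|exact: mf].
Qed.
Lemma rmeas_updr k (F : (nat -> 'cV[R]_p) -> R) : rmeas F ->
  measurable_fun setT (fun z : T * T => F (updr (rows z.1) k (rows z.2 k))).
Proof.
move=> mF; apply: mF => i j; rewrite /updr; case: (i == k).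
  exact: (measurableT_comp (rows_meas k j) measurable_snd).
exact: (measurableT_comp (rows_meas i j) measurable_fst).
Qed.
Let measurable_decoupled k (F : (nat -> 'cV[R]_p) -> R) :
  (forall a, 0 <= F a) -> rmeas F ->
  measurable_fun setT (fun w => \int[P]_w' (F (updr (rows w) k (rows w' k)))%:E)%E.
Proof.
move=> F0 mF.
apply: (@measurable_fun_fubini_tonelli_F _ _ T T R P
  (fun z => (F (updr (rows z.1) k (rows z.2 k)))%:E)).
- by apply/measurable_EFinP; exact: rmeas_updr.
- by move=> z; rewrite lee_fin.
Qed.
Definition rexp (F : (nat -> 'cV[R]_p) -> R) : \bar R := (\int[P]_w (F (rows w))%:E)%E.
Definition nnm (F : (nat -> 'cV[R]_p) -> R) := rmeas F /\ forall a, 0 <= F a.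
Lemma rexp_le F G : nnm F -> nnm G -> (forall a, F a <= G a) -> (rexp F <= rexp G)%E.
Proof.
move=> [mF F0] [mG G0] FG; apply: ge0_le_integral => //.
- by move=> w _; rewrite lee_fin.
- exact/measurable_EFinP/rmeas_rows.
- exact/measurable_EFinP/rmeas_rows.
- by move=> w _; rewrite lee_fin.
Qed.
Lemma rexp_ge0 F : nnm F -> (0 <= rexp F)%E.
Proof. by move=> [_ F0]; apply: integral_ge0 => w _; rewrite lee_fin. Qed.
Lemma rexpD F G : nnm F -> nnm G -> rexp (fun a => F a + G a) = (rexp F + rexp G)%E.
Proof.
move=> [mF F0] [mG G0]; rewrite /rexp; under eq_integral do rewrite EFinD.
rewrite ge0_integralD //.
- by move=> w _; rewrite lee_fin.
- exact/measurable_EFinP/rmeas_rows.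
- by move=> w _; rewrite lee_fin.
- exact/measurable_EFinP/rmeas_rows.
Qed.
Lemma rexpZ c F : 0 <= c -> nnm F -> rexp (fun a => c * F a) = (c%:E * rexp F)%E.
Proof.
move=> c0 [mF F0]; rewrite /rexp; under eq_integral do rewrite EFinM.
rewrite ge0_integralZl //.
- exact/measurable_EFinP/rmeas_rows.
- by move=> w _; rewrite lee_fin.
Qed.
Lemma rexp_cst c : rexp (fun=> c) = c%:E.
Proof. by have := (has_mean_cst P c).2. Qed.
Lemma rexp_sum (I : Type) (r : seq I) (F : I -> (nat -> 'cV[R]_p) -> R) :
  (forall i, nnm (F i)) -> rexp (fun a => \sum_(i <- r) F i a) = (\sum_(i <- r) rexp (F i))%E.
Proof.
move=> h; rewrite /rexp; under eq_integral do rewrite -sumEFin.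
rewrite ge0_integral_sum //.
- by move=> i; apply/measurable_EFinP/rmeas_rows; case: (h i).
- by move=> i w _; rewrite lee_fin; case: (h i).
Qed.
(** The tower property: a bound on the inner integral over row [k], valid for every fixed [a], is
    integrated over the remaining rows. *)
Lemma rexp_step_le k F G : (k < n)%N -> nnm F -> nnm G ->
  (forall a, \int[P]_w' (F (updr a k (rows w' k)))%:E <= (G a)%:E)%E -> (rexp F <= rexp G)%E.
Proof.
move=> kn [mF F0] [mG G0] h; rewrite /rexp (decouple_rows kn F0 mF).
apply: ge0_le_integral => //.
- by move=> w _; apply: integral_ge0 => w' _; rewrite lee_fin.
- exact: measurable_decoupled.
- exact/measurable_EFinP/rmeas_rows.
Qed.
Lemma rexp_step_ge k F G : (k < n)%N -> nnm F -> nnm G ->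
  (forall a, (G a)%:E <= \int[P]_w' (F (updr a k (rows w' k)))%:E)%E -> (rexp G <= rexp F)%E.
Proof.
move=> kn [mF F0] [mG G0] h; rewrite /rexp (decouple_rows kn F0 mF).
apply: ge0_le_integral => //.
- by move=> w _; rewrite lee_fin.
- exact/measurable_EFinP/rmeas_rows.
- exact: measurable_decoupled.
Qed.
End random_rows.
Section nnm.
Context {R : realType} {p : nat}.
Implicit Types F G : (nat -> 'cV[R]_p) -> R.
Lemma nnm_cst (c : R) : 0 <= c -> nnm (fun _ : nat -> 'cV[R]_p => c).
Proof. by move=> c0; split => //; exact: rmeas_cst. Qed.
Lemma nnmD F G : nnm F -> nnm G -> nnm (fun a => F a + G a).
Proof. by move=> [mF F0] [mG G0]; split; [exact: rmeasD|move=> a; rewrite addr_ge0]. Qed.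
Lemma nnmM F G : nnm F -> nnm G -> nnm (fun a => F a * G a).
Proof. by move=> [mF F0] [mG G0]; split; [exact: rmeasM|move=> a; rewrite mulr_ge0]. Qed.
Lemma nnmV F : nnm F -> nnm (fun a => (F a)^-1).
Proof. by move=> [mF F0]; split; [exact: rmeasV|move=> a; rewrite invr_ge0]. Qed.
Lemma nnm_sum I (r : seq I) (F : I -> (nat -> 'cV[R]_p) -> R) :
  (forall i, nnm (F i)) -> nnm (fun a => \sum_(i <- r) F i a).
Proof.
move=> h; split; first by apply: rmeas_sum => i; case: (h i).
by move=> a; apply: sumr_ge0 => i _; case: (h i).
Qed.
Lemma nnm_prod I (r : seq I) (F : I -> (nat -> 'cV[R]_p) -> R) :
  (forall i, nnm (F i)) -> nnm (fun a => \prod_(i <- r) F i a).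
Proof.
move=> h; split; first by apply: rmeas_prod => i; case: (h i).
by move=> a; apply: prodr_ge0 => i _; case: (h i).
Qed.
Lemma nnm_fsq m q (F : (nat -> 'cV[R]_p) -> 'M[R]_(m, q)) : mxmeas F -> nnm (fun a => fsq (F a)).
Proof. by move=> mF; split; [exact: rmeas_fsq|move=> a; exact: fsq_ge0]. Qed.
Lemma nnm_ind (b : (nat -> 'cV[R]_p) -> bool) : rmeas (fun a => (b a)%:R) ->
  nnm (fun a => (b a)%:R).
Proof. by move=> mb; split => // a; exact: ler0n. Qed.
Lemma nnm_min F G : nnm F -> nnm G -> nnm (fun a => Num.min (F a) (G a)).
Proof.
move=> [mF F0] [mG G0]; split; first exact: rmeas_min.
by move=> a; rewrite le_min F0 G0.
Qed.
End nnm.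
Section process_measurability.
Context {R : realType} {p q : nat}.
Variables (S : 'M[R]_p) (Wst : 'M[R]_(p, q)) (s : nat -> 'rV[R]_q).
Lemma mxmeas_Mk k : mxmeas (fun a : nat -> 'cV[R]_p => Mk a k).
Proof. by apply: mxmeas_pj => i; exact: mxmeas_row. Qed.
Lemma mxmeas_uk k : mxmeas (fun a : nat -> 'cV[R]_p => uk a k).
Proof. by apply: mxmeasM; [exact: mxmeas_Mk|exact: mxmeas_row]. Qed.
Lemma rmeas_bk k : rmeas (fun a : nat -> 'cV[R]_p => bk a k).
Proof. exact/rmeas_fsq/mxmeas_uk. Qed.
Lemma mxmeas_resp k : mxmeas (fun a : nat -> 'cV[R]_p => resp Wst s a k).
Proof.
apply: mxmeasD; last exact: mxmeas_cst.
by apply: mxmeasM; [exact/mxmeas_tr/mxmeas_row|exact: mxmeas_cst].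
Qed.
Lemma mxmeas_Wk k : mxmeas (fun a : nat -> 'cV[R]_p => Wk Wst s a k).
Proof.
elim: k => [|k IH]; first exact: mxmeas_cst.
apply: mxmeasD => //; apply: mxmeasZ; first exact/rmeasV/rmeas_bk.
apply: mxmeasM; first exact: mxmeas_uk.
apply: mxmeasB; first exact: mxmeas_resp.
by apply: mxmeasM => //; exact/mxmeas_tr/mxmeas_row.
Qed.
Lemma mxmeas_Dk k : mxmeas (fun a : nat -> 'cV[R]_p => Dk Wst s a k).
Proof. by apply: mxmeasB; [exact: mxmeas_Wk|exact: mxmeas_cst]. Qed.
Lemma rmeas_tk k : rmeas (fun a : nat -> 'cV[R]_p => tk S a k).
Proof. by apply: rmeas_fsq; apply: mxmeasM; [exact: mxmeas_Mk|exact: mxmeas_cst]. Qed.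
Lemma rmeas_Qk k : rmeas (fun a : nat -> 'cV[R]_p => Qk S a k).
Proof.
apply: rmeas_fsq; apply: mxmeasM; last exact: mxmeas_cst.
by apply: mxmeasM; [exact: mxmeas_cst|exact: mxmeas_Mk].
Qed.
Lemma rmeas_Phik k : rmeas (fun a : nat -> 'cV[R]_p => Phik S Wst s a k).
Proof. by apply: rmeas_fsq; apply: mxmeasM; [exact: mxmeas_cst|exact: mxmeas_Dk]. Qed.
Lemma rmeas_ek k : rmeas (fun a : nat -> 'cV[R]_p => fsq (ek Wst s a k)).
Proof.
apply: rmeas_fsq; apply: mxmeasB; first exact: mxmeas_cst.
by apply: mxmeasM; [exact/mxmeas_tr/mxmeas_row|exact: mxmeas_Dk].
Qed.
Lemma rmeas_le_cst c (f : (nat -> 'cV[R]_p) -> R) : rmeas f ->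
  rmeas (fun a => (f a <= c)%R%:R).
Proof. by move=> mf; apply: rmeas_le => //; exact: rmeas_cst. Qed.
Lemma rmeas_ge_cst c (f : (nat -> 'cV[R]_p) -> R) : rmeas f ->
  rmeas (fun a => (c <= f a)%R%:R).
Proof. by move=> mf; apply: rmeas_le => //; exact: rmeas_cst. Qed.
Lemma rmeas_lt_cst c (f : (nat -> 'cV[R]_p) -> R) : rmeas f ->
  rmeas (fun a => (c < f a)%R%:R).
Proof.
move=> mf; apply: (rmeas_eq (rmeas_ind_not (rmeas_le_cst c mf))) => a.
by rewrite -ltNge.
Qed.
Lemma rmeas_and (b c : (nat -> 'cV[R]_p) -> bool) :
  rmeas (fun a => (b a)%:R) -> rmeas (fun a => (c a)%:R) -> rmeas (fun a => (b a && c a)%:R).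
Proof.
move=> mb mc; apply: (rmeas_eq (rmeasM mb mc)) => a.
by case: (b a); rewrite ?mul1r ?mul0r.
Qed.
Lemma rmeas_all (I : eqType) (l : seq I) (b : I -> (nat -> 'cV[R]_p) -> bool) :
  (forall i, rmeas (fun a => (b i a)%:R)) ->
  rmeas (fun a => (all (b^~ a) l)%:R).
Proof.
move=> mb; elim: l => [|i l IH]; first exact: rmeas_cst.
by apply: (rmeas_eq (rmeasM (mb i) IH)) => a /=; case: (b i a); rewrite ?mul1r ?mul0r.
Qed.
End process_measurability.
(** * Numerical and combinatorial preliminaries *)
Section rexp_bounds.
Context d (T : measurableType d) {R : realType} (P : probability T R) {n p : nat}.
Variables (X : 'I_n -> 'I_p -> T -> R).
Hypothesis mX : forall i j, measurable_fun setT (X i j).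
Implicit Types F G : (nat -> 'cV[R]_p) -> R.
Notation Ex := (rexp P X).
Lemma rexpD_le F G x y : nnm F -> nnm G -> (Ex F <= x%:E)%E -> (Ex G <= y%:E)%E ->
  (Ex (fun a => F a + G a)%R <= (x + y)%:E)%E.
Proof. by move=> nF nG hF hG; rewrite (rexpD P mX) // EFinD leeD. Qed.
Lemma rexpZ_le F c x : 0 <= c -> nnm F -> (Ex F <= x%:E)%E ->
  (Ex (fun a => c * F a)%R <= (c * x)%:E)%E.
Proof. by move=> c0 nF hF; rewrite (rexpZ P mX) // EFinM; apply: lee_wpmul2l. Qed.
Lemma rexp_sum_le (I : eqType) (r : seq I) (F : I -> (nat -> 'cV[R]_p) -> R) (x : I -> R) :
  (forall i, nnm (F i)) -> (forall i, i \in r -> (Ex (F i) <= (x i)%:E)%E) ->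
  (Ex (fun a => (\sum_(i <- r) F i a)%R) <= (\sum_(i <- r) x i)%:E)%E.
Proof.
move=> nF h; rewrite rexp_sum // -sumEFin big_seq [leRHS]big_seq.
by apply: lee_sum => i; exact: h.
Qed.
Lemma rexp_le_trans F G x : nnm F -> nnm G -> (forall a, F a <= G a) ->
  (Ex G <= x%:E)%E -> (Ex F <= x%:E)%E.
Proof. by move=> nF nG FG; apply: le_trans; exact: rexp_le. Qed.
Hypothesis hXindep : indep_family P (fun i => gen_sigma (X i)).
Lemma rexp_le_cst k F c : (k < n)%N -> nnm F -> 0 <= c ->
  (forall a, \int[P]_w' (F (updr a k (rows X w' k)))%:E <= c%:E)%E -> (Ex F <= c%:E)%E.
Proof.
move=> kn nF c0 h; rewrite -(rexp_cst P X c).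
by apply: (rexp_step_le mX hXindep kn) => //; exact: nnm_cst.
Qed.
End rexp_bounds.
Section rexp_fin.
Context d (T : measurableType d) {R : realType} (P : probability T R) {n p : nat}.
Variables (X : 'I_n -> 'I_p -> T -> R).
Hypothesis mX : forall i j, measurable_fun setT (X i j).
Implicit Types F G : (nat -> 'cV[R]_p) -> R.
Notation Ex := (rexp P X).
Lemma rexp_fin F x : nnm F -> (Ex F <= x%:E)%E -> exists y, [/\ Ex F = y%:E, 0 <= y & y <= x].
Proof.
move=> nF h; have h0 := rexp_ge0 P X nF.
have f : Ex F \is a fin_num by rewrite ge0_fin_numE // (le_lt_trans h) // ltry.
by exists (fine (Ex F)); rewrite -!lee_fin fineK.
Qed.
Lemma rexp_ind_fin (b : (nat -> 'cV[R]_p) -> bool) : rmeas (fun a => (b a)%:R) ->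
  exists y, Ex (fun a => (b a)%:R) = y%:E /\ Ex (fun a => (~~ b a)%:R) = (1 - y)%:E.
Proof.
move=> mb; have nb := nnm_ind mb; have nn := nnm_ind (rmeas_ind_not mb).
have ind1 (c : bool) : c%:R <= 1 :> R by rewrite lern1 leq_b1.
have le1 F : nnm F -> (forall a, F a <= 1) -> (Ex F <= 1%:E)%E.
  by move=> nF F1; rewrite -(rexp_cst P X 1); apply: rexp_le => //; exact: nnm_cst.
have [y [yE _ _]] := rexp_fin nb (le1 _ nb (fun a => ind1 (b a))).
have [z [zE _ _]] := rexp_fin nn (le1 _ nn (fun a => ind1 (~~ b a))).
exists y; split => //; rewrite zE; congr (_%:E).
have := rexpD P mX nb nn; rewrite yE zE.
have -> : (fun a => (b a)%:R + (~~ b a)%:R) = fun=> 1 :> R.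
  by apply/funext => a; case: (b a); rewrite ?addr0 ?add0r.
by rewrite rexp_cst => -[->]; rewrite addrAC subrr add0r.
Qed.
Lemma integralZ_le (f h : T -> R) c x : 0 <= c -> measurable_fun setT f ->
  (forall w, 0 <= f w) -> (forall w, h w = c * f w) ->
  (\int[P]_w (f w)%:E <= x%:E)%E -> (\int[P]_w (h w)%:E <= (c * x)%:E)%E.
Proof.
move=> c0 mf f0 hE fx; under eq_integral do rewrite hE EFinM.
rewrite ge0_integralZl //; last 2 first.
- exact/measurable_EFinP.
- by move=> w _; rewrite lee_fin.
by rewrite EFinM; apply: lee_wpmul2l => //; rewrite lee_fin.
Qed.
End rexp_fin.
(** It converts a small sum of drift factors into a product close to 1. The induction rests on
    [(1 - q - Q)(1 + q) <= 1 - Q] for nonnegative [q] and [Q]. *)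
Lemma prod_inv1D_ge {R : realFieldType} (l : seq nat) (q : nat -> R) :
  (forall i, 0 <= q i) -> 1 - \sum_(i <- l) q i <= \prod_(i <- l) (1 + q i)^-1.
Proof.
move=> q0; suff : 1 - \sum_(i <- l) q i <= \prod_(i <- l) (1 + q i)^-1 <= 1 by case/andP.
elim: l => [|i l /andP[IH1 IH2]]; first by rewrite !big_nil subr0 lexx.
rewrite !big_cons; set Q := \sum_(j <- l) q j in IH1 *; set Pi := \prod_(j <- l) _ in IH1 IH2 *.
have Pi0 : 0 <= Pi by apply: prodr_ge0 => j _; rewrite invr_ge0 addr_ge0.
have pos : 0 < 1 + q i by rewrite ltr_pwDl.
apply/andP; split; rewrite mulrC; last by rewrite ler_pdivrMr // mul1r (le_trans IH2) // lerDl.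
rewrite ler_pdivlMr //; have Q0 : 0 <= Q by apply: sumr_ge0.
by have := q0 i; nra.
Qed.

(** * Choice of the constants *)

Section parameters.
Context {R : realType}.
Implicit Types s c t w r k m : R.
Lemma ex_lower_bound (l : seq R) : all (fun x => 0 < x) l ->
  exists2 c, 0 < c & all (fun x => c <= x) l.
Proof.
elim: l => [_|x l IH /= /andP[x0 /IH[c c0 cl]]]; first by exists 1.
exists (Num.min x c); first by rewrite lt_min x0.
rewrite ge_min lexx /=; apply: sub_all cl => y cy.
by rewrite ge_min cy orbT.
Qed.
(** In terms of [x = r / k] and [y = q2 / t^2] the left side has four summands, each at most
    [s / 4]; the last three bounds on [c] serve the first three. The weight [s * dl ^+ 4 / 8] is
    tuned so that the one summand that does not vanish with [c] starts at [s / 16]. *)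
Lemma first_rows_budget s (dl : R) c t (q2 : R) r k m : 0 < s -> 0 < dl -> 0 < t -> 0 <= q2 -> 0 <= r ->
  0 < k -> 1 <= m -> k <= m -> s * m <= 2 * k -> r <= c * m -> m * q2 <= c * t ^+ 2 ->
  c <= 1 -> c <= s ^+ 2 * dl ^+ 3 / 8 -> c <= s * dl ^+ 4 / 8 -> c <= s ^+ 3 * dl ^+ 8 / 32 ->
  (k * dl ^+ 2)^-1 * (r / dl + k * (2 * q2 / (dl * t) ^+ 2) +
    (t / (s * dl ^+ 4 / 8) * r + s * dl ^+ 4 / 8 / t * (k * (t ^+ 2 + 2 * q2) + k ^+ 2 * q2))
      / (2 * dl ^+ 2 * t)) <= s.
Proof.
move=> s0 d0 t0 q0 r0 k0 m1 km smk rc qc c1 c2 c3 c4.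
pose x := r / k; pose y := q2 / t ^+ 2.
have y0 : 0 <= y by rewrite divr_ge0 ?sqr_ge0.
have x0 : 0 <= x by rewrite divr_ge0 // ltW.
have m0 : 0 < m by lra.
have my : m * y <= c by rewrite /y mulrA ler_pdivrMr ?exprn_gt0.
have ky : k * y <= c by apply: le_trans my; rewrite ler_wpM2r.
have yc : y <= c by apply: le_trans my; rewrite ler_peMl.
have c0 : 0 <= c by apply: le_trans yc.
have xs : x * s <= 2 * c.
  rewrite /x mulrAC ler_pdivrMr //; apply: (@le_trans _ _ (c * m * s)); first by rewrite ler_wpM2r // ltW.
  by rewrite -mulrA [m * s]mulrC [2 * c]mulrC -[leRHS]mulrA ler_wpM2l.
have -> : (k * dl ^+ 2)^-1 * (r / dl + k * (2 * q2 / (dl * t) ^+ 2) +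
    (t / (s * dl ^+ 4 / 8) * r + s * dl ^+ 4 / 8 / t * (k * (t ^+ 2 + 2 * q2) + k ^+ 2 * q2))
      / (2 * dl ^+ 2 * t)) =
   x / dl ^+ 3 + 2 * y / dl ^+ 4 + 4 * x / (s * dl ^+ 8) + s / 16 * (1 + 2 * y + k * y).
  by rewrite /x /y; field; rewrite !gt_eqF.
have d3 n : 0 < dl ^+ n by exact: exprn_gt0.
have t1 : x / dl ^+ 3 <= s / 4.
  rewrite ler_pdivrMr // -(ler_pM2r s0); apply: le_trans xs _.
  by move: c2; rewrite expr2; lra.
have t2 : 2 * y / dl ^+ 4 <= s / 4 by rewrite ler_pdivrMr //; lra.
have t3 : 4 * x / (s * dl ^+ 8) <= s / 4.
  rewrite ler_pdivrMr ?mulr_gt0 // -(ler_pM2r s0) -mulrA.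
  by move: c4 xs; rewrite exprS expr2; lra.
have t4 : s / 16 * (1 + 2 * y + k * y) <= s / 4.
  by rewrite (_ : s / 4 = s / 16 * 4); [rewrite ler_wpM2l ?divr_ge0 ?(ltW s0) //; lra|field].
by lra.
Qed.
(** The divisors give [24 * dl = eta = s / 50], so [kap] is about [3 s / 25], and [72 * kap] stays
    below [u * u = 20 * s]. *)
Lemma parameter_bounds (u s dl eta : R) : 0 < u -> u <= 1 / 2 ->
  s = u ^+ 2 / 20 -> dl = s / 30 / 40 -> eta = s / 50 ->
  let kap := 3 * (1 + 24 * dl) * (24 * dl + eta) in
  [/\ [/\ 0 < s, 0 < dl & s <= 1 / 80], [/\ dl <= 1 / 10, 0 <= eta < 1 & 0 <= eta <= 1 / 4],
      [/\ 1 <= 1 + 24 * dl <= 1 + s, 0 <= 2 - (1 + 24 * dl) - 2 * (s / 2) & s <= u],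
      [/\ 0 <= kap, kap <= s / 4 & 72 * kap / u <= u] &
      [/\ s < 1, s <= 1 / 2 & [/\ (s / 16) ^+ 2 <= u, 0 < u < 1 & u * u = 20 * s]]].
Proof.
move=> u0 u2 sE dE eE kap.
have uu : u * u <= u / 2 by nra.
have uE : u * u = 20 * s by rewrite sE expr2; lra.
have us : 40 * s <= u by lra.
have s0 : 0 < s by rewrite sE divr_gt0 ?exprn_gt0.
have kE : kap = 3 * (1 + s / 50) * (s / 25) by rewrite /kap dE eE; field.
have k0 : 0 <= kap by rewrite kE; nra.
have k1 : kap <= s / 4 by rewrite kE; nra.
have k2 : 72 * kap / u <= u by rewrite ler_pdivrMr // uE kE; nra.
have r1 : (s / 16) ^+ 2 <= u by rewrite expr2; nra.
by clearbody kap; do !split; try (apply/andP; split); lra.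
Qed.
(** Both sides are [m] times [1 + O(s)]. The left coefficient of [s] is at most 5; on the right the
    gain 20 survives losses of 1 from the trace event, 2 from the slack factor and 1 from the
    discarded rows, leaving 16. *)
Lemma early_budget s c (thr kap : R) w t m k : 0 < s -> thr <= 1 + s -> s <= 1 / 80 -> c <= s / 6 -> 1 <= c * m ->
  0 <= kap -> kap <= s / 4 -> w * t <= c * m -> 0 < t -> 0 <= k -> k <= s * m ->
  t * (w + m / ((1 - s) * t)) + 6 * kap / (s / 2) + 16 * (s / 16) * (m - k) <
  (2 - thr - 2 * (s / 2)) * ((m - k) * (1 - s + 20 * s)).
Proof.
move=> s0 thrs s1 cs cm kap0 kaps wt t0 k0 ksm.
have m0 : 0 < m by rewrite -(pmulr_rgt0 _ (_ : 0 < c)) ; nra.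
have -> : t * (w + m / ((1 - s) * t)) = w * t + m / (1 - s).
  by field; rewrite !gt_eqF //; lra.
have h1 : m / (1 - s) <= m * (1 + 2 * s).
  rewrite ler_pdivrMr; last by lra.
  rewrite -mulrA ler_peMr ?(ltW m0) //; nra.
have h2 : 6 * kap / (s / 2) <= 3.
  by rewrite ler_pdivrMr ?divr_gt0 //; lra.
have cm1 : c * m <= s / 6 * m by rewrite ler_wpM2r // ltW.
have h4 : (1 - s) * m <= m - k by lra.
have h5 : (1 - 2 * s) * (1 + 19 * s) * ((1 - s) * m) <= (1 - 2 * s) * (1 + 19 * s) * (m - k).
  by rewrite ler_wpM2l //; nra.
have h6 : 16 * (s / 16) * (m - k) <= s * m.
  have -> : 16 * (s / 16) = s by field.
  by rewrite ler_wpM2l ?(ltW s0) //; lra.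
have h7 : (1 + 5 * s) * m < (1 - 2 * s) * (1 + 19 * s) * ((1 - s) * m).
  rewrite mulrA ltr_pM2r // -subr_gt0.
  have -> : (1 - 2 * s) * (1 + 19 * s) * (1 - s) - (1 + 5 * s) = s * (11 - 55 * s + 38 * s ^+ 2) by ring.
  by rewrite mulr_gt0 //; have := sqr_ge0 s; lra.
have h8 : (1 - 2 * s) * (1 + 19 * s) * (m - k) <= (2 - thr - 2 * (s / 2)) * ((m - k) * (1 - s + 20 * s)).
  have -> : (1 - 2 * s) * (1 + 19 * s) * (m - k) = (1 - 2 * s) * ((m - k) * (1 - s + 20 * s)) by ring.
  apply: ler_wpM2r; last by lra.
  rewrite mulr_ge0 //; last by lra.
  by apply: le_trans h4; rewrite mulr_ge0 ?(ltW m0) //; lra.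
by lra.
Qed.
End parameters.

(** * Distances between a row and the span of the others *)

Section leave_one_out.
Context {R : realFieldType} {p : nat}.
Variables (B : seq 'cV[R]_p) (k : nat) (a : nat -> 'cV[R]_p).
Definition loo0 i := pj [seq a j | j <- rem i (iota 0 k)].
Let Am : 'M[R]_(k, p) := \matrix_(i, j) a i j 0.
Let N1 := pj B.
Let X2 := Am *m N1.
(** A projection in the sample space: it removes the vectors [Am *m v] with [v] in [B], so
    [1 - Qm i i] is the leverage of row [i] in a regression on those directions. *)
Let Qm : 'M[R]_k := pj [seq Am *m v | v <- B].
Let Am_row (i : 'I_k) : Am^T *m delta_mx i 0 = a i.
Proof.
apply/colP => j; rewrite mxE (bigD1 i) //= big1 => [|l li]; rewrite !mxE.
  by rewrite !eqxx mulr1 addr0.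
by rewrite (negPf li) mulr0.
Qed.
Let Q_Am : Qm *m Am = Qm *m X2.
Proof.
have fix_N : N1 *m (Qm *m Am)^T = (Qm *m Am)^T.
  apply: pj_fix => v vB; rewrite -trmx_mul -mulmxA pj_mem ?trmx0 //.
  by apply/mapP; exists v.
by rewrite /X2 mulmxA -[LHS]trmxK -fix_N trmx_mul trmxK pj_sym.
Qed.
Let Q_diag (i : 'I_k) : Qm i i = fsq (Qm *m delta_mx i (0 : 'I_1)).
Proof.
rewrite fsqE trmx_mul pj_sym -mulmxA (mulmxA Qm) pj_idem trmx_delta.
by rewrite mulmxA -rowE -colE /mxtrace big_ord1 !mxE.
Qed.
Lemma loo0_sym i : (loo0 i)^T = loo0 i. Proof. exact: pj_sym. Qed.
Lemma loo0_idem i : loo0 i *m loo0 i = loo0 i. Proof. exact: pj_idem. Qed.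
Let loo_mul (i : 'I_k) (y : 'cV[R]_k) : loo0 i *m (Am^T *m y) = y i 0 *: (loo0 i *m a i).
Proof.
have -> : y = \sum_l y l 0 *: delta_mx l 0.
  apply/colP => l; rewrite summxE (bigD1 l) //= big1 => [|l' ll]; rewrite !mxE.
    by rewrite !eqxx mulr1 addr0.
  by rewrite eq_sym (negPf ll) mulr0.
rewrite !mulmx_sumr (bigD1 i) //= big1 => [|l li].
  rewrite addr0 -!scalemxAr Am_row summxE (bigD1 i) //= big1 => [|l li]; rewrite !mxE.
    by rewrite !eqxx mulr1 addr0.
  by rewrite eq_sym (negPf li) mulr0.
rewrite -!scalemxAr Am_row pj_mem ?scaler0 //; apply/mapP; exists (val l) => //.
by rewrite mem_rem_uniq ?iota_uniq // inE mem_iota /= add0n ltn_ord andbT.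
Qed.
(* Removing from [e_i] its component on the column space of the [B]-part of the
   design cancels that part, whence the distance of [a i] to the other rows is
   governed by the remaining part alone. *)
Let loo_dist_le (i : 'I_k) :
  Qm i i ^+ 2 * fsq (loo0 i *m a i) <= fsq (X2^T *m Qm *m delta_mx i (0 : 'I_1)).
Proof.
have -> : X2^T *m Qm *m delta_mx i (0 : 'I_1) = Am^T *m (Qm *m delta_mx i 0).
  rewrite [RHS]mulmxA; congr (_ *m _).
  by have := congr1 trmx Q_Am; rewrite [LHS]trmx_mul [RHS]trmx_mul pj_sym => ->.
rewrite -fsqZ; have -> : Qm i i *: (loo0 i *m a i) = loo0 i *m (Am^T *m (Qm *m delta_mx i 0)).
  by rewrite loo_mul -colE mxE.
by rewrite fsq_proj_le ?loo0_sym ?loo0_idem.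
Qed.
(** A far row must have leverage at least [dl], or a large component outside [B], or a large [g i].
    Each alternative is counted by Markov: the leverages sum to at most [size B], and the [g i] sum
    to the trace of [(1 - Qm) X2 X2^T], which is split by Cauchy-Schwarz with weight [tau / mu]. *)
Lemma sum_loo_far_le (tau dl mu : R) : 0 < tau -> 0 < dl -> dl <= 1 / 10 -> 0 < mu ->
  \sum_(i < k) ((1 + 12 * dl) * tau < fsq (loo0 i *m a i))%R%:R <=
    (size B)%:R / dl + \sum_(i < k) ((1 + dl) * tau <= fsq (N1 *m a i))%R%:R +
    (tau / mu * (size B)%:R + mu / tau * \sum_(i < k) \sum_(j < k) fsq ((a i)^T *m N1 *m a j))
      / (2 * dl ^+ 2 * tau).
Proof.
move=> tau0 dl0 dl1 mu0.
pose f (i : 'I_k) := fsq (N1 *m a i).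
pose g (i : 'I_k) := fsq (X2^T *m (1%:M - Qm) *m delta_mx i (0 : 'I_1)).
have fE i : f i = fsq (X2^T *m delta_mx i (0 : 'I_1)).
  by rewrite /X2 trmx_mul pj_sym -mulmxA Am_row.
have key (i : 'I_k) : ((1 + 12 * dl) * tau < fsq (loo0 i *m a i))%R%:R <=
    (1 - Qm i i) / dl + ((1 + dl) * tau <= f i)%R%:R + g i / (dl ^+ 2 * tau).
  have Q1 : Qm i i <= 1.
    rewrite Q_diag; apply: le_trans (fsq_proj_le _ (pj_sym _) (pj_idem _)) _.
    rewrite /fsq (bigD1 i) //= big_ord1 big1 => [|l li]; last by rewrite big_ord1 mxE (negPf li) expr0n.
    by rewrite mxE !eqxx expr1n addr0.
  have g0 : 0 <= g i by exact: fsq_ge0.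
  have t1 : 0 <= (1 - Qm i i) / dl by rewrite divr_ge0 ?subr_ge0 // ltW.
  have d2 : 0 < dl ^+ 2 * tau by rewrite mulr_gt0 ?exprn_gt0.
  have t3 : 0 <= g i / (dl ^+ 2 * tau) by rewrite divr_ge0 // ltW.
  have t2 : 0 <= ((1 + dl) * tau <= f i)%R%:R :> R by exact: ler0n.
  case: ltP => // far; last by rewrite addr_ge0 // addr_ge0.
  have [Qs|Qs] := leP (Qm i i) (1 - dl).
    have : 1 <= (1 - Qm i i) / dl by rewrite ler_pdivlMr // mul1r; lra.
    by rewrite /=; lra.
  case: (leP ((1 + dl) * tau) (f i)) => [_|fs]; first by rewrite /=; lra.
  have [gs|gs] := leP (dl ^+ 2 * tau) (g i).
    have : 1 <= g i / (dl ^+ 2 * tau) by rewrite ler_pdivlMr // mul1r.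
    by rewrite /=; lra.
  exfalso; have dist := loo_dist_le i.
  have split : fsq (X2^T *m Qm *m delta_mx i (0 : 'I_1)) <= (1 + dl) * f i + (1 + dl^-1) * g i.
    have -> : X2^T *m Qm *m delta_mx i (0 : 'I_1) =
        X2^T *m delta_mx i 0 + - (X2^T *m (1%:M - Qm) *m delta_mx i 0).
      by rewrite mulmxBr mulmx1 mulmxBl opprB addrC subrK.
    rewrite fsqD fsqN -/(g i) -fE.
    have := tr_mul_le (X2^T *m delta_mx i (0 : 'I_1)) (- (X2^T *m (1%:M - Qm) *m delta_mx i 0)) dl0.
    by rewrite fsqN -/(g i) -fE; lra.
  have gd : (1 + dl^-1) * g i <= (dl + dl ^+ 2) * tau.
    have -> : (dl + dl ^+ 2) * tau = (1 + dl^-1) * (dl ^+ 2 * tau) by field; rewrite lt0r_neq0.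
    by rewrite ler_wpM2l ?(ltW gs) // addr_ge0 // invr_ge0 ltW.
  have up : fsq (X2^T *m Qm *m delta_mx i (0 : 'I_1)) <= (1 + 3 * dl + 2 * dl ^+ 2) * tau.
    have : (1 + dl) * f i <= (1 + dl) * ((1 + dl) * tau) by rewrite ler_wpM2l ?(ltW fs) //; lra.
    by nra.
  have Q2 : (1 - dl) ^+ 2 <= Qm i i ^+ 2 by rewrite ler_sqr ?nnegrE; lra.
  (* To first order the squared diagonal entry costs [2 dl] and the splitting [3 dl]; the margin
     [12 dl] exceeds their sum, which gives the contradiction for [dl <= 1 / 10]. *)
  have l1 : (1 - dl) ^+ 2 * ((1 + 12 * dl) * tau) < (1 + 3 * dl + 2 * dl ^+ 2) * tau.
    apply: lt_le_trans up; apply: lt_le_trans dist.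
    apply: (@lt_le_trans _ _ ((1 - dl) ^+ 2 * fsq (loo0 i *m a i))).
      by rewrite ltr_pM2l // exprn_gt0 //; lra.
    by rewrite ler_wpM2r ?fsq_ge0.
  have : (1 - dl) ^+ 2 * (1 + 12 * dl) < 1 + 3 * dl + 2 * dl ^+ 2.
    by rewrite -(ltr_pM2r tau0) -mulrA.
  apply/negP; rewrite -leNgt -subr_ge0.
  have -> : (1 - dl) ^+ 2 * (1 + 12 * dl) - (1 + 3 * dl + 2 * dl ^+ 2) =
    dl * (7 - 25 * dl + 12 * dl ^+ 2) by ring.
  by apply: mulr_ge0; [lra|have := sqr_ge0 dl; lra].
apply: le_trans (ler_sum _ (fun i _ => key i)) _.
rewrite !big_split /= -!mulr_suml.
have trQ : \sum_(i < k) (1 - Qm i i) = \tr (1%:M - Qm).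
  by apply: eq_bigr => i _; rewrite !mxE eqxx mulr1n.
have rB : \tr (1%:M - Qm) <= (size B)%:R.
  by rewrite -(size_map (fun v => Am *m v) B) tr_1Bpj.
apply: lerD; last first.
  have -> : \sum_(i < k) g i = \tr ((1%:M - Qm)^T *m (X2 *m X2^T)).
    rewrite /g -[X in _ = X]mxtrace_mulC.
    have -> : \tr (X2 *m X2^T *m (1%:M - Qm)^T) = fsq (X2^T *m (1%:M - Qm)).
      have [sE iE] := (subpj_sym [seq Am *m v | v <- B], subpj_idem [seq Am *m v | v <- B]).
      rewrite fsqE [(X2^T *m _)^T]trmx_mul [X2^T^T]trmxK sE -/Qm.
      by rewrite [LHS]mxtrace_mulC [in RHS]mulmxA [RHS]mxtrace_mulC !mulmxA iE.
    by rewrite (fsq_col_sum (X2^T *m _)); apply: eq_bigr => i _; rewrite colE.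
  have h := tr_mul_le (1%:M - Qm) (X2 *m X2^T) (divr_gt0 tau0 mu0).
  have e1 : fsq (X2 *m X2^T) = \sum_(i < k) \sum_(j < k) fsq ((a i)^T *m N1 *m a j).
    apply: eq_bigr => i _; apply: eq_bigr => j _.
    rewrite /X2 [(Am *m N1)^T]trmx_mul pj_sym -!Am_row [(Am^T *m _)^T]trmx_mul trmxK trmx_delta.
    rewrite !mulmxA -(mulmxA Am) pj_idem.
    by rewrite -colE -!mulmxA -rowE /fsq !big_ord1 !mxE.
  rewrite -e1; set sg := \tr ((1%:M - Qm)^T *m _) in h *.
  have sB : fsq (1%:M - Qm) <= (size B)%:R.
    by rewrite -(size_map (fun v => Am *m v) B) fsq_subpj.
  have h2 : tau / mu * fsq (1%:M - Qm) <= tau / mu * (size B)%:R.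
    by rewrite ler_wpM2l // divr_ge0 // ltW.
  have -> : sg / (dl ^+ 2 * tau) = 2 * sg / (2 * dl ^+ 2 * tau).
    by field; rewrite !lt0r_neq0.
  rewrite ler_wpM2r ?invr_ge0 ?mulr_ge0 ?sqr_ge0 ?(ltW tau0) ?(ltW dl0) //.
  by move: h; rewrite invf_div; lra.
apply: lerD; last by [].
by rewrite trQ; apply: ler_wpM2r => //; rewrite invr_ge0 ltW.
Qed.
End leave_one_out.
(** * Estimates under a covariance splitting *)
(* [V] stands for [Sigma2], [S] for a square root of [Sigma], and [B] is a list
   of vectors spanning the range of [Sigma1]. *)
Section benign.
Context d (T : measurableType d) {R : realType} (P : probability T R) {n p : nat}.
Variables (X : 'I_n -> 'I_p -> T -> R) (S V : 'M[R]_p) (B : seq 'cV[R]_p).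
Hypothesis mX : forall i j, measurable_fun setT (X i j).
Hypothesis sS : S^T = S.
Hypothesis hXrow : forall i, gaussian_vec P (X i) (S *m S).
Hypothesis hXindep : indep_family P (fun i => gen_sigma (X i)).
Hypothesis sV : V^T = V.
Hypothesis Vge0 : forall M, M^T = M -> M *m M = M -> 0 <= \tr (M *m V).
Hypothesis trMV : forall M, M^T = M -> M *m M = M -> \tr (M *m V) <= fsq (M *m S).
Hypothesis killB : forall M : 'M[R]_p, (forall v, v \in B -> M *m v = 0) -> M *m S *m S = M *m V.
Notation Ex := (rexp P X).
Notation tau := (\tr V).
Notation q2 := (fsq V).
Hypothesis tau0 : 0 < tau.
Lemma fsqMS M : M^T = M -> M *m M = M -> fsq (M *m S) = \tr (M *m S *m S).
Proof.
move=> sM iM; rewrite fsqE [LHS]mxtrace_mulC trmx_mul sS sM !mulmxA.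
by rewrite [LHS]mxtrace_mulC !mulmxA iM.
Qed.
(** By Cauchy-Schwarz the directions in [l] carry at most the root of [size l * q2] of the trace of
    [V]. This is where [n] being small against the effective rank of [Sigma2] enters. *)
Lemma tr_pjV_ge (l : seq 'cV[R]_p) (eta : R) : 0 <= eta ->
  (size l)%:R * q2 <= (eta * tau) ^+ 2 -> (1 - eta) * tau <= \tr (pj l *m V).
Proof.
move=> eta0 hl; have := tr_mul_sq_le (1%:M - pj l) V; rewrite subpj_sym.
have h2 : fsq (1%:M - pj l) * q2 <= (size l)%:R * q2.
  by rewrite ler_wpM2r ?fsq_ge0 ?fsq_subpj.
move=> h; have {}h := le_trans h (le_trans h2 hl).
have : \tr ((1%:M - pj l) *m V) <= eta * tau.
  apply: le_trans (ler_norm _) _.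
  by rewrite -ler_sqr ?nnegrE ?normr_ge0 ?mulr_ge0 ?(ltW tau0) // real_normK ?num_real.
by rewrite mulmxBl mul1mx raddfB /=; lra.
Qed.
(** Once the range of [Sigma1] is annihilated, [Sigma] and [V] have the same compression, so the
    fluctuations of the projected row are controlled by [q2] alone. *)
Lemma fsq_SMS_killB M : M^T = M -> M *m M = M -> (forall v, v \in B -> M *m v = 0) ->
  fsq (S *m M *m S) <= q2.
Proof.
move=> sM iM kB; rewrite -(fsq_MSSM sS sM iM) (MS_gram sS sM) (killB kB).
apply: (@le_trans _ _ (fsq (V *m M))); first by rewrite -mulmxA fsq_proj_le.
by rewrite -fsq_tr trmx_mul sM sV fsq_proj_le.
Qed.
(* Leave-one-out projections that also annihilate the range of [Sigma1]. *)
Definition loo (a : nat -> 'cV[R]_p) i :=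
  pj (B ++ [seq a j | j <- rem i (iota 0 n)]).
(** One event with three uses: it bounds every [bk] from below, bounds the norm of an explicit
    interpolator, and makes the system solvable. *)
Definition apart (dl : R) (a : nat -> 'cV[R]_p) :=
  all (fun i => (1 - dl) * tau < fsq (loo a i *m a i)) (iota 0 n).
Lemma loo_sym a i : (loo a i)^T = loo a i. Proof. exact: pj_sym. Qed.
Lemma loo_idem a i : loo a i *m loo a i = loo a i. Proof. exact: pj_idem. Qed.
Lemma loo_updr a i x : loo (updr a i x) i = loo a i.
Proof. by rewrite /loo map_updr // mem_rem_uniqF ?iota_uniq. Qed.
Lemma loo_killB a i v : v \in B -> loo a i *m v = 0.
Proof. by move=> vB; apply: pj_mem; rewrite mem_cat vB. Qed.
Lemma size_loo (a : nat -> 'cV[R]_p) i : (i < n)%N ->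
  (size (B ++ [seq a j | j <- rem i (iota 0 n)]) <= size B + n)%N.
Proof.
move=> ilt; rewrite size_cat size_map leq_add2l size_rem ?mem_iota // size_iota.
exact: leq_pred.
Qed.
Lemma rmeas_loo i : rmeas (fun a => fsq (loo a i *m a i)).
Proof.
apply: rmeas_fsq; apply: mxmeasM; last exact: mxmeas_row.
(* Constant vectors and random rows are put into one indexed family: indices below [size B] denote
   members of [B], the others are shifted row indices. *)
have := @mxmeas_pj _ p p (iota 0 (size B) ++ [seq (size B + j)%N | j <- rem i (iota 0 n)])
  (fun j a => if (j < size B)%N then nth 0 B j else a (j - size B)%N) _.
move=> h.
have e : (fun a => pj [seq (if (j < size B)%N then nth 0 B j else a (j - size B)%N) |
    j <- iota 0 (size B) ++ [seq (size B + j)%N | j <- rem i (iota 0 n)]]) = loo^~ i.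
  apply/funext => a; rewrite /loo map_cat; congr (pj (_ ++ _)).
    rewrite -[in RHS](mkseq_nth 0 B); apply/eq_in_map => j.
    by rewrite mem_iota /= => ->.
  rewrite -map_comp; apply/eq_in_map => j _ /=.
  by rewrite ltnNge leq_addr /= addKn.
rewrite e in h; apply: h => j; case: (ltnP j (size B)) => _; [exact: mxmeas_cst|exact: mxmeas_row].
Qed.
Lemma rmeas_apart dl : rmeas (fun a => (apart dl a)%:R).
Proof.
by apply: (@rmeas_all _ _ _ _ (fun i a => (1 - dl) * tau < fsq (loo a i *m a i))) => i;
  exact/rmeas_lt_cst/rmeas_loo.
Qed.
Lemma sum_all_ge (b : nat -> bool) (l : seq nat) :
  (~~ all b l)%:R <= \sum_(i <- l) (~~ b i)%:R :> R.
Proof.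
elim: l => [|i l IH] /=; first by rewrite big_nil.
rewrite big_cons negb_and; case: (b i) => /=; first by rewrite add0r.
by rewrite lerDl sumr_ge0.
Qed.
(* Chebyshev for each leave-one-out distance, then a union bound. *)
Lemma prob_not_apart dl : 0 < dl -> (size B + n)%:R * q2 <= (dl / 2 * tau) ^+ 2 ->
  (Ex (fun a => (~~ apart dl a)%:R) <= (n%:R * (8 * q2 / (dl * tau) ^+ 2))%:E)%E.
Proof.
move=> dl0 hsz; have ddt : 0 < dl * tau by rewrite mulr_gt0.
pose bad i (a : nat -> 'cV[R]_p) := (~~ ((1 - dl) * tau < fsq (loo a i *m a i)))%:R : R.
have nbad i : nnm (bad i).
  by apply/nnm_ind/rmeas_ind_not/rmeas_lt_cst/rmeas_loo.
have ngood : nnm (fun a => (~~ apart dl a)%:R) by apply/nnm_ind/rmeas_ind_not/rmeas_apart.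
have hle a : (~~ apart dl a)%:R <= \sum_(i <- iota 0 n) bad i a by exact: sum_all_ge.
apply: (le_trans (rexp_le P mX ngood (nnm_sum (iota 0 n) nbad) hle)).
rewrite rexp_sum //.
have -> : (n%:R * (8 * q2 / (dl * tau) ^+ 2))%:E =
    (\sum_(i <- iota 0 n) (8 * q2 / (dl * tau) ^+ 2)%:E)%E.
  by rewrite sumEFin big_const_seq count_predT size_iota iter_addr_0 mulr_natl.
rewrite big_seq [leRHS]big_seq; apply: lee_sum => i; rewrite mem_iota add0n => /= ilt.
rewrite -(rexp_cst P X (8 * q2 / (dl * tau) ^+ 2)).
apply: (rexp_step_le mX hXindep ilt) => //.
  by apply: nnm_cst; apply: divr_ge0; [apply: mulr_ge0; [exact: ler0n|exact: fsq_ge0]|exact: sqr_ge0].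
move=> a; rewrite /bad; under eq_integral do rewrite loo_updr updr_id -leNgt.
have gm := rows_moments mX sS hXrow ilt.
have hQ := fsq_SMS_killB (loo_sym a i) (loo_idem a i) (@loo_killB a i).
apply: (le_trans (chebyshev_lower sS gm (loo_sym a i) (loo_idem a i)
  (c := (1 - dl) * tau) (r := dl / 2 * tau) _ _)).
- by rewrite mulr_gt0 // divr_gt0.
- apply: (@le_trans _ _ ((1 - dl / 2) * tau)); first by lra.
  apply: le_trans (trMV (loo_sym a i) (loo_idem a i)).
  apply: tr_pjV_ge; first by rewrite divr_ge0 // ltW.
  apply: le_trans hsz; apply: ler_wpM2r; first exact: fsq_ge0.
  by rewrite ler_nat size_loo.
- rewrite lee_fin.
  have -> : 8 * q2 / (dl * tau) ^+ 2 = 2 * q2 / (dl / 2 * tau) ^+ 2.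
    by field; rewrite !lt0r_neq0.
  by rewrite ler_wpM2r ?invr_ge0 ?sqr_ge0 // ler_wpM2l.
Qed.

(** * Upper bound for the remaining trace after the first rows *)

Section first_rows.
Notation N1 := (pj B).
Let fsqN1S : fsq (N1 *m S) <= tau.
Proof.
rewrite fsqMS ?pj_sym ?pj_idem // killB; last exact: pj_mem.
have := Vge0 (subpj_sym B) (subpj_idem B).
by rewrite mulmxBl mul1mx raddfB /= subr_ge0.
Qed.
Let QN1 : fsq (S *m N1 *m S) <= q2.
Proof. by apply: (fsq_SMS_killB (pj_sym B) (pj_idem B)); exact: pj_mem. Qed.
Let mN1 m (F : (nat -> 'cV[R]_p) -> 'M[R]_(m, p)) : mxmeas F -> mxmeas (fun a => F a *m N1).
Proof. by move=> mF; apply: mxmeasM => //; exact: mxmeas_cst. Qed.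
Let far_N1 dl i : (i < n)%N -> 0 < dl ->
  (Ex (fun a => ((1 + dl) * tau <= fsq (N1 *m a i))%R%:R) <= (2 * q2 / (dl * tau) ^+ 2)%:E)%E.
Proof.
move=> ilt dl0; have nF : nnm (fun a => ((1 + dl) * tau <= fsq (N1 *m a i))%R%:R).
  apply/nnm_ind/rmeas_ge_cst/rmeas_fsq/mxmeasM; [exact: mxmeas_cst|exact: mxmeas_row].
apply: (rexp_le_cst mX hXindep ilt nF).
  by rewrite divr_ge0 ?sqr_ge0 // mulr_ge0 ?ler0n ?fsq_ge0.
move=> a; under eq_integral do rewrite updr_id.
have gm := rows_moments mX sS hXrow ilt.
apply: (le_trans (chebyshev_upper sS gm (pj_sym B) (pj_idem B)
  (c := (1 + dl) * tau) (r := dl * tau) _ _)).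
- by rewrite mulr_gt0.
- by rewrite mulrDl mul1r lerD2r.
- by rewrite lee_fin ler_wpM2r ?invr_ge0 ?sqr_ge0 // ler_wpM2l ?ler0n.
Qed.
(** Averaging over [a j] leaves [|S N1 a_i|^2]; averaging that over [a i] leaves the norm bounded in
    [QN1]. *)
Let cross_N1 i j : (i < n)%N -> (j < n)%N -> i != j ->
  (Ex (fun a => fsq ((a i)^T *m N1 *m a j)) <= q2%:E)%E.
Proof.
move=> ilt jlt ij; have gi := rows_moments mX sS hXrow ilt.
have gj := rows_moments mX sS hXrow jlt.
have n1 : nnm (fun a : nat -> 'cV[R]_p => fsq ((a i)^T *m N1 *m a j)).
  by apply: nnm_fsq; apply: mxmeasM; [apply/mN1/mxmeas_tr/mxmeas_row|exact: mxmeas_row].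
have n2 : nnm (fun a : nat -> 'cV[R]_p => fsq (S *m N1 *m a i)).
  by apply: nnm_fsq; apply: mxmeasM; [exact: mxmeas_cst|exact: mxmeas_row].
apply: (@le_trans _ _ (Ex (fun a => fsq (S *m N1 *m a i)))).
  apply: (rexp_step_le mX hXindep jlt) => // a.
  under eq_integral do rewrite updr_id /updr (negPf ij).
  rewrite (gm2 gj ((a i)^T *m N1)).2 lee_fin.
  by rewrite -fsq_tr [((a i)^T *m N1 *m S)^T]trmx_mul trmx_mul trmxK pj_sym sS mulmxA.
apply: (rexp_le_cst mX hXindep ilt n2); first exact: fsq_ge0.
move=> a; under eq_integral do rewrite updr_id.
by rewrite (gm2 gi (S *m N1)).2 lee_fin.
Qed.
Let diag_N1 i : (i < n)%N ->
  (Ex (fun a => fsq ((a i)^T *m N1 *m a i)) <= (tau ^+ 2 + 2 * q2)%:E)%E.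
Proof.
move=> ilt; have gi := rows_moments mX sS hXrow ilt.
have n1 : nnm (fun a : nat -> 'cV[R]_p => fsq ((a i)^T *m N1 *m a i)).
  by apply: nnm_fsq; apply: mxmeasM; [apply/mN1/mxmeas_tr/mxmeas_row|exact: mxmeas_row].
apply: (rexp_le_cst mX hXindep ilt n1).
  by rewrite addr_ge0 ?sqr_ge0 // mulr_ge0 ?ler0n ?fsq_ge0.
move=> a; under eq_integral do rewrite updr_id.
have E w : (fsq (N1 *m rows X w i) - 0) ^+ 2 = fsq ((rows X w i)^T *m N1 *m rows X w i).
  by rewrite subr0 -mulmxA pj_dot /fsq !big_ord1 !mxE eqxx mulr1n.
have := (has_mean_eq (proj_var sS gi (pj_sym B) (pj_idem B) 0) E erefl).2.
move=> ->; rewrite subr0 lee_fin addrC lerD ?ler_wpM2l ?ler0n //.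
by rewrite ler_sqr ?nnegrE ?fsq_ge0 // ltW.
Qed.
Lemma sum_cross_N1 k : (k <= n)%N ->
  (Ex (fun a => (\sum_(i < k) \sum_(j < k) fsq ((a i)^T *m N1 *m a j))%R) <=
   (k%:R * (tau ^+ 2 + 2 * q2) + k%:R ^+ 2 * q2)%:E)%E.
Proof.
move=> kn; have n1 i j : nnm (fun a : nat -> 'cV[R]_p => fsq ((a i)^T *m N1 *m a j)).
  by apply: nnm_fsq; apply: mxmeasM; [apply/mN1/mxmeas_tr/mxmeas_row|exact: mxmeas_row].
have lt (i : 'I_k) : (i < n)%N := leq_trans (ltn_ord i) kn.
have c1 : 0 <= tau ^+ 2 + 2 * q2 by rewrite addr_ge0 ?sqr_ge0 // mulr_ge0 ?ler0n ?fsq_ge0.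
apply: (@le_trans _ _ (\sum_(i < k) (tau ^+ 2 + 2 * q2 + k%:R * q2))%:E).
  apply: rexp_sum_le => // [i|i _]; first exact: nnm_sum.
  apply: (@le_trans _ _ (\sum_(j < k) ((i == j)%:R * (tau ^+ 2 + 2 * q2) + q2))%:E).
    apply: rexp_sum_le => // j _; case: (eqVneq i j) => [<-|ij].
      apply: (le_trans (diag_N1 (lt i))).
      by rewrite lee_fin mul1r lerDl fsq_ge0.
    by rewrite mul0r add0r; apply: cross_N1.
  rewrite lee_fin big_split /= -mulr_suml lerD //.
    rewrite (bigD1 i) //= eqxx big1 ?addr0 ?mul1r // => j ji.
    by rewrite eq_sym (negPf ji).
  by rewrite sumr_const card_ord mulr_natl.
rewrite sumr_const card_ord lee_fin -mulr_natl le_eqVlt; apply/orP; left; apply/eqP.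
by ring.
Qed.
(** If [tk S a k] is large, so is the trace left by each leave-one-out projection. The omitted row
    is independent of that projection, so it is far from the others with conditional probability at
    least [dl^2]. A large trace therefore forces about [k dl^2] far rows on average, whereas
    [sum_loo_far_le] allows only few. *)
Lemma prob_tk_large k dl mu : (0 < k <= n)%N -> 0 < dl -> dl <= 1 / 10 -> 0 < mu ->
  (Ex (fun a => (~~ (tk S a k <= (1 + 24 * dl) * tau)%R)%:R) <=
   ((k%:R * dl ^+ 2)^-1 *
     ((size B)%:R / dl + k%:R * (2 * q2 / (dl * tau) ^+ 2) +
      (tau / mu * (size B)%:R + mu / tau * (k%:R * (tau ^+ 2 + 2 * q2) + k%:R ^+ 2 * q2))
      / (2 * dl ^+ 2 * tau)))%:E)%E.
Proof.
move=> /andP[k0 kn] dl0 dl1 mu0.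
have lt (i : 'I_k) : (i < n)%N := leq_trans (ltn_ord i) kn.
pose large (i : nat) (a : nat -> 'cV[R]_p) := (~~ (fsq (loo0 k a i *m S) <= (1 + 24 * dl) * tau)%R)%:R : R.
pose far (i : nat) (a : nat -> 'cV[R]_p) := ((1 + 12 * dl) * tau < fsq (loo0 k a i *m a i))%R%:R : R.
have mloo i : mxmeas (fun a : nat -> 'cV[R]_p => loo0 k a i).
  by apply: mxmeas_pj => j; exact: mxmeas_row.
have nlarge i : nnm (large i).
  apply/nnm_ind/rmeas_ind_not/rmeas_le_cst/rmeas_fsq; apply: mxmeasM => //.
  exact: mxmeas_cst.
have nfar i : nnm (far i).
  apply/nnm_ind/rmeas_lt_cst/rmeas_fsq; apply: mxmeasM => //.
  exact: mxmeas_row.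
have ntk : nnm (fun a => (~~ (tk S a k <= (1 + 24 * dl) * tau)%R)%:R).
  exact/nnm_ind/rmeas_ind_not/rmeas_le_cst/rmeas_tk.
have loo_upd a i x : loo0 k (updr a i x) i = loo0 k a i.
  by rewrite /loo0 map_updr // mem_rem_uniqF ?iota_uniq.
have step1 (i : 'I_k) : (Ex (fun a => (dl ^+ 2 * large i a)%R) <= Ex (far i))%E.
  apply: (rexp_step_ge mX hXindep (lt i)) => //.
    by apply: nnmM => //; apply: nnm_cst; exact: sqr_ge0.
  move=> a; rewrite /far; under eq_integral do rewrite loo_upd updr_id.
  rewrite /large; case: (leP (fsq (loo0 k a i *m S))) => /= big; last first.
    have t'0 : 0 < fsq (loo0 k a i *m S) by apply: le_lt_trans big; rewrite mulr_ge0 ?(ltW tau0) //; lra.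
    pose th := (1 + 12 * dl) * tau / fsq (loo0 k a i *m S).
    (* The ratio of the thresholds [1 + 12 dl] and [1 + 24 dl] is at most [1 - 3 dl], so the
       small-ball bound is at least [(3 dl)^2 / 3], more than the required [dl^2]. *)
    have th1 : th <= 1 - 3 * dl.
      rewrite /th ler_pdivrMr //; apply: (@le_trans _ _ ((1 - 3 * dl) * ((1 + 24 * dl) * tau))).
        rewrite mulrA ler_wpM2r ?(ltW tau0) //.
        have -> : (1 - 3 * dl) * (1 + 24 * dl) = 1 + 12 * dl + 9 * dl * (1 - 8 * dl) by ring.
        by rewrite lerDl mulr_ge0 //; lra.
      by rewrite ler_wpM2l ?(ltW big) //; lra.
    have th0 : 0 <= th by rewrite divr_ge0 ?fsq_ge0 // mulr_ge0 ?(ltW tau0) //; lra.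
    have gi := rows_moments mX sS hXrow (lt i).
    have th01 : 0 <= th <= 1 by rewrite th0 /=; lra.
    have := small_ball sS gi (loo0_sym k a i) (loo0_idem k a i) t'0 th01.
    have -> : th * fsq (loo0 k a i *m S) = (1 + 12 * dl) * tau by rewrite /th divfK // gt_eqF.
    under eq_integral do rewrite -ltNge.
    apply: le_trans; rewrite lee_fin mulr1.
    clearbody th; have sq : (3 * dl) ^+ 2 <= (1 - th) ^+ 2.
      by rewrite ler_sqr ?nnegrE; lra.
    by have := sqr_ge0 dl; rewrite exprMn in sq; lra.
  by rewrite mulr0; apply: integral_ge0 => w _; rewrite lee_fin.
have step2 : (Ex (fun a => (k%:R * dl ^+ 2 * (~~ (tk S a k <= (1 + 24 * dl) * tau)%R)%:R)%R) <=
    Ex (fun a => (\sum_(i < k) far i a)%R))%E.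
  apply: (@le_trans _ _ (Ex (fun a => (\sum_(i < k) dl ^+ 2 * large i a)%R))).
    apply: rexp_le => //.
    - by apply: nnmM => //; apply: nnm_cst; rewrite mulr_ge0 ?ler0n ?sqr_ge0.
    - by apply: nnm_sum => i; apply: nnmM => //; apply: nnm_cst; exact: sqr_ge0.
    - move=> a; rewrite -mulrA.
      have sumk (c : R) : k%:R * c = \sum_(i < k) c by rewrite sumr_const card_ord mulr_natl.
      rewrite sumk; apply: ler_sum => i _; rewrite ler_wpM2l ?sqr_ge0 // /large.
      have sub : tk S a k <= fsq (loo0 k a i *m S).
        apply: fsq_pj_sub => v /mapP[j /mem_rem ji ->].
        by apply: map_f; rewrite mem_prefix_idx; move: ji; rewrite mem_iota add0n.
      case: (leP (fsq (loo0 k a i *m S))) => [h2|_] /=; last by rewrite lern1 leq_b1.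
      by rewrite (le_trans sub h2).
  rewrite rexp_sum //; last by move=> i; apply: nnmM => //; apply: nnm_cst; exact: sqr_ge0.
  by rewrite rexp_sum //; apply: lee_sum.
rewrite (rexpZ P mX) // in step2; last by rewrite mulr_ge0 ?ler0n ?sqr_ge0.
have kd : 0 < k%:R * dl ^+ 2 by rewrite mulr_gt0 ?ltr0n ?exprn_gt0.
rewrite -(@lee_pmul2l _ (k%:R * dl ^+ 2)%:E) ?lte_fin // -EFinM mulVKf ?gt_eqF //.
apply: (le_trans step2).
have n2 (i : 'I_k) : nnm (fun a : nat -> 'cV[R]_p => ((1 + dl) * tau <= fsq (N1 *m a i))%R%:R).
  by apply/nnm_ind/rmeas_ge_cst/rmeas_fsq/mxmeasM; [exact: mxmeas_cst|exact: mxmeas_row].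
have n1 : nnm (fun a : nat -> 'cV[R]_p => \sum_(i < k) \sum_(j < k) fsq ((a i)^T *m N1 *m a j)).
  apply: nnm_sum => i; apply: nnm_sum => j.
  by apply: nnm_fsq; apply: mxmeasM; [apply/mN1/mxmeas_tr/mxmeas_row|exact: mxmeas_row].
have p1 : 0 <= mu / tau by rewrite divr_ge0 // ltW.
have p2 : 0 <= tau / mu * (size B)%:R by rewrite mulr_ge0 // divr_ge0 // ltW.
have p3 : 0 <= (2 * dl ^+ 2 * tau)^-1 by rewrite invr_ge0 mulr_ge0 ?(ltW tau0) // mulr_ge0 ?sqr_ge0.
have nA : nnm (fun a : nat -> 'cV[R]_p => tau / mu * (size B)%:R +
   mu / tau * \sum_(i < k) \sum_(j < k) fsq ((a i)^T *m N1 *m a j)).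
  by apply: nnmD; [exact: nnm_cst|apply: nnmM => //; exact: nnm_cst].
have nC : nnm (fun a : nat -> 'cV[R]_p => (2 * dl ^+ 2 * tau)^-1 * (tau / mu * (size B)%:R +
   mu / tau * \sum_(i < k) \sum_(j < k) fsq ((a i)^T *m N1 *m a j))).
  by apply: nnmM => //; exact: nnm_cst.
have nB : nnm (fun a : nat -> 'cV[R]_p => (size B)%:R / dl +
    \sum_(i < k) ((1 + dl) * tau <= fsq (N1 *m a i))%R%:R).
  by apply: nnmD; [apply: nnm_cst; rewrite divr_ge0 // ltW|exact: nnm_sum].
apply: (rexp_le_trans mX (G := fun a => (size B)%:R / dl +
    \sum_(i < k) ((1 + dl) * tau <= fsq (N1 *m a i))%R%:R + (2 * dl ^+ 2 * tau)^-1 * (tau / mu * (size B)%:R +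
   mu / tau * \sum_(i < k) \sum_(j < k) fsq ((a i)^T *m N1 *m a j)))).
- exact: nnm_sum.
- exact: nnmD.
- by move=> a; rewrite [_^-1 * _]mulrC; exact: sum_loo_far_le.
apply: rexpD_le => //.
  apply: rexpD_le => //; first by apply: nnm_cst; rewrite divr_ge0 // ltW.
  - exact: nnm_sum.
  - by rewrite rexp_cst.
  - rewrite mulr_natl -[k in _ *+ k]card_ord -sumr_const.
    by apply: rexp_sum_le => // i _; exact: far_N1.
rewrite [X in (_ <= X%:E)%E]mulrC; apply: rexpZ_le => //.
apply: rexpD_le => //; first exact: nnm_cst.
- by apply: nnmM => //; exact: nnm_cst.
- by rewrite rexp_cst.
- by apply: rexpZ_le => //; exact: sum_cross_N1.
Qed.
End first_rows.

(** * Sum of the fluctuations [Qk] after the first rows *)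

Section later_rows.
Variables (k0 : nat) (eta th : R).
Hypothesis eta01 : 0 <= eta < 1.
Hypothesis n_q2 : n%:R * q2 <= (eta * tau) ^+ 2.
Hypothesis tau_th : tau <= th.
Hypothesis k0n : (k0 <= n)%N.
(** Decided by the first [k0] rows, so it can be treated as a constant when any later row is
    averaged; monotonicity of the trace extends its bound to all later times. *)
Definition tame (a : nat -> 'cV[R]_p) : bool := (tk S a k0 <= th)%R.
Lemma rmeas_tame : rmeas (fun a => (tame a)%:R).
Proof. exact/rmeas_le_cst/rmeas_tk. Qed.
Lemma tk_ge (a : nat -> 'cV[R]_p) k : (k <= n)%N -> (1 - eta) * tau <= tk S a k.
Proof.
move=> kn; case/andP: eta01 => e0 _.
apply: le_trans (trMV (Mk_sym a k) (Mk_idem a k)); apply: tr_pjV_ge => //.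
apply: le_trans n_q2; rewrite ler_wpM2r ?fsq_ge0 // ler_nat.
by rewrite size_map size_rev size_iota.
Qed.
Lemma tk_le (a : nat -> 'cV[R]_p) k : (k0 <= k)%N -> tame a -> tk S a k <= th.
Proof.
move=> k0k; apply: le_trans; apply: fsq_pj_sub => v /mapP[j jk ->].
by apply: map_f; move: jk; rewrite !mem_prefix_idx => /leq_trans; exact.
Qed.
Lemma tame_updr a k x : (k0 <= k)%N -> tame (updr a k x) = tame a.
Proof. by move=> k0k; rewrite /tame tk_updr. Qed.
(** On [tame] each later row lowers the trace by at least [Qk / (3 th)] on average, and the trace
    can only fall from [th] to [(1 - eta) * tau]. *)
Lemma sum_Qk_le :
  (Ex (fun a => ((tame a)%:R * \sum_(k0 <= k < n) Qk S a k)%R) <=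
   (3 * th * (th - (1 - eta) * tau))%:E)%E.
Proof.
case/andP: eta01 => e0 e1; have tl : 0 < (1 - eta) * tau by rewrite mulr_gt0 // subr_gt0.
have nG : nnm (fun a => (tame a)%:R) by apply/nnm_ind/rmeas_tame.
have nQ k : nnm (fun a => Qk S a k) by split; [exact: rmeas_Qk|move=> a; exact: fsq_ge0].
have nb k : nnm (fun a : nat -> 'cV[R]_p => (bk a k)^-1).
  by apply/nnmV; split; [exact: rmeas_bk|move=> a; exact: fsq_ge0].
have nu k : nnm (fun a => fsq (S *m Mk a k *m a k)).
  apply: nnm_fsq; apply: mxmeasM; last exact: mxmeas_row.
  by apply: mxmeasM; [exact: mxmeas_cst|exact: mxmeas_Mk].
have nr k : nnm (fun a => fsq (S *m Mk a k *m a k) / bk a k) by exact: nnmM.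
have th0 : 0 < th by exact: lt_le_trans tau_th.
have tlth : (1 - eta) * tau <= th.
  by apply: le_trans tau_th; rewrite ler_piMl ?(ltW tau0) // gerBl.
have step k : (k0 <= k < n)%N -> (Ex (fun a => ((tame a)%:R * Qk S a k)%R) <=
    Ex (fun a => (3 * th * ((tame a)%:R * (fsq (S *m Mk a k *m a k) / bk a k)))%R))%E.
  move=> /andP[k0k kn].
  have nF : nnm (fun a => (tame a)%:R * (fsq (S *m Mk a k *m a k) / bk a k)) by exact: nnmM.
  apply: (rexp_step_ge mX hXindep kn).
  - by apply: nnmM => //; apply: nnm_cst; rewrite mulr_ge0 ?(ltW th0).
  - exact: nnmM.
  - move=> a; under eq_integral do rewrite tame_updr //.
    case hG: (tame a); last first.
      rewrite mul0r; apply: integral_ge0 => w _.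
      by rewrite mul0r mulr0.
    rewrite mul1r.
    have t1 : tk S a k <= th by exact: tk_le.
    have t0 : 0 < tk S a k by apply: lt_le_trans tl _; apply: tk_ge; exact: ltnW.
    have gk := rows_moments mX sS hXrow kn.
    pose f w := fsq (S *m Mk a k *m rows X w k) / fsq (Mk a k *m rows X w k).
    have mf : measurable_fun setT f.
      apply: measurable_funM; first exact: has_mean_measurable (gm2 gk (S *m Mk a k)).
      exact/measurable_inv/(has_mean_measurable (gm2 gk (Mk a k))).
    have := ratio_mean_ge gk t0 mf (fun=> erefl).
    rewrite -/(tk S a k) -/(Qk S a k) => h.
    have -> : (\int[P]_w' (3 * th * (1 * (fsq (S *m Mk (updr a k (rows X w' k)) k *m updr a k (rows X w' k) k) /
        bk (updr a k (rows X w' k)) k)))%:E = (3 * th)%:E * \int[P]_w' (f w')%:E)%E.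
      have th3 : 0 <= 3 * th by rewrite mulr_ge0 // ltW.
      rewrite -ge0_integralZl ?lee_fin //.
        by apply: eq_integral => w _; rewrite -EFinM bk_updr_id Mk_updr // updr_id mul1r.
        exact/measurable_EFinP.
      by move=> w _; rewrite lee_fin /f divr_ge0 // fsq_ge0.
    apply: (@le_trans _ _ ((3 * th)%:E * (Qk S a k / (3 * tk S a k))%:E)%E); last first.
      by rewrite lee_wpmul2l // lee_fin mulr_ge0 // ltW.
    rewrite -EFinM lee_fin mulrA ler_pdivlMr ?mulr_gt0 //.
    by rewrite [leRHS]mulrC ler_wpM2l ?fsq_ge0 // ler_wpM2l.
pose lst := index_iota k0 n.
have nR k : nnm (fun a => 3 * th * ((tame a)%:R * (fsq (S *m Mk a k *m a k) / bk a k))).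
  by apply: nnmM; [apply: nnm_cst; rewrite mulr_ge0 ?(ltW th0)|exact: nnmM].
have -> : (fun a => ((tame a)%:R * \sum_(k0 <= k < n) Qk S a k)%R) =
    (fun a => (\sum_(k <- lst) (tame a)%:R * Qk S a k)%R).
  by apply/funext => a; rewrite mulr_sumr.
rewrite rexp_sum //; last by move=> k; exact: nnmM.
apply: (@le_trans _ _ (\sum_(k <- lst) Ex (fun a => (3 * th * ((tame a)%:R * (fsq (S *m Mk a k *m a k) / bk a k)))%R))%E).
  rewrite big_seq [leRHS]big_seq; apply: lee_sum => k.
  by rewrite mem_index_iota; exact: step.
rewrite -rexp_sum // -(rexp_cst P X (3 * th * (th - (1 - eta) * tau))).
apply: rexp_le => //; first exact: nnm_sum.
  by apply: nnm_cst; rewrite mulr_ge0 ?subr_ge0 // mulr_ge0 // ltW.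
move=> a; rewrite -mulr_sumr ler_wpM2l ?mulr_ge0 ?(ltW th0) // -mulr_sumr.
case hG: (tame a); last by rewrite mul0r subr_ge0.
rewrite mul1r.
have -> : \sum_(k <- lst) fsq (S *m Mk a k *m a k) / bk a k = tk S a k0 - tk S a n.
  rewrite -[RHS]opprB -(telescope_sumr (fun k => tk S a k) k0n) -sumrN; apply: eq_bigr => k _.
  by rewrite opprB (tkS sS) opprB [RHS]addrC subrK.
by apply: lerB; [exact: hG|exact: tk_ge].
Qed.
End later_rows.

(** * An explicit interpolator of small norm *)

Section feasible.
Lemma apart_bk dl (a : nat -> 'cV[R]_p) k : apart dl a -> (k < n)%N -> (1 - dl) * tau < bk a k.
Proof.
move=> /allP/(_ k); rewrite mem_iota => h kn; apply: lt_le_trans (h kn) _.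
apply: fsq_pj_sub => v /mapP[j jk ->]; rewrite mem_cat; apply/orP; right; apply: map_f.
move: jk; rewrite mem_prefix_idx => jk.
by rewrite mem_rem_uniq ?iota_uniq // inE mem_iota /= (ltn_trans jk kn) andbT neq_ltn jk.
Qed.
Variable w : 'cV[R]_p.
Definition augW : 'M[R]_(p, 1 + n) := row_mx w 0.
(** With [augW], right multiplication by [col_mx 1%:M z] turns these fixed responses into those of
    the signal [w] with noise vector [z]. *)
Definition augs (k : nat) : 'rV[R]_(1 + n) := row_mx 0 (\row_j (j == k :> nat)%:R).
Lemma fsq_augs k : (k < n)%N -> fsq (augs k) = 1.
Proof.
move=> kn; rewrite /augs fsq_row_mx fsq0 add0r /fsq big_ord1 (bigD1 (Ordinal kn)) //= big1 => [|j jk].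
  by rewrite !mxE eqxx expr1n addr0.
by rewrite mxE (inj_eq val_inj j (Ordinal kn)) (negPf jk) expr0n.
Qed.
Lemma fsq_augs_le k : fsq (augs k) <= 1.
Proof.
have [kn|nk] := ltnP k n; first by rewrite fsq_augs.
rewrite /augs fsq_row_mx fsq0 add0r (_ : \row_j _ = 0) ?fsq0 //.
by apply/rowP => j; rewrite !mxE ltn_eqF // (leq_trans (ltn_ord j)).
Qed.
Let z (a : nat -> 'cV[R]_p) j := (fsq (loo a j *m a j))^-1 *: (loo a j *m a j).
(** The vectors [z a j] form a dual system to the rows: [z a j] has inner product 1 with row [j] and
    0 with the others, and its squared norm is the inverse of a squared distance. With [w] as first
    column they solve all the augmented systems at once. *)
Lemma fsq_Wk_le dl (a : nat -> 'cV[R]_p) : dl < 1 -> apart dl a ->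
  fsq (Wk augW augs a n) <= fsq w + n%:R / ((1 - dl) * tau).
Proof.
move=> dl1 /allP gA.
have d0 : 0 < (1 - dl) * tau by rewrite mulr_gt0 // subr_gt0.
have big j : (j < n)%N -> (1 - dl) * tau < fsq (loo a j *m a j).
  by move=> jn; apply: gA; rewrite mem_iota.
pose Z : 'M[R]_(p, 1 + n) := row_mx w (\matrix_(i < p, j < n) z a j i 0).
have colZ (j : 'I_n) : col j (\matrix_(i < p, j < n) z a j i 0) = z a j.
  by apply/colP => i; rewrite !mxE.
rewrite (@Wk_solution _ _ _ _ _ a n Z) => [|i ilt].
  apply: (@le_trans _ _ (fsq Z)).
    by rewrite fsq_proj_le ?subpj_sym ?subpj_idem.
  rewrite fsq_row_mx lerD2l fsq_col_sum.
  have -> : n%:R / ((1 - dl) * tau) = \sum_(j < n) ((1 - dl) * tau)^-1.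
    by rewrite sumr_const card_ord mulr_natl.
  apply: ler_sum => j _; rewrite colZ /z fsqZ.
  have bj := big j (ltn_ord j); have b0 := lt_trans d0 bj.
  have -> : (fsq (loo a j *m a j))^-1 ^+ 2 * fsq (loo a j *m a j) =
    (fsq (loo a j *m a j))^-1 by field; rewrite gt_eqF.
  by rewrite lef_pV2 ?posrE // ltW.
rewrite /resp mul_mx_row /augW mul_mx_row /augs mulmx0 add_row_mx addr0 add0r; congr row_mx.
apply/rowP => j; rewrite -[LHS](_ : ((a i)^T *m z a j) 0 0 = _); last first.
  by rewrite !mxE; apply: eq_bigr => l _; rewrite !mxE.
have b0 := lt_trans d0 (big j (ltn_ord j)).
rewrite /z -scalemxAr mxE [RHS]mxE; case: (eqVneq (j : nat) i) => [<-|ji].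
  by rewrite pj_dot mxE eqxx mulr1n mulVf // gt_eqF.
have kill : loo a j *m a i = 0.
  apply: pj_mem; rewrite mem_cat; apply/orP; right; apply: map_f.
  by rewrite mem_rem_uniq ?iota_uniq // inE mem_iota /= add0n ilt andbT eq_sym.
have -> : (a i)^T *m (loo a j *m a j) = (loo a j *m a i)^T *m a j.
  by rewrite [in RHS]trmx_mul pj_sym mulmxA.
by rewrite kill trmx0 mul0mx mxE mulr0.
Qed.
End feasible.

(** * Existence of a time of small excess risk *)

Section early_index.
Context {q : nat}.
Variables (Wst : 'M[R]_(p, q)) (s : nat -> 'rV[R]_q) (k0 : nat).
Variables (dl rho kappa gam thr L eps p3 zeta : R).
Hypothesis s1 : forall k, (k < n)%N -> fsq (s k) = 1.
Hypothesis dl1 : dl < 1.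
Hypothesis bA : forall a k, apart dl a -> (k < n)%N -> 0 < bk a k.
Hypothesis WA : forall a, apart dl a -> fsq (Wk Wst s a n) <= L.
Hypothesis rho0 : 0 < rho.
Hypothesis PA : (Ex (fun a => (~~ apart dl a)%:R) <= (rho ^+ 2)%:E)%E.
Notation tame := (tame k0 (thr * tau)).
Hypothesis SQ : (Ex (fun a => ((tame a)%:R * \sum_(k0 <= k < n) Qk S a k)%R) <= (kappa * tau ^+ 2)%:E)%E.
Hypothesis PG : (Ex (fun a => (~~ tame a)%:R) <= p3%:E)%E.
Hypothesis thr1 : 1 <= thr.
Hypothesis gam0 : 0 < gam.
Hypothesis eps01 : 0 < eps <= 1.
Let Phi a k := Phik S Wst s a k.
Let m a k := Num.min (1 + Phi a k) (1 + eps).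
(** With this weight the squared residual has conditional mean exactly [m], between 1 and 2, when
    the noise part is a unit vector, and a bounded conditional second moment, however large [Phi]
    is. *)
Let g a k := m a k / (1 + Phi a k).
Let G a : R := (tame a)%:R.
Let F1 k a := G a * (g a k * fsq (ek Wst s a k)).
Let F2 k a := G a * (g a k * (fsq (ek Wst s a k) * bk a k)).
Let F3 k a := (~~ apart dl a)%:R * (g a k * fsq (ek Wst s a k)).
Let M k a := G a * m a k.
Let Phi0 a k : 0 <= Phi a k. Proof. exact: fsq_ge0. Qed.
Let eps0 : 0 < eps. Proof. by case/andP: eps01. Qed.
Let m1 a k : 1 <= m a k.
Proof. by rewrite le_min !lerDl Phi0 ltW. Qed.
Let m2 a k : m a k <= 1 + eps. Proof. by rewrite ge_min lexx orbT. Qed.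
Let m2' a k : m a k <= 2.
Proof. by apply: le_trans (m2 a k) _; case/andP: eps01 => _; generalize eps => x ?; lra. Qed.
Let g0 a k : 0 <= g a k.
Proof. by rewrite divr_ge0 ?(le_trans _ (m1 a k)) ?addr_ge0. Qed.
Let gM a k : g a k * (1 + Phi a k) = m a k.
Proof. by rewrite divfK // gt_eqF // ltr_pwDl. Qed.
Let g1 a k : g a k <= 1.
Proof. by rewrite ler_pdivrMr ?ltr_pwDl // mul1r ge_min lexx. Qed.
Let nQ k : nnm (fun a => Qk S a k).
Proof. by split; [exact: rmeas_Qk|move=> a; exact: fsq_ge0]. Qed.
Let n1P k : nnm (fun a => 1 + Phi a k).
Proof. by apply: nnmD; [exact: nnm_cst|split => [|a]; [exact: rmeas_Phik|exact: Phi0]]. Qed.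
Let nm k : nnm (fun a => m a k).
Proof. by apply: nnm_min => //; apply: nnm_cst; rewrite addr_ge0 // ltW. Qed.
Let ng k : nnm (fun a => g a k). Proof. by apply: nnmM => //; exact: nnmV. Qed.
Let ne k : nnm (fun a => fsq (ek Wst s a k)).
Proof. by split; [exact: rmeas_ek|move=> a; exact: fsq_ge0]. Qed.
Let nb k : nnm (fun a : nat -> 'cV[R]_p => bk a k).
Proof. by split; [exact: rmeas_bk|move=> a; exact: fsq_ge0]. Qed.
Let nG : nnm G. Proof. exact/nnm_ind/rmeas_tame. Qed.
Let nA : nnm (fun a => (~~ apart dl a)%:R).
Proof. exact/nnm_ind/rmeas_ind_not/rmeas_apart. Qed.
Let nF1 k : nnm (F1 k). Proof. by apply: nnmM => //; exact: nnmM. Qed.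
Let nF2 k : nnm (F2 k). Proof. by apply: nnmM => //; apply: nnmM => //; exact: nnmM. Qed.
Let nF3 k : nnm (F3 k). Proof. by apply: nnmM => //; exact: nnmM. Qed.
Let nM k : nnm (M k). Proof. exact: nnmM. Qed.
Let g_updr a k x : g (updr a k x) k = g a k.
Proof. by rewrite /g /m /Phi Phik_updr. Qed.
Let F1_ge k : (k0 <= k < n)%N -> (Ex (M k) <= Ex (F1 k))%E.
Proof.
move=> /andP[k0k kn]; have gk := rows_moments mX sS hXrow kn.
apply: (rexp_step_ge mX hXindep kn) => // a.
have em := has_meanZ (G a * g a k) (resid_mean sS gk (Dk Wst s a k) (s k)).
have <- : (\int[P]_w' (G a * g a k * fsq (s k - (rows X w' k)^T *m Dk Wst s a k))%:E =
    \int[P]_w' (F1 k (updr a k (rows X w' k)))%:E)%E.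
  by apply: eq_integral => w _; rewrite /F1 /G tame_updr // g_updr ek_updr_id -mulrA.
by rewrite em.2 lee_fin s1 // /M -gM -mulrA.
Qed.
Let tau_gam : 0 < gam * tau. Proof. by rewrite mulr_gt0. Qed.
Let F2_le k : (k0 <= k < n)%N ->
  (Ex (F2 k) <= Ex (fun a => ((thr + 2 * gam) * tau * M k a + 6 / (gam * tau) * (G a * Qk S a k))%R))%E.
Proof.
move=> /andP[k0k kn]; have gk := rows_moments mX sS hXrow kn.
have thr0 : 0 <= (thr + 2 * gam) * tau.
  rewrite mulr_ge0 ?(ltW tau0) //.
  by move: thr1 gam0; generalize thr, gam => x y ? ?; lra.
apply: (rexp_step_le mX hXindep kn) => // [|a].
  apply: nnmD; first by apply: nnmM => //; exact: nnm_cst.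
  by apply: nnmM; [apply: nnm_cst; rewrite divr_ge0 // ltW|exact: nnmM].
have s1k : fsq (s k) <= 1 by rewrite s1.
have Gg : 0 <= G a * g a k by rewrite mulr_ge0 ?ler0n.
have h := resid_proj_mean_le sS gk (Mk_sym a k) (Mk_idem a k) (Dk Wst s a k) s1k tau_gam.
apply: le_trans (integralZ_le Gg _ _ _ h) _.
- apply: measurable_funM; first exact: has_mean_measurable (resid_mean sS gk _ _).
  exact: has_mean_measurable (gm2 gk (Mk a k)).
- by move=> w; rewrite mulr_ge0 ?fsq_ge0.
- move=> w; rewrite /F2 /G tame_updr // g_updr ek_updr_id bk_updr_id.
  by rewrite -[in RHS](mulrA _ (g a k)).
have e y : G a * g a k * ((1 + fsq (S *m Dk Wst s a k)) * y) = G a * (m a k * y).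
  by rewrite -(gM a k) /Phi /Phik; ring.
rewrite lee_fin e -/(tk S a k) -/(Qk S a k).
case hG: (tame a); last by rewrite /M /G hG !mul0r !mulr0 addr0.
have tl := tk_le k0k hG.
rewrite /M /G hG !mul1r.
apply: (@le_trans _ _ (m a k * ((thr + 2 * gam) * tau) + m a k * (3 * Qk S a k / (gam * tau)))).
  rewrite -mulrDr ler_wpM2l ?(le_trans ler01) // lerD2r.
  by move: tl; generalize (tk S a k), (\tr V), gam, thr => x1 x2 x3 x4; lra.
rewrite [leLHS]addrC [leRHS]addrC [m a k * (_ * tau)]mulrC lerD2r.
have -> : 6 / (gam * tau) * Qk S a k = 2 * (3 * Qk S a k / (gam * tau)).
  by field; rewrite !gt_eqF.
by rewrite ler_wpM2r // divr_ge0 ?(ltW tau_gam) // mulr_ge0 ?fsq_ge0.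
Qed.
Let F3_le k : (k < n)%N -> (Ex (F3 k) <= (8 * rho)%:E)%E.
Proof.
move=> kn; have gk := rows_moments mX sS hXrow kn.
have n2 : nnm (fun a => g a k ^+ 2 * fsq (ek Wst s a k) ^+ 2) by apply: nnmM; exact: nnmM.
have r2 : 0 <= 2 / rho by rewrite divr_ge0 // ltW.
have r8 : 0 <= rho / 8 by rewrite divr_ge0 // ltW.
(* Cauchy-Schwarz in additive form: 48 is [12 * 2 ^+ 2], the bound on the weighted second moment,
   and the weights [2 / rho] and [rho / 8] contribute [2 rho] and [6 rho]. *)
apply: (@le_trans _ _ (2 / rho * rho ^+ 2 + rho / 8 * 48)%:E); last first.
  by rewrite lee_fin (_ : _ + _ = 8 * rho) //; field; rewrite gt_eqF.
apply: (rexp_le_trans mX (G := fun a => 2 / rho * (~~ apart dl a)%:R +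
    rho / 8 * (g a k ^+ 2 * fsq (ek Wst s a k) ^+ 2))) => //.
- by apply: nnmD; apply: nnmM => //; exact: nnm_cst.
- move=> a; rewrite /F3; set y := g a k * _; rewrite -exprMn -/y.
  have y0 : 0 <= y by rewrite mulr_ge0 ?fsq_ge0.
  case: (apart _ _) => /=; rewrite ?mulr0 ?mul0r ?add0r ?mulr1 ?mul1r; first by rewrite mulr_ge0 ?sqr_ge0.
  rewrite -subr_ge0 (_ : _ - y = rho / 8 * (y - 4 / rho) ^+ 2) ?(mulr_ge0 r8 (sqr_ge0 _)) //.
  by field; rewrite gt_eqF.
- apply: rexpD_le => //; try by apply: nnmM => //; exact: nnm_cst.
    exact: rexpZ_le.
  apply: rexpZ_le => //; apply: (rexp_le_cst mX hXindep kn n2) => // a.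
  have s1k : fsq (s k) <= 1 by rewrite s1.
  apply: le_trans (integralZ_le (c := g a k ^+ 2) (sqr_ge0 _) _ _ _ (resid_mean4 sS gk (Dk Wst s a k) s1k)) _.
  - by apply: measurable_funX; exact: has_mean_measurable (resid_mean sS gk _ _).
  - by move=> w; exact: sqr_ge0.
  - by move=> w; rewrite g_updr ek_updr_id.
  rewrite lee_fin mulrCA -exprMn gM.
  have : m a k ^+ 2 <= 2 ^+ 2.
    have h1 := m1 a k; have h2 := m2' a k.
    by rewrite ler_sqr ?nnegrE // (le_trans ler01).
  by lra.
Qed.
Hypothesis L0 : 0 <= L.
Hypothesis k0n : (k0 <= n)%N.
Let lst := index_iota k0 n.
(* On the good event, [2 tau <= tau^2 / b + b] with [b = bk a k]. *)
Let budget a : 2 * tau * \sum_(k <- lst) F1 k a <=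
  tau ^+ 2 * L + \sum_(k <- lst) F2 k a + 2 * tau * \sum_(k <- lst) F3 k a.
Proof.
have F20 : 0 <= \sum_(k <- lst) F2 k a by apply: sumr_ge0 => k _; case: (nF2 k).
have tauL : 0 <= tau ^+ 2 * L by rewrite mulr_ge0 ?sqr_ge0.
have [gA|nA'] := boolP (apart dl a); last first.
  apply: (@le_trans _ _ (2 * tau * \sum_(k <- lst) F3 k a)); last by rewrite lerDr addr_ge0.
  rewrite ler_wpM2l ?mulr_ge0 ?(ltW tau0) //; apply: ler_sum => k _.
  rewrite /F3 nA' mul1r /F1; apply: ler_piMl; first exact: mulr_ge0 (g0 a k) (fsq_ge0 _).
  by rewrite /G lern1 leq_b1.
have -> : \sum_(k <- lst) F3 k a = 0 by apply: big1 => k _; rewrite /F3 gA mul0r.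
rewrite mulr0 addr0.
apply: (@le_trans _ _ (\sum_(k <- lst) (tau ^+ 2 * (fsq (ek Wst s a k) / bk a k) + F2 k a))).
  rewrite mulr_sumr big_seq [leRHS]big_seq; apply: ler_sum => k.
  rewrite mem_index_iota => /andP[_ kn]; have b0 := bA gA kn.
  have e0 : 0 <= fsq (ek Wst s a k) by exact: fsq_ge0.
  have x0 : 0 <= fsq (ek Wst s a k) / bk a k by rewrite divr_ge0 // ltW.
  pose y := G a * g a k.
  have y0 : 0 <= y by exact: mulr_ge0 (ler0n _ _) (g0 a k).
  have y1 : y <= 1 by apply: mulr_ile1; rewrite ?(g0 a k) ?(g1 a k) // /G ?ler0n // lern1 leq_b1.
  have -> : F1 k a = y * fsq (ek Wst s a k) by rewrite /F1 /y mulrA.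
  have -> : F2 k a = y * (fsq (ek Wst s a k) * bk a k) by rewrite /F2 /y -[RHS](mulrA (G a)).
  apply: (@le_trans _ _ (y * (tau ^+ 2 * (fsq (ek Wst s a k) / bk a k)) + y * (fsq (ek Wst s a k) * bk a k))).
    rewrite mulrCA -mulrDr ler_wpM2l // -subr_ge0.
    have -> : tau ^+ 2 * (fsq (ek Wst s a k) / bk a k) + fsq (ek Wst s a k) * bk a k - 2 * tau * fsq (ek Wst s a k) =
      fsq (ek Wst s a k) / bk a k * (tau - bk a k) ^+ 2 by field; rewrite gt_eqF.
    by rewrite mulr_ge0 ?sqr_ge0.
  by rewrite lerD2r ler_piMl // mulr_ge0 ?sqr_ge0.
rewrite big_split /= lerD2r -mulr_sumr ler_wpM2l ?sqr_ge0 //.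
by apply: le_trans (WA gA); exact: fsq_Wk_sum.
Qed.
Hypothesis num : tau * L + 6 * kappa / gam + 16 * rho * (n - k0)%:R <
  (2 - thr - 2 * gam) * ((n - k0)%:R * (1 - p3 + eps * zeta)).
Hypothesis thr_gam : 0 <= 2 - thr - 2 * gam.
(** If every time were bad with probability at least [zeta], each mean of [M k] would be at least
    [1 - p3 + eps * zeta]. In the averaged budget the terms in [F2] absorb the fraction
    [thr + 2 gam] of the factor 2, about half of it, and the rest must fit into [tau * L] plus small
    errors, which [num] excludes. *)
Lemma early_index : exists k1, (k0 <= k1 < n)%N /\
  (Ex (fun a => (tame a && ~~ (Phik S Wst s a k1 <= eps)%R)%:R) <= zeta%:E)%E.
Proof.
apply: contrapT => hno.
pose bad k a := tame a && ~~ (Phi a k <= eps)%R.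
have nbad k : nnm (fun a => (bad k a)%:R).
  by apply/nnm_ind/rmeas_and; [exact: rmeas_tame|exact/rmeas_ind_not/rmeas_le_cst/rmeas_Phik].
have hbad k : (k0 <= k < n)%N -> (zeta%:E <= Ex (fun a => (bad k a)%:R))%E.
  move=> kn; rewrite leNgt; apply/negP => hlt; apply: hno; exists k; split => //.
  exact: ltW.
have [pg [gE gN]] := rexp_ind_fin P mX (rmeas_tame k0 (thr * tau)).
have p3g : 1 - p3 <= pg by move: PG; rewrite gN lee_fin lerBlDr addrC -lerBlDr.
have nMle k : (Ex (M k) <= 2%:E)%E.
  rewrite -(rexp_cst P X 2); apply: rexp_le => //; first exact: nnm_cst.
  move=> a; rewrite /M /G; case: (tame a); rewrite ?mul1r ?mul0r //; exact: m2'.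
have /choice[u hu] : forall k, exists y, Ex (M k) = y%:E.
  by move=> k; have [y [yE _ _]] := rexp_fin (nM k) (nMle k); exists y.
have lst_in k : k \in lst -> (k0 <= k < n)%N by rewrite mem_index_iota.
have u_ge k : k \in lst -> 1 - p3 + eps * zeta <= u k.
  move=> /lst_in kn; rewrite -lee_fin -hu.
  apply: (@le_trans _ _ (Ex (fun a => (G a + eps * (bad k a)%:R)%R))).
    rewrite (rexpD P mX nG) ?(rexpZ P mX) ?(ltW eps0) //; last by apply: nnmM => //; exact/nnm_cst/ltW.
    rewrite /G gE EFinD leeD ?lee_fin // EFinM.
    by apply: lee_wpmul2l; [rewrite lee_fin ltW|exact: hbad].
  apply: rexp_le => //; first by apply: nnmD => //; apply: nnmM => //; exact/nnm_cst/ltW.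
  move=> a; rewrite /M /G /bad; case: (tame a); rewrite ?mul0r ?mul1r /= ?mulr0 ?addr0 //.
  case: (leP (Phi a k)) => h /=; first by rewrite mulr0 addr0.
  by rewrite mulr1 le_min lexx andbT lerD2l ltW.
pose U := \sum_(k <- lst) u k.
have szl : size lst = (n - k0)%N by rewrite size_iota.
have sumc (c : R) : \sum_(k <- lst) c = (n - k0)%:R * c.
  by rewrite big_const_seq count_predT szl iter_addr_0 mulr_natl.
have Uge : (n - k0)%:R * (1 - p3 + eps * zeta) <= U.
  by rewrite -sumc big_seq [leRHS]big_seq; apply: ler_sum.
have c3 : 0 <= 2 * tau by rewrite mulr_ge0 // ltW.
have thr0 : 0 <= (thr + 2 * gam) * tau.
  rewrite mulr_ge0 ?(ltW tau0) //.
  by move: thr1 gam0; generalize thr, gam => x y ? ?; lra.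
have c6 : 0 <= 6 / (gam * tau) by rewrite divr_ge0 // ltW.
have lower : ((2 * tau * U)%:E <= Ex (fun a => (2 * tau * \sum_(k <- lst) F1 k a)%R))%E.
  rewrite (rexpZ P mX) //; last exact: nnm_sum.
  rewrite EFinM; apply: lee_wpmul2l; first by rewrite lee_fin.
  rewrite rexp_sum // /U -sumEFin big_seq [leRHS]big_seq; apply: lee_sum => k /lst_in kn.
  by rewrite -hu; exact: F1_ge.
have nF2s : nnm (fun a => \sum_(k <- lst) F2 k a) by exact: nnm_sum.
have nF3s : nnm (fun a => 2 * tau * \sum_(k <- lst) F3 k a).
  by apply: nnmM; [exact: nnm_cst|exact: nnm_sum].
have tL0 : 0 <= tau ^+ 2 * L by rewrite mulr_ge0 ?sqr_ge0.
have nL : nnm (fun _ : nat -> 'cV[R]_p => tau ^+ 2 * L) by exact: nnm_cst tL0.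
have nMQ k : nnm (fun a => (thr + 2 * gam) * tau * M k a + 6 / (gam * tau) * (G a * Qk S a k)).
  apply: nnmD; first by apply: nnmM => //; exact: nnm_cst.
  by apply: nnmM; [exact: nnm_cst|exact: nnmM].
have hF2 : (Ex (fun a => (\sum_(k <- lst) F2 k a)%R) <=
    ((thr + 2 * gam) * tau * U + 6 / (gam * tau) * (kappa * tau ^+ 2))%:E)%E.
  apply: (@le_trans _ _ (Ex (fun a => (\sum_(k <- lst) ((thr + 2 * gam) * tau * M k a + 6 / (gam * tau) * (G a * Qk S a k)))%R))).
    rewrite rexp_sum // rexp_sum // big_seq [leRHS]big_seq; apply: lee_sum => k /lst_in.
    exact: F2_le.
  have -> : (fun a => (\sum_(k <- lst) ((thr + 2 * gam) * tau * M k a + 6 / (gam * tau) * (G a * Qk S a k)))%R) =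
     (fun a => (thr + 2 * gam) * tau * (\sum_(k <- lst) M k a) + 6 / (gam * tau) * (G a * \sum_(k <- lst) Qk S a k)).
    by apply/funext => a; rewrite big_split /= -!mulr_sumr.
  have nS : nnm (fun a => \sum_(k <- lst) M k a) by exact: nnm_sum.
  have nT : nnm (fun a => G a * \sum_(k <- lst) Qk S a k) by apply: nnmM => //; exact: nnm_sum.
  apply: rexpD_le => //; try by apply: nnmM => //; exact: nnm_cst.
    apply: rexpZ_le => //; apply: rexp_sum_le => // k _.
    by rewrite hu.
  by apply: rexpZ_le.
have hF3 : (Ex (fun a => (2 * tau * \sum_(k <- lst) F3 k a)%R) <= (2 * tau * ((n - k0)%:R * (8 * rho)))%:E)%E.
  apply: rexpZ_le => //; first exact: nnm_sum.
  rewrite -sumc; apply: rexp_sum_le => // k /lst_in/andP[_]; exact: F3_le.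
have upper : (Ex (fun a => (2 * tau * \sum_(k <- lst) F1 k a)%R) <=
    (tau ^+ 2 * L + ((thr + 2 * gam) * tau * U + 6 / (gam * tau) * (kappa * tau ^+ 2)) +
     2 * tau * ((n - k0)%:R * (8 * rho)))%:E)%E.
  apply: (rexp_le_trans mX (G := fun a => tau ^+ 2 * L + \sum_(k <- lst) F2 k a + 2 * tau * \sum_(k <- lst) F3 k a)).
  - by apply: nnmM; [exact: nnm_cst|exact: nnm_sum].
  - by apply: nnmD => //; exact: nnmD.
  - exact: budget.
  apply: rexpD_le => //; first exact: nnmD.
  by apply: rexpD_le => //; rewrite rexp_cst.
have := le_trans lower upper; rewrite lee_fin.
have -> : 6 / (gam * tau) * (kappa * tau ^+ 2) = tau * (6 * kappa / gam) by field; rewrite !gt_eqF.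
move=> h; have h2 : 2 * U <= tau * L + (thr + 2 * gam) * U + 6 * kappa / gam + 16 * rho * (n - k0)%:R.
  rewrite -(ler_pM2l tau0); move: h.
  by generalize (\tr V), L, thr, gam, (6 * kappa / gam), rho, ((n - k0)%:R : R) => x1 x2 x3 x4 x5 x6 x7; lra.
have h3 : (2 - thr - 2 * gam) * ((n - k0)%:R * (1 - p3 + eps * zeta)) <= (2 - thr - 2 * gam) * U.
  by rewrite ler_wpM2l.
move: num; rewrite ltNge => /negP; apply; apply: le_trans h3 _.
by move: h2; generalize (\tr V * L), thr, gam, (6 * kappa / gam), (16 * rho * (n - k0)%:R) => x1 x2 x3 x4 x5; lra.
Qed.
End early_index.

(** * Propagation of small risk to the last row *)

Section late_rows.
Context {q : nat}.
Variables (Wst : 'M[R]_(p, q)) (s : nat -> 'rV[R]_q) (k0 k1 : nat).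
Variables (dl eta kappa thr eps eps1 beta pA p3 zeta : R).
Hypothesis s1 : forall k, fsq (s k) <= 1.
Hypothesis dl12 : dl <= 1 / 2.
Hypothesis eta14 : 0 <= eta <= 1 / 4.
Hypothesis n_q2 : n%:R * q2 <= (eta * tau) ^+ 2.
Hypothesis k0k1 : (k0 <= k1)%N.
Hypothesis k1n : (k1 <= n)%N.
Notation tame := (tame k0 (thr * tau)).
Let Phi a k := Phik S Wst s a k.
Let qk a k := 72 * Qk S a k / tau ^+ 2.
Let E a := tame a && (Phi a k1 <= eps)%R.
(** The event [E] is decided by the first [k1] rows. The indicators discard paths on which some [bk]
    drops below [tau / 2], where [drift_bound] gives no control; on [apart] all of them equal 1
    because [dl <= 1 / 2]. *)
Let Psi k a := (E a)%:R * \prod_(j <- index_iota k1 k) ((tau / 2 <= bk a j)%R%:R * (1 + qk a j)^-1) *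
  (1 + Phi a k).
Let Phi0 a k : 0 <= Phi a k. Proof. exact: fsq_ge0. Qed.
Let qk0 a k : 0 <= qk a k.
Proof. by rewrite divr_ge0 ?sqr_ge0 // mulr_ge0 ?fsq_ge0 ?ler0n. Qed.
Let nPhi k : nnm (fun a => Phi a k).
Proof. by split => [|a]; [exact: rmeas_Phik|exact: Phi0]. Qed.
Let n1Phi k : nnm (fun a => 1 + Phi a k).
Proof. by apply: nnmD => //; exact: nnm_cst. Qed.
Let nQ k : nnm (fun a => Qk S a k).
Proof. by split; [exact: rmeas_Qk|move=> a; exact: fsq_ge0]. Qed.
Let nE : nnm (fun a => (E a)%:R).
Proof. by apply/nnm_ind/rmeas_and; [exact: rmeas_tame|exact/rmeas_le_cst/rmeas_Phik]. Qed.
Let nfac j : nnm (fun a => (tau / 2 <= bk a j)%R%:R * (1 + qk a j)^-1).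
Proof.
apply: nnmM; first exact/nnm_ind/rmeas_ge_cst/rmeas_bk.
apply: nnmV; apply: nnmD; first exact: nnm_cst.
apply: nnmM; first by apply: nnmM => //; exact: nnm_cst.
by apply: nnm_cst; rewrite invr_ge0 sqr_ge0.
Qed.
Let nPsi k : nnm (Psi k).
Proof. by apply: nnmM => //; apply: nnmM => //; exact: nnm_prod. Qed.
(* The normalised process is a supermartingale. *)
Let Psi_step k : (k1 <= k < n)%N -> (Ex (Psi k.+1) <= Ex (Psi k))%E.
Proof.
move=> /andP[k1k kn]; have gk := rows_moments mX sS hXrow kn.
apply: (rexp_step_le mX hXindep kn) => // a.
pose Phn w := Phi (updr a k (rows X w k)) k.+1.
have t34 : 3 / 4 * tau <= fsq (Mk a k *m S).
  case/andP: eta14 => e0 e4; have e01 : 0 <= eta < 1.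
    by rewrite e0 /=; apply: le_lt_trans e4 _; lra.
  apply: le_trans (tk_ge e01 n_q2 a (ltnW kn)); rewrite ler_pM2r //.
  by move: e4; generalize eta => x ?; lra.
have mPhn : measurable_fun setT Phn.
  apply: (rmeas_Phik S Wst s k.+1) => i j; rewrite /updr; case: (i == k); last exact: measurable_cst.
  exact: rows_meas.
have Phn0 w : 0 <= Phn w by exact: Phi0.
have step w : Phn w <= _ := PhikS Wst s sS (updr a k (rows X w k)) k.
have pos : 0 < 1 + qk a k by rewrite ltr_pwDl.
pose c := (E a)%:R * \prod_(j <- index_iota k1 k) ((tau / 2 <= bk a j)%R%:R * (1 + qk a j)^-1) / (1 + qk a k).
have c0 : 0 <= c.
  rewrite mulr_ge0 ?invr_ge0 ?(ltW pos) // mulr_ge0 ?ler0n //.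
  by apply: prodr_ge0 => j _; case: (nfac j).
have h := drift_bound sS gk (Mk_sym a k) (Mk_idem a k) (s1 k) tau0 t34 mPhn Phn0.
have {}h : (\int[P]_w ((tau / 2 <= fsq (Mk a k *m rows X w k))%R%:R * (1 + Phn w))%:E <=
    ((1 + Phi a k) * (1 + qk a k))%:E)%E.
  apply: h => w; move: (step w); rewrite bk_updr_id /hk !Dk_updr // !Mk_updr // !updr_id ek_updr_id.
  by rewrite Phik_updr.
have -> : Psi k a = c * ((1 + Phi a k) * (1 + qk a k)).
  by rewrite /c /Psi; field; rewrite gt_eqF.
apply: (integralZ_le c0 _ _ _ h).
- apply: measurable_funM; last by apply: measurable_funD.
  apply: measurable_ler_ind; first exact: measurable_cst.
  exact: has_mean_measurable (gm2 gk (Mk a k)).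
- by move=> w; rewrite mulr_ge0 ?ler0n // addr_ge0.
- move=> w; rewrite /Psi; set a' := updr a k _.
  have -> : E a' = E a by rewrite /E /Phi /a' tame_updr ?(leq_trans k0k1) // Phik_updr.
  rewrite big_nat_recr //=.
  have -> : \prod_(k1 <= j < k) ((tau / 2 <= bk a' j)%R%:R * (1 + qk a' j)^-1) =
     \prod_(j <- index_iota k1 k) ((tau / 2 <= bk a j)%R%:R * (1 + qk a j)^-1).
    apply: eq_big_nat => j /andP[_ jk].
    by rewrite /a' bk_updr // /qk Qk_updr // ltnW.
  rewrite /a' bk_updr_id {2}/qk Qk_updr // -/(qk a k) /c /Phn.
  by ring.
Qed.
Hypothesis eps0 : 0 <= eps.
Hypothesis eps10 : 0 < eps1.
Hypothesis beta01 : 0 < beta < 1.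
Hypothesis PA : (Ex (fun a => (~~ apart dl a)%:R) <= pA%:E)%E.
Hypothesis PG : (Ex (fun a => (~~ tame a)%:R) <= p3%:E)%E.
Hypothesis PE : (Ex (fun a => (tame a && ~~ (Phi a k1 <= eps)%R)%:R) <= zeta%:E)%E.
Hypothesis SQ : (Ex (fun a => ((tame a)%:R * \sum_(k0 <= k < n) Qk S a k)%R) <= (kappa * tau ^+ 2)%:E)%E.
Let Psi_le k : (k1 <= k <= n)%N -> (Ex (Psi k) <= (1 + eps)%:E)%E.
Proof.
case/andP => k1k; rewrite -(subnKC k1k); elim: (k - k1)%N => [_|i IH].
  rewrite addn0 -(rexp_cst P X (1 + eps)); apply: rexp_le => //.
    by apply: nnm_cst; rewrite addr_ge0.
  move=> a; rewrite /Psi big_geq // mulr1 /E; case: (tame a); last by rewrite mul0r addr_ge0.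
  by case: (leP (Phi a k1)) => h; rewrite ?mul1r ?mul0r ?lerD2l // addr_ge0.
rewrite addnS => kn; apply: le_trans (IH (ltnW kn)).
by apply: Psi_step; rewrite leq_addr.
Qed.
Let sumQ a := (tame a)%:R * \sum_(k0 <= k < n) Qk S a k.
Let nsumQ : nnm sumQ.
Proof. by apply: nnmM; [exact/nnm_ind/rmeas_tame|exact: nnm_sum]. Qed.
Let badE a := tame a && ~~ (Phi a k1 <= eps)%R.
Let nbadE : nnm (fun a => (badE a)%:R).
Proof.
by apply/nnm_ind/rmeas_and; [exact: rmeas_tame|exact/rmeas_ind_not/rmeas_le_cst/rmeas_Phik].
Qed.
Let nA : nnm (fun a => (~~ apart dl a)%:R).
Proof. exact/nnm_ind/rmeas_ind_not/rmeas_apart. Qed.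
Let nT : nnm (fun a => (~~ tame a)%:R).
Proof. exact/nnm_ind/rmeas_ind_not/rmeas_tame. Qed.
Let cQ := 72 / (beta * tau ^+ 2).
Let beta0 : 0 < beta. Proof. by case/andP: beta01. Qed.
Let cQ0 : 0 <= cQ. Proof. by rewrite divr_ge0 ?mulr_ge0 ?sqr_ge0 // ltW. Qed.
Let exc a := (~~ tame a)%:R + (badE a)%:R + (~~ apart dl a)%:R + cQ * sumQ a.
(** Markov applied to [1 + Phi] alone would give about [(1 + eps) / (1 + eps1)], which is useless
    for small [eps1]. But off the exceptional events [Psi n / (1 - beta)] is at least [1 + Phi], so
    subtracting the baseline 1 leaves [eps1] times the indicator. On an exceptional event [exc] is
    at least 1 and pays for the whole left side; its last term is Markov for a drift sum exceeding
    [beta]. *)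
Let markov_pt a : 1 + eps1 * (~~ (Phi a n <= eps1)%R)%:R <=
  (1 - beta)^-1 * Psi n a + (1 + eps1) * exc a.
Proof.
have P0 : 0 <= (1 - beta)^-1 * Psi n a.
  by rewrite mulr_ge0 ?invr_ge0 ?subr_ge0 ?(ltW (andP beta01).2) //; case: (nPsi n).
have S0 : 0 <= cQ * sumQ a by rewrite mulr_ge0 //; case: nsumQ.
have lhs : 1 + eps1 * (~~ (Phi a n <= eps1)%R)%:R <= 1 + eps1.
  by rewrite lerD2l ler_piMr ?(ltW eps10) // lern1 leq_b1.
have e1 : 0 <= 1 + eps1 by rewrite addr_ge0 // ltW.
have easy : 1 <= exc a -> 1 + eps1 * (~~ (Phi a n <= eps1)%R)%:R <=
    (1 - beta)^-1 * Psi n a + (1 + eps1) * exc a.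
  by move=> x1; apply: le_trans lhs _; apply: ler_wpDl => //; rewrite ler_peMr.
case gT: (tame a); last by apply: easy; rewrite /exc gT /= -!addrA lerDl !addr_ge0 ?ler0n.
case pE: (Phi a k1 <= eps); last first.
  by apply: easy; rewrite /exc /badE gT pE /= add0r -!addrA lerDl !addr_ge0 ?ler0n.
case gA: (apart dl a); last first.
  by apply: easy; rewrite /exc /badE gT pE gA /= !add0r lerDl.
have [xs|xs] := leP 1 (cQ * sumQ a).
  by apply: easy; rewrite /exc /badE gT pE gA /= !add0r.
apply: ler_wpDr; first by rewrite mulr_ge0 // /exc !addr_ge0 ?ler0n.
have b1 : 0 < 1 - beta by rewrite subr_gt0; case/andP: beta01.
rewrite ler_pdivlMl //.
have prodE : \prod_(j <- index_iota k1 n) ((tau / 2 <= bk a j)%R%:R * (1 + qk a j)^-1) =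
    \prod_(j <- index_iota k1 n) (1 + qk a j)^-1.
  apply: eq_big_nat => j /andP[_ jn]; rewrite (_ : (tau / 2 <= bk a j)%R = true) ?mul1r //.
  apply: le_trans (ltW (apart_bk gA jn)); rewrite [tau / 2]mulrC ler_pM2r //.
  by move: dl12; generalize dl => x ?; lra.
rewrite /Psi prodE /E gT pE mul1r.
have hp : 1 - beta <= \prod_(j <- index_iota k1 n) (1 + qk a j)^-1.
  apply: le_trans (prod_inv1D_ge (index_iota k1 n) (qk0 a)); rewrite lerB //.
  apply: (@le_trans _ _ (\sum_(k0 <= j < n) qk a j)).
    by rewrite (big_cat_nat k0k1) //= lerDr sumr_ge0.
  have -> : \sum_(k0 <= j < n) qk a j = beta * (cQ * sumQ a).
    rewrite /sumQ gT mul1r /cQ !mulr_sumr; apply: eq_bigr => j _; rewrite /qk.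
    by field; rewrite !gt_eqF.
  by rewrite ler_piMr ?ltW.
apply: (@le_trans _ _ ((1 - beta) * (1 + Phi a n))).
  rewrite ler_wpM2l ?(ltW b1) // lerD2l; case: (leP (Phi a n)) => h /=.
    by rewrite mulr0.
  by rewrite mulr1 ltW.
by rewrite ler_wpM2r // addr_ge0.
Qed.
Lemma prob_Phik_large : (Ex (fun a => (~~ (Phik S Wst s a n <= eps1)%R)%:R) <=
  (((1 + eps) / (1 - beta) - 1 + (1 + eps1) * (p3 + zeta + pA + 72 * kappa / beta)) / eps1)%:E)%E.
Proof.
have nB : nnm (fun a => (~~ (Phi a n <= eps1)%R)%:R).
  exact/nnm_ind/rmeas_ind_not/rmeas_le_cst/rmeas_Phik.
have nexc : nnm exc.
  apply: nnmD; last by apply: nnmM => //; exact: nnm_cst.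
  by apply: nnmD => //; exact: nnmD.
have e1 : 0 <= 1 + eps1 by rewrite addr_ge0 // ltW.
have b1 : 0 <= (1 - beta)^-1 by rewrite invr_ge0 subr_ge0 ltW //; case/andP: beta01.
have h : (Ex (fun a => (1 + eps1 * (~~ (Phi a n <= eps1)%R)%:R)%R) <=
    ((1 - beta)^-1 * (1 + eps) + (1 + eps1) * (p3 + zeta + pA + cQ * (kappa * tau ^+ 2)))%:E)%E.
  have n1 : nnm (fun a => (1 - beta)^-1 * Psi n a) by apply: nnmM => //; exact: nnm_cst.
  have n2 : nnm (fun a => (1 + eps1) * exc a) by apply: nnmM => //; exact: nnm_cst.
  have n3 : nnm (fun a => cQ * sumQ a) by apply: nnmM => //; exact: nnm_cst.
  apply: (rexp_le_trans mX _ _ markov_pt).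
  - by apply: nnmD; [exact: nnm_cst|apply: nnmM => //; exact/nnm_cst/ltW].
  - exact: nnmD.
  apply: rexpD_le => //.
    by apply: rexpZ_le => //; apply: Psi_le; rewrite k1n leqnn.
  apply: rexpZ_le => //; apply: rexpD_le => //; first by apply: nnmD => //; exact: nnmD.
    by apply: rexpD_le => //; [exact: nnmD|exact: rexpD_le].
  exact: rexpZ_le.
have eq1 : Ex (fun a => (1 + eps1 * (~~ (Phi a n <= eps1)%R)%:R)%R) =
    (1%:E + eps1%:E * Ex (fun a => (~~ (Phi a n <= eps1)%R)%:R))%E.
  rewrite (rexpD P mX) ?rexp_cst ?(rexpZ P mX) ?(ltW eps10) //; first exact: nnm_cst.
  by apply: nnmM => //; exact/nnm_cst/ltW.
have n1 : (Ex (fun a => (~~ (Phi a n <= eps1)%R)%:R) <= 1%:E)%E.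
  rewrite -(rexp_cst P X 1); apply: rexp_le => //; first exact: nnm_cst.
  by move=> a; rewrite lern1 leq_b1.
have [y [yE y0 y1]] := rexp_fin nB n1.
rewrite yE lee_fin ler_pdivlMr //; move: h; rewrite eq1 yE -EFinM -EFinD lee_fin.
have -> : cQ * (kappa * tau ^+ 2) = 72 * kappa / beta.
  by rewrite /cQ; field; rewrite !gt_eqF.
rewrite -lerBrDl => h; rewrite mulrC; apply: le_trans h _.
by rewrite le_eqVlt; apply/orP; left; apply/eqP; rewrite [_ * (1 + eps)]mulrC; ring.
Qed.
End late_rows.
Lemma prob_excess_le (w : 'cV[R]_p) (u c eps1 : R) : 0 < u -> u <= 1 / 2 -> 0 < eps1 ->
  all (fun x => c <= x) [:: 1; u ^+ 2 / 20 / 6; (u ^+ 2 / 20 / 50) ^+ 2; (u ^+ 2 / 20) ^+ 2 / 8;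
    (u ^+ 2 / 20) ^+ 4 / 32 / 64; (u ^+ 2 / 20) ^+ 2 * (u ^+ 2 / 20 / 30 / 40) ^+ 3 / 8;
    u ^+ 2 / 20 * (u ^+ 2 / 20 / 30 / 40) ^+ 4 / 8; (u ^+ 2 / 20) ^+ 3 * (u ^+ 2 / 20 / 30 / 40) ^+ 8 / 32] ->
  (size B)%:R <= c * n%:R -> n%:R * q2 <= c * tau ^+ 2 -> fsq w * tau <= c * n%:R -> 1 <= c * n%:R ->
  (Ex (fun a => (~~ (Phik S (augW w) augs a n <= eps1)%R)%:R) <=
    (((1 + u) / (1 - u) - 1 + (1 + eps1) * (4 * u)) / eps1)%:E)%E.
Proof.
move=> u0 u2 eps10 hc rc qc wc nc.
have q0 : 0 <= q2 by exact: fsq_ge0.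
pose s := u ^+ 2 / 20; pose dl := s / 30 / 40; pose eta := s / 50.
have [[s0 d0 s80] [d10 e01 eta14] [/andP[thr1 thrs] gap0 us] [kap0 kap1 kap2] [s1 s12 [rho1 u01 uE]]] :=
  parameter_bounds u0 u2 (erefl s) (erefl dl) (erefl eta).
move: hc; rewrite /= -/s -/dl -/eta.
case/andP=> c1 /andP[c2 /andP[c3 /andP[c4 /andP[c5 /andP[c6 /andP[c7 /andP[c8 _]]]]]]].
clearbody s dl eta.
have m1 : 1 <= n%:R :> R.
  apply: le_trans nc _; rewrite -[leRHS]mul1r ler_wpM2r //; exact: ler0n.
have m0 : 0 < n%:R :> R by lra.
have c0 : 0 < c by rewrite -(pmulr_lgt0 _ m0); lra.
have c2n : c * n%:R <= s / 6 * n%:R by rewrite ler_wpM2r // ltW.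
have sn0 : 0 <= s * n%:R by rewrite mulr_ge0 ?ltW.
(* Many rows compared with the rank of [Sigma1], at most [c n], yet few enough to cost only a
   fraction [s] of the norm budget. *)
pose k0 := Num.truncn (s * n%:R).
have /andP[k0s] := truncn_itv sn0; rewrite -/k0 -natr1 => sk0.
have k0n : (k0 <= n)%N.
  rewrite -(ler_nat R); apply: le_trans k0s _; rewrite ler_piMl ?(ltW m0) //; lra.
have k0pos : 0 < k0%:R :> R by lra.
have n_q2 : n%:R * q2 <= (eta * tau) ^+ 2.
  by apply: le_trans qc _; rewrite exprMn ler_wpM2r ?sqr_ge0.
have PA : (Ex (fun a => (~~ apart s a)%:R) <= ((s / 16) ^+ 2)%:E)%E.
  apply: (le_trans (prob_not_apart s0 _)).
    have -> : (s / 2 * tau) ^+ 2 = s ^+ 2 / 4 * tau ^+ 2 by field.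
    apply: (@le_trans _ _ (2 * (c * tau ^+ 2))).
      rewrite natrD mulrDl (_ : 2 * (c * tau ^+ 2) = c * tau ^+ 2 + c * tau ^+ 2); last by ring.
      apply: lerD => //; apply: le_trans qc; rewrite ler_wpM2r //.
      by apply: le_trans rc _; rewrite ler_piMl.
    rewrite mulrA ler_wpM2r ?sqr_ge0 //; move: c4; lra.
  rewrite lee_fin mulrA ler_pdivrMr ?exprn_gt0 ?mulr_gt0 //.
  apply: (@le_trans _ _ (8 * (c * tau ^+ 2))); first by rewrite mulrCA ler_wpM2l.
  have -> : (s / 16) ^+ 2 * (s * tau) ^+ 2 = s ^+ 4 / 256 * tau ^+ 2 by field.
  by rewrite mulrA ler_wpM2r ?sqr_ge0 //; lra.
have PG : (Ex (fun a => (~~ tame k0 ((1 + 24 * dl) * tau) a)%:R) <= s%:E)%E.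
  have k0n' : (0 < k0 <= n)%N by rewrite k0n andbT -(ltr_nat R).
  have mu0 : 0 < s * dl ^+ 4 / 8 by rewrite divr_gt0 // mulr_gt0 // exprn_gt0.
  apply: le_trans (prob_tk_large k0n' d0 d10 mu0) _.
  rewrite lee_fin; apply: (first_rows_budget (c := c) (m := n%:R)) => //.
  - by rewrite ler_nat.
  - lra.
have tth : tau <= (1 + 24 * dl) * tau by rewrite ler_peMl // ltW.
have SQ : (Ex (fun a => ((tame k0 ((1 + 24 * dl) * tau) a)%:R * \sum_(k0 <= k < n) Qk S a k)%R) <=
    (3 * (1 + 24 * dl) * (24 * dl + eta) * tau ^+ 2)%:E)%E.
  apply: le_trans (sum_Qk_le e01 n_q2 tth k0n) _.
  by rewrite lee_fin le_eqVlt; apply/orP; left; apply/eqP; ring.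
have bA a k : apart s a -> (k < n)%N -> 0 < bk a k.
  by move=> gA kn; apply: lt_trans (apart_bk gA kn); rewrite mulr_gt0 // subr_gt0.
have [k1 [/andP[k01 k1n] PE]] : exists k1, (k0 <= k1 < n)%N /\
  (Ex (fun a => (tame k0 ((1 + 24 * dl) * tau) a && ~~ (Phik S (augW w) augs a k1 <= u)%R)%:R) <= u%:E)%E.
  (* With [eps] and [zeta] both equal to [u] the gain is [u * u = 20 * s]; [rho = s / 16] makes the
     loss on the bad event exactly [s] per row, and [p3] is [s]. *)
  apply: (early_index (fsq_augs) bA (fun a => fsq_Wk_le w s1) _ PA SQ PG
    (gam := s / 2)) => //.
  - by rewrite divr_gt0.
  - by rewrite divr_gt0.
  - by rewrite u0 ltW //; case/andP: u01.
  - by rewrite addr_ge0 ?fsq_ge0 // divr_ge0 ?ler0n // mulr_ge0 ?(ltW tau0) // subr_ge0 ltW.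
  - by rewrite natrB // uE; apply: (early_budget (c := c)).
apply: le_trans (prob_Phik_large (fsq_augs_le) s12 eta14 n_q2
  k01 (ltnW k1n) (ltW u0) eps10 u01 PA PG PE SQ) _.
rewrite lee_fin ler_wpM2r ?invr_ge0 ?(ltW eps10) // lerD2l ler_wpM2l //; first by rewrite addr_ge0 // ltW.
apply: le_trans (lerD (lerD (lerD us (lexx u)) rho1) kap2) _.
by rewrite le_eqVlt; apply/orP; left; apply/eqP; ring.
Qed.
End benign.
(** * Noise and the interpolator *)
Section entrywise_measurability.
Context d (T : measurableType d) {R : realType}.
Definition emeas {m q} (F : T -> 'M[R]_(m, q)) :=
  forall i j, measurable_fun setT (fun w => F w i j).
Lemma emeas_cst m q (C : 'M[R]_(m, q)) : emeas (fun=> C).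
Proof. by move=> i j; exact: measurable_cst. Qed.
Lemma emeasB m q (F G : T -> 'M[R]_(m, q)) : emeas F -> emeas G -> emeas (fun w => F w - G w).
Proof.
move=> mF mG i j; under eq_fun do rewrite mxE [X in _ + X]mxE.
exact: measurable_funB.
Qed.
Lemma emeasM m q r (F : T -> 'M[R]_(m, q)) (G : T -> 'M[R]_(q, r)) :
  emeas F -> emeas G -> emeas (fun w => F w *m G w).
Proof.
move=> mF mG i j; under eq_fun do rewrite mxE.
by apply: measurable_sum => k; exact: measurable_funM.
Qed.
Lemma emeas_col_mx m r q (F : T -> 'M[R]_(m, q)) (G : T -> 'M[R]_(r, q)) :
  emeas F -> emeas G -> emeas (fun w => col_mx (F w) (G w)).
Proof.
move=> mF mG i j; case: (split_ordP i) => k ->.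
  by under eq_fun do rewrite col_mxEu; exact: mF.
by under eq_fun do rewrite col_mxEd; exact: mG.
Qed.
Lemma measurable_fsq m q (F : T -> 'M[R]_(m, q)) : emeas F -> measurable_fun setT (fun w => fsq (F w)).
Proof.
move=> mF; apply: measurable_sum => i; apply: measurable_sum => j.
exact: measurable_funX.
Qed.
End entrywise_measurability.
Section noise.
Context d (T : measurableType d) {R : realType} (P : probability T R) {n p : nat}.
Variables (X : 'I_n -> 'I_p -> T -> R) (xi : 'I_n -> T -> R) (S : 'M[R]_p) (sigma : R).
Hypothesis mX : forall i j, measurable_fun setT (X i j).
Hypothesis mxi : forall i, measurable_fun setT (xi i).
Hypothesis hxi : gaussian_vec P xi (sigma ^+ 2)%:M.
Hypothesis hxiX : indep2 P (gen_sigma (fun ij : 'I_n * 'I_p => X ij.1 ij.2)) (gen_sigma xi).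
Variable w : 'cV[R]_p.
Notation Ex := (rexp P X).
Notation D a := (Dk (augW w (n := n)) (augs (n := n)) a n).
Notation Phi a := (Phik S (augW w (n := n)) (augs (n := n)) a n).
Definition noise om : 'cV[R]_n := \col_i xi i om.
Let noise_moments : gauss_moments P noise sigma%:M.
Proof.
have h : gaussian_vec P xi (sigma%:M *m sigma%:M^T) by rewrite tr_scalar_mx -scalar_mxM -expr2.
exact: gaussian_vec_moments mxi h.
Qed.
Lemma emeas_rows m q (F : (nat -> 'cV[R]_p) -> 'M[R]_(m, q)) : mxmeas F ->
  emeas (fun om => F (rows X om)).
Proof. by move=> mF i j; apply: (rmeas_rows mX (mF i j)). Qed.
Let msq : measurable_fun setT (fun om => fsq (S *m D (rows X om) *m col_mx 1%:M (noise om))).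
Proof.
apply: measurable_fsq; apply: emeasM; first by apply: emeasM; [exact: emeas_cst|exact: (emeas_rows (mxmeas_Dk (augW w (n := n)) (augs (n := n)) n))].
apply: emeas_col_mx; first exact: emeas_cst.
by move=> i j; under eq_fun do rewrite mxE; exact: mxi.
Qed.
Let noise_mean_le (A : 'M[R]_(p, 1 + n)) :
  (\int[P]_om (fsq (A *m col_mx 1%:M (noise om)))%:E <= (2 * (1 + sigma ^+ 2) * fsq A)%:E)%E.
Proof.
rewrite -(hsubmxK A); set al := lsubmx A; set be := rsubmx A.
have hm := has_meanD (has_mean_cst P (2 * fsq al)) (has_meanZ 2 (gm2 noise_moments be)).
apply: le_trans (integral_le_mean _ _ hm _) _.
- apply: measurable_fsq; apply: emeasM; first exact: emeas_cst.
  apply: emeas_col_mx; first exact: emeas_cst.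
  by move=> i j; under eq_fun do rewrite mxE; exact: mxi.
- by move=> om; exact: fsq_ge0.
- by move=> om; rewrite mul_row_col mulmx1; exact: fsqD_le.
rewrite lee_fin fsq_row_mx mul_mx_scalar fsqZ.
have := fsq_ge0 al; have := fsq_ge0 be; have := sqr_ge0 sigma; nra.
Qed.
Lemma noise_le (eps eps1 : R) : 0 < eps -> 0 < eps1 ->
  (\int[P]_om ((eps < fsq (S *m D (rows X om) *m col_mx 1%:M (noise om)))%R%:R : R)%:E <=
   Ex (fun a => (~~ (Phi a <= eps1)%R)%:R) + (2 * (1 + sigma ^+ 2) * eps1 / eps)%:E)%E.
Proof.
move=> eps0 eps10.
pose h1 om : R := (~~ (Phi (rows X om) <= eps1)%R)%:R.
(* Truncating to [Phi a <= eps1] before averaging over the noise keeps the inner mean bounded for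
   every [a], so no integrability of [Phi] over the rows is needed. *)
pose h2 (a : nat -> 'cV[R]_p) (z : 'cV[R]_n) : R :=
  (Phi a <= eps1)%R%:R / eps * fsq (S *m D a *m col_mx 1%:M z).
have m1 : measurable_fun setT h1.
  apply: (rmeas_rows mX (f := fun a => (~~ (Phi a <= eps1)%R)%:R)).
  exact/rmeas_ind_not/rmeas_le_cst/rmeas_Phik.
have mI : measurable_fun setT (fun om => (Phi (rows X om) <= eps1)%R%:R : R).
  apply: (rmeas_rows mX (f := fun a => (Phi a <= eps1)%R%:R)).
  exact/rmeas_le_cst/rmeas_Phik.
have m2 : measurable_fun setT (fun om => h2 (rows X om) (noise om)).
  by apply: measurable_funM => //; exact: measurable_funM.
have h20 a z : 0 <= h2 a z.
  by rewrite mulr_ge0 ?fsq_ge0 // divr_ge0 ?ler0n // ltW.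
have mlt : measurable_fun setT (fun om => (eps < fsq (S *m D (rows X om) *m col_mx 1%:M (noise om)))%R%:R : R).
  by apply: measurable_ltr_ind => //; exact: measurable_cst.
apply: (@le_trans _ _ (\int[P]_om (h1 om + h2 (rows X om) (noise om))%:E)%E).
  apply: ge0_le_integral => //.
  - exact/measurable_EFinP.
  - by apply/measurable_EFinP; exact: measurable_funD.
  move=> om _; rewrite lee_fin /h1 /h2; case: (leP (Phi _)) => hP /=; last first.
    by rewrite !mul0r addr0 lern1 leq_b1.
  rewrite add0r mul1r; case: ltP => // hlt.
    by rewrite ler_pdivlMl // mulr1 ltW.
  by rewrite mulr_ge0 ?fsq_ge0 // invr_ge0 ltW.
under eq_integral do rewrite EFinD.
rewrite ge0_integralD //; last 4 first.
- by move=> om _; rewrite lee_fin ler0n.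
- exact/measurable_EFinP.
- by move=> om _; rewrite lee_fin.
- exact/measurable_EFinP.
apply: leeD => //.
pose rowsf (f : 'I_n * 'I_p -> R) (k : nat) : 'cV[R]_p :=
  if insub k is Some i then \col_j f (i, j) else 0.
have mrowsf dU (U : measurableType dU) (f : U -> 'I_n * 'I_p -> R) :
    (forall ij, measurable_fun setT (f^~ ij)) ->
    forall i j, measurable_fun setT (fun u => rowsf (f u) i j 0).
  move=> mf i j; rewrite /rowsf; case: insubP => [i' _ _|_]; last exact: measurable_cst.
  by under eq_fun do rewrite mxE; exact: mf.
have mjoint dU (U : measurableType dU) (f : U -> 'I_n * 'I_p -> R) (h : U -> 'I_n -> R) :
    (forall ij, measurable_fun setT (f^~ ij)) -> (forall i, measurable_fun setT (h^~ i)) ->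
    measurable_fun setT (fun u => (h2 (rowsf (f u)) (\col_i h u i))%:E).
  move=> mf mh; apply/measurable_EFinP; apply: measurable_funM.
    apply: measurable_funM => //.
    exact: (rmeas_le_cst eps1 (rmeas_Phik S (augW w (n := n)) (augs (n := n)) n) (mrowsf _ _ _ mf)).
  apply: measurable_fsq; apply: emeasM.
    apply: emeasM; first exact: emeas_cst.
    by move=> i j; exact: (mxmeas_Dk (augW w (n := n)) (augs (n := n)) n i j (mrowsf _ _ _ mf)).
  apply: emeas_col_mx; first exact: emeas_cst.
  by move=> i j; under eq_fun do rewrite mxE; exact: mh.
have dec : (\int[P]_om (h2 (rows X om) (noise om))%:E =
    \int[P]_om \int[P]_om' (h2 (rows X om) (noise om'))%:E)%E.
  apply: (@integral_decouple _ T R P _ _ _ _ (fun ij => mX ij.1 ij.2) mxi hxiX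
    (fun f h => (h2 (rowsf f) (\col_i h i))%:E)) => [f h|]; first by rewrite lee_fin.
  exact: mjoint.
rewrite dec.
have bnd a : (\int[P]_om' (h2 a (noise om'))%:E <= (2 * (1 + sigma ^+ 2) * eps1 / eps)%:E)%E.
  have c0 : 0 <= (Phi a <= eps1)%R%:R / eps by rewrite divr_ge0 ?ler0n // ltW.
  apply: le_trans (integralZ_le c0 _ _ _ (noise_mean_le (S *m D a))) _ => //.
  - apply: measurable_fsq; apply: emeasM; first exact: emeas_cst.
    apply: emeas_col_mx; first exact: emeas_cst.
    by move=> i j; under eq_fun do rewrite mxE; exact: mxi.
  - by move=> om; exact: fsq_ge0.
  rewrite lee_fin -/(Phi a); have s2 : 0 <= 2 * (1 + sigma ^+ 2) by rewrite mulr_ge0 // addr_ge0 ?sqr_ge0.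
  case: (leP (Phi a) eps1) => hP; last by rewrite !mul0r divr_ge0 ?(ltW eps0) // mulr_ge0 // ltW.
  by rewrite mulrC mulrA mulr1 ler_wpM2r ?invr_ge0 ?(ltW eps0) // ler_wpM2l.
have := has_mean_cst P (2 * (1 + sigma ^+ 2) * eps1 / eps) => -[_ <-].
apply: ge0_le_integral => //.
- by move=> om _; apply: integral_ge0 => om' _; rewrite lee_fin.
- apply: (@measurable_fun_fubini_tonelli_F _ _ T T R P
    (fun z => (h2 (rows X z.1) (noise z.2))%:E)); last by move=> z; rewrite lee_fin.
  apply: (mjoint _ _ (fun z ij => X ij.1 ij.2 z.1) (fun z i => xi i z.2)) => i.
    exact: (measurableT_comp (mX i.1 i.2) measurable_fst).
  exact: (measurableT_comp (mxi i) measurable_snd).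
- by apply/measurable_EFinP; exact: measurable_cst.
Qed.
End noise.
Section interpolation.
Context {R : realType} {p q : nat}.
Implicit Types (a : nat -> 'cV[R]_p).
(** The directions [uk] depend on the rows only, so the recursion is linear in the responses. Hence
    one run on fixed responses serves every noise vector. *)
Lemma Wk_mulmx r (Wst : 'M[R]_(p, q)) s (C : 'M[R]_(q, r)) a k :
  Wk Wst s a k *m C = Wk (Wst *m C) (fun i => s i *m C) a k.
Proof.
elim: k => [|k IH]; first by rewrite mul0mx.
rewrite /= mulmxDl -scalemxAl -(mulmxA (uk a k)) mulmxBl -(mulmxA (a k)^T) IH.
by rewrite /resp mulmxDl mulmxA.
Qed.
Lemma Wk_fit (Wst : 'M[R]_(p, q)) s a k i : (forall j, (j < k)%N -> bk a j != 0) ->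
  (i < k)%N -> (a i)^T *m Wk Wst s a k = resp Wst s a i.
Proof.
elim: k => // k IH b0; rewrite ltnS leq_eqVlt => ik.
rewrite WkS mulmxDr -scalemxAr mulmxA /uk.
case/orP: ik => [/eqP ->|ik].
  rewrite pj_dot mul_scalar_mx scalerA -/(uk a k) -/(bk a k) mulVf ?b0 // scale1r ekE.
  by rewrite addrC subrK.
have -> : (a i)^T *m (Mk a k *m a k) = (Mk a k *m a i)^T *m a k.
  by rewrite [in RHS]trmx_mul pj_sym mulmxA.
rewrite pj_mem; last by apply: map_f; rewrite mem_prefix_idx.
by rewrite trmx0 !mul0mx scaler0 addr0 IH // => j jk; apply: b0; exact: ltnW.
Qed.
End interpolation.
Section minimal_norm.
Context {R : realType} {p : nat}.
Implicit Types (a : nat -> 'cV[R]_p).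
Lemma norm2_le k (x y : 'cV[R]_k) : (norm2 x <= norm2 y) = (fsq x <= fsq y).
Proof.
have E (u : 'cV[R]_k) : \sum_i u i 0 ^+ 2 = fsq u.
  by apply: eq_bigr => i _; rewrite big_ord1.
by rewrite /norm2 !E ler_sqrt ?fsq_ge0.
Qed.
(** Whenever some solution [y] exists, [v] is its projection onto the row space and hence the unique
    minimiser. The explicit test also covers the default 0 of an unsolvable system, so that the
    interpolator is an explicit function of the data and its loss is measurable. *)
Lemma minnorm_interpE n (Xm : 'M[R]_(n, p)) (w : 'cV[R]_p) (z : 'cV[R]_n) a :
  (forall i : 'I_n, (a i)^T = row i Xm) ->
  let v := Dk (augW w (n := n)) (augs (n := n)) a n *m col_mx 1%:M z + w in
  minnorm_interp Xm (Xm *m w + z) = if Xm *m v == Xm *m w + z then v else 0.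
Proof.
move=> aX v; set Y := Xm *m w + z.
have wE : augW w (n := n) *m col_mx 1%:M z = w.
  by rewrite /augW mul_row_col mulmx1 mul0mx addr0.
have vE : v = Wk w (fun i => augs i *m col_mx 1%:M z) a n.
  by rewrite /v /Dk mulmxBl wE subrK Wk_mulmx wE.
have respE (i : 'I_n) : resp w (fun i => augs i *m col_mx 1%:M z) a i = row i Y.
  rewrite /resp aX linearD /= row_mul; congr (_ + _).
  rewrite /augs mul_row_col mul0mx add0r; apply/rowP => j; rewrite !mxE (bigD1 i) //= big1 => [|l li].
    by rewrite mxE eqxx mul1r addr0.
  by rewrite mxE (inj_eq val_inj) (negPf li) mul0r.
have sol y : Xm *m y = Y -> v = (1%:M - Mk a n) *m y.
  move=> yY; rewrite vE; apply: Wk_solution => i ilt.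
  by have := respE (Ordinal ilt); have := aX (Ordinal ilt) => /= -> ->; rewrite -row_mul yY.
have XM : Xm *m Mk a n = 0.
  apply/row_matrixP => i; rewrite row_mul row0 -aX -[LHS]trmxK trmx_mul trmxK pj_sym pj_mem ?trmx0 //.
  by apply: map_f; rewrite mem_prefix_idx.
have solv y : Xm *m y = Y -> Xm *m v = Y.
  by move=> yY; rewrite (sol y yY) mulmxA mulmxBr mulmx1 XM subr0.
have min y : Xm *m y = Y -> fsq y = fsq (Mk a n *m y) + fsq v.
  by move=> yY; rewrite (fsq_projM y (Mk_sym a n) (Mk_idem a n)) -sol.
rewrite /minnorm_interp; case: xgetP => [y _ [yY ymin]|none].
  rewrite (solv y yY) eqxx; have := ymin v (solv y yY).
  rewrite norm2_le (min y yY) gerDr => h.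
  have /eqP : fsq (Mk a n *m y) == 0 by rewrite eq_le h fsq_ge0.
  by move/eqP; rewrite fsq_eq0 => /eqP My; rewrite (sol y yY) mulmxBl mul1mx My subr0.
case: eqP => // vY; case: (none v); split => // y yY.
by rewrite norm2_le (min y yY) lerDr fsq_ge0.
Qed.
End minimal_norm.
Section excess_event.
Context d (T : measurableType d) {R : realType} (P : probability T R) {n p : nat}.
Variables (X : 'I_n -> 'I_p -> T -> R) (xi : 'I_n -> T -> R) (S V : 'M[R]_p) (B : seq 'cV[R]_p) (sigma : R).
Hypothesis mX : forall i j, measurable_fun setT (X i j).
Hypothesis mxi : forall i, measurable_fun setT (xi i).
Hypothesis sS : S^T = S.
Hypothesis tau0 : 0 < \tr V.
Variable w : 'cV[R]_p.
Notation D a := (Dk (augW w (n := n)) (augs (n := n)) a n).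
Let U om := fsq (S *m D (rows X om) *m col_mx 1%:M (noise xi om)).
Lemma excess_event_le (eps dl : R) : 0 < eps -> dl < 1 ->
  (P [set om : T | (let Xm := \matrix_(i < n, j < p) X i j om in
        let Y := Xm *m w + \col_i xi i om in
        eps < `| loss sigma (S *m S) w (minnorm_interp Xm Y) - sigma ^+ 2 |)%R] <=
   rexp P X (fun a => (~~ apart V B dl a (n := n))%:R) + \int[P]_om ((eps < U om)%R%:R : R)%:E)%E.
Proof.
move=> eps0 dl1.
pose Xm om := \matrix_(i < n, j < p) X i j om.
pose v om := D (rows X om) *m col_mx 1%:M (noise xi om) + w.
pose Y om := Xm om *m w + noise xi om.
(* Solvability is written as an inequality between reals, whose indicator is measurable. *)
pose solv om : bool := fsq (Xm om *m v om - Y om) <= 0.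
pose f om : R := (solv om)%:R * U om + (1 - (solv om)%:R) * fsq (S *m w).
have rowsX om (i : 'I_n) : (rows X om i)^T = row i (Xm om).
  by apply/rowP => j; rewrite (rowsE X om (ltn_ord i)) !mxE; congr (X _ _ _); exact: val_inj.
have solvE om : (Xm om *m v om == Y om) = solv om.
  by rewrite /solv le_eqVlt ltNge fsq_ge0 orbF fsq_eq0 subr_eq0.
have fE om : `| loss sigma (S *m S) w (minnorm_interp (Xm om) (Y om)) - sigma ^+ 2 | = f om.
  rewrite /loss addrAC subrr add0r.
  have qE (x : 'cV[R]_p) : qform (S *m S) x = fsq (S *m x).
    rewrite fsqE trmx_mul sS /qform !mulmxA /mxtrace big_ord1.
    by [].
  rewrite qE ger0_norm ?fsq_ge0 // (minnorm_interpE w (noise xi om) (rowsX om)) -/(v om) solvE /f.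
  case: (solv om); last by rewrite mul0r !add0r subr0 mul1r mulmxN fsqN.
  by rewrite mul1r subrr mul0r addr0 /v addrK mulmxA.
have mnoise : emeas (noise xi) by move=> i j; under eq_fun do rewrite mxE; exact: mxi.
have mone : emeas (fun om => col_mx 1%:M (noise xi om)).
  by apply: emeas_col_mx => //; exact: emeas_cst.
have mD : emeas (fun om => D (rows X om)).
  exact: (emeas_rows mX (mxmeas_Dk (augW w (n := n)) (augs (n := n)) n)).
have mU : measurable_fun setT U.
  by apply: measurable_fsq; apply: emeasM => //; apply: emeasM => //; exact: emeas_cst.
have mXm : emeas Xm by move=> i j; under eq_fun do rewrite mxE; exact: mX.
have msolv : measurable_fun setT (fun om => (solv om)%:R : R).
  apply: measurable_ler_ind; last exact: measurable_cst.
  apply: measurable_fsq; have -> : (fun om => Xm om *m v om - Y om) =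
      (fun om => Xm om *m (D (rows X om) *m col_mx 1%:M (noise xi om)) - noise xi om).
    by apply/funext => om; rewrite /v /Y mulmxDr opprD addrA addrK.
  by apply: emeasB => //; apply: emeasM => //; exact: emeasM.
have mf : measurable_fun setT f.
  apply: measurable_funD; first exact: measurable_funM.
  by apply: measurable_funM => //; apply: measurable_funB => //; exact: measurable_cst.
pose A := f @^-1` `]eps, +oo[.
have mA : measurable A by rewrite -[A]setTI; exact: mf.
have -> : [set om : T | let Xm := \matrix_(i < n, j < p) X i j om in
        let Y := Xm *m w + \col_i xi i om in
        eps < `| loss sigma (S *m S) w (minnorm_interp Xm Y) - sigma ^+ 2 |] = A.
  by apply/seteqP; split => om /=; rewrite /A /= in_itv /= andbT -fE.
have -> : P A = (\int[P]_om (\1_A om)%:E)%E by rewrite integral_indic // setIT.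
have mlt : measurable_fun setT (fun om => (eps < U om)%R%:R : R).
  by apply: measurable_ltr_ind => //; exact: measurable_cst.
pose g om : R := (~~ apart V B dl (rows X om) (n := n))%:R.
have mg : measurable_fun setT g.
  apply: (rmeas_rows mX (f := fun a => (~~ apart V B dl a (n := n))%:R)).
  exact/rmeas_ind_not/rmeas_apart.
have -> : (rexp P X (fun a => (~~ apart V B dl a (n := n))%:R) + \int[P]_om ((eps < U om)%R%:R : R)%:E =
    \int[P]_om (g om + (eps < U om)%R%:R)%:E)%E.
  under [RHS]eq_integral do rewrite EFinD.
  by rewrite ge0_integralD //; first [exact/measurable_EFinP|by move=> om _; rewrite lee_fin ler0n].
apply: ge0_le_integral => //.
- by apply/measurable_EFinP; exact: measurable_indic.
- by apply/measurable_EFinP; exact: measurable_funD.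
move=> om _; rewrite lee_fin /g indicE.
case gA: (apart V B dl (rows X om)) => /=; last by rewrite -[leLHS]addr0 lerD ?ler0n // lern1 leq_b1.
rewrite add0r; have sl : solv om.
  rewrite -solvE; apply/eqP/row_matrixP => i; rewrite row_mul -rowsX.
  have b0 j : (j < n)%N -> bk (rows X om) j != 0.
    move=> jn; rewrite gt_eqF //; apply: lt_trans (apart_bk gA jn).
    by rewrite mulr_gt0 // subr_gt0.
  have h := Wk_fit (augW w (n := n)) (augs (n := n)) b0 (ltn_ord i).
  have wE : augW w (n := n) *m col_mx 1%:M (noise xi om) = w.
    by rewrite /augW mul_row_col mulmx1 mul0mx addr0.
  rewrite /v /Dk mulmxBl wE subrK mulmxA h /resp mulmxDl -mulmxA wE /Y linearD /= row_mul rowsX.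
  congr (_ + _); rewrite /augs mul_row_col mul0mx add0r.
  apply/rowP => j; rewrite mxE [RHS]mxE (bigD1 i) //= big1 => [|l li].
    by rewrite mxE eqxx mul1r addr0.
  by rewrite mxE (inj_eq val_inj) (negPf li) mul0r.
have -> : (om \in A) = (eps < U om).
  have fU : f om = U om by rewrite /f sl mul1r subrr mul0r addr0.
  by apply/idP/idP => [/set_mem|h]; [|apply/mem_set]; rewrite /A /= in_itv /= andbT fU.
by [].
Qed.
End excess_event.
(** * Conclusion *)
Section splitting.
Context {R : realType} {p : nat}.
Implicit Types A M : 'M[R]_p.
Lemma tr_proj_psd_ge0 A M : psd A -> M^T = M -> M *m M = M -> 0 <= \tr (M *m A).
Proof.
by move=> pA sM iM; have [[sQ _] <-] := sqrtmP pA; rewrite mulmxA -fsqMS // fsq_ge0.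
Qed.
Lemma fsq_sqrtm A : psd A -> fsq (sqrtm A) = \tr A.
Proof. by move=> pA; have [[sQ _] QQ] := sqrtmP pA; rewrite fsqE sQ QQ. Qed.
Lemma psd_tr_gt0 A : psd A -> A != 0 -> 0 < \tr A.
Proof.
move=> pA A0; rewrite -fsq_sqrtm // lt_neqAle fsq_ge0 andbT eq_sym fsq_eq0.
apply: contra A0 => /eqP Q0; have [_ <-] := sqrtmP pA.
by rewrite Q0 mul0mx.
Qed.
(** For symmetric [A] the row space is the range, so a matrix that kills this list kills [A]; its
    length is the quantity that hypothesis (1) controls. *)
Definition row_basis A : seq 'cV[R]_p := [seq (row i (row_base A))^T | i : 'I_(\rank A)].
Lemma size_row_basis A : size (row_basis A) = \rank A.
Proof. by rewrite size_map size_enum_ord. Qed.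
Lemma row_basis_kill A M : A^T = A -> (forall v : 'cV[R]_p, v \in row_basis A -> M *m v = 0) -> M *m A = 0.
Proof.
move=> sA kM; rewrite -sA -(mulmx_base A) trmx_mul mulmxA.
suff -> : M *m (row_base A)^T = 0 by rewrite mul0mx.
apply/trmx_inj/row_matrixP => i; rewrite trmx_mul trmxK row_mul trmx0 row0.
have vB : (row i (row_base A))^T \in row_basis A by apply/mapP; exists i; rewrite ?mem_enum.
have := kM _ vB.
by move/(congr1 trmx); rewrite trmx_mul trmxK trmx0.
Qed.
End splitting.
Section expected_norm.
Context d (T : measurableType d) {R : realType} (P : probability T R) {p : nat}.
Variables (H : 'I_p -> T -> R) (A : 'M[R]_p).
Hypothesis mH : forall i, measurable_fun setT (H i).
Hypothesis hH : gaussian_vec P H 1%:M.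
Hypothesis pA : psd A.
Hypothesis A0 : A != 0.
(* [sqrt y >= (y - y^2 / (4 t)) / sqrt t] reduces the first moment of the norm
   to its second and fourth moments. *)
Lemma expected_norm_ge :
  ((Num.sqrt (\tr A) / 4)%:E <= 'E_P[fun h => norm2 (sqrtm A *m \col_i H i h)])%E.
Proof.
have hh : gaussian_vec P H ((1%:M : 'M[R]_p) *m (1%:M)^T) by rewrite tr_scalar_mx mulmx1.
have gm := gaussian_vec_moments mH hh.
have t0 := psd_tr_gt0 pA A0.
have r0 : 0 < Num.sqrt (\tr A) by rewrite sqrtr_gt0.
set r := Num.sqrt (\tr A) in r0 *.
have rr : \tr A = r ^+ 2 by rewrite sqr_sqrtr // ltW.
pose Q := sqrtm A.
have mean2 := gm2 gm Q; have mean4 := gm4 gm Q Q.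
rewrite mulmx1 fsq_sqrtm // in mean2 mean4.
pose y h := fsq (Q *m \col_i H i h).
have hm := has_meanD (has_meanZ r^-1 mean2) (has_meanZ (- (4 * r ^+ 3)^-1) mean4).
have y0 h : 0 <= y h by exact: fsq_ge0.
have nE h : norm2 (Q *m \col_i H i h) = Num.sqrt (y h).
  by congr Num.sqrt; apply: eq_bigr => i _; rewrite big_ord1.
have my : measurable_fun setT y by exact: has_mean_measurable mean2.
have msq : measurable_fun setT (fun h => norm2 (Q *m \col_i H i h)).
  under eq_fun do rewrite nE.
  apply: (measurableT_comp _ my); apply: continuous_measurable_fun.
  exact: sqrt_continuous.
rewrite unlock; apply: (le_trans _ (mean_le_integral msq _ hm _)).
- rewrite lee_fin.
  have q2 : fsq (Q *m Q^T) <= (\tr A) ^+ 2.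
    by apply: le_trans (fsqM_le _ _) _; rewrite fsq_tr fsq_sqrtm // expr2 lexx.
  (* With fourth-order mean at most [3 (\tr A)^2] the minorant averages to at least [r - 3 r / 4],
     the origin of the factor 1/4. *)
  have -> : r^-1 * \tr A + - (4 * r ^+ 3)^-1 * (\tr A * \tr A + 2 * fsq (Q *m Q^T)) =
     r / 4 + ((\tr A) ^+ 2 - fsq (Q *m Q^T)) / (2 * r ^+ 3).
    by rewrite rr; field; rewrite gt_eqF.
  by rewrite lerDl divr_ge0 ?subr_ge0 // mulr_ge0 // exprn_ge0 // ltW.
- by move=> h; exact: sqrtr_ge0.
move=> h; rewrite nE -/(y h); set x := Num.sqrt (y h).
have x0 : 0 <= x by exact: sqrtr_ge0.
have -> : y h = x ^+ 2 by rewrite sqr_sqrtr.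
pose v := x / r; have v0 : 0 <= v by rewrite divr_ge0 // ltW.
have -> : x = v * r by rewrite /v divfK // gt_eqF.
have -> : r^-1 * (v * r) ^+ 2 + - (4 * r ^+ 3)^-1 * ((v * r) ^+ 2 * (v * r) ^+ 2) =
  r * (v ^+ 2 - v ^+ 4 / 4) by field; rewrite gt_eqF.
rewrite mulrC ler_pM2r //.
have -> : v ^+ 2 - v ^+ 4 / 4 = v * (v - v ^+ 3 / 4) by ring.
rewrite ler_piMr // -subr_ge0.
(* The cubic [v^3 - 4 v + 4] is split as [v^3 - 3 v + 2], which has a double root at 1, plus
   [2 - v]; this settles [v <= 2]. *)
have -> : 1 - (v - v ^+ 3 / 4) = ((v - 1) ^+ 2 * (v + 2) + (2 - v)) / 4 by field.
have [v2|v2] := leP v 2.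
  by rewrite divr_ge0 // addr_ge0 ?subr_ge0 // mulr_ge0 ?sqr_ge0 // addr_ge0.
have -> : (v - 1) ^+ 2 * (v + 2) + (2 - v) = 4 + v * ((v - 2) * (v + 2)) by ring.
by rewrite divr_ge0 // addr_ge0 // mulr_ge0 // mulr_ge0 ?subr_ge0 ?addr_ge0 // ltW.
Qed.
End expected_norm.
(** A single [c], depending only on [sigma], [eps] and [zeta], serves all dimensions, probability
    spaces and covariances, so the limit statement only needs the three ratios to be eventually
    below it. *)
Lemma excess_prob_le {R : realType} (sigma eps zeta : R) : 0 < eps -> 0 < zeta ->
  exists2 c : R, 0 < c & forall (dT : measure_display) (T : measurableType dT) (P : probability T R)
    (n p : nat) (X : 'I_n -> 'I_p -> T -> R) (xi : 'I_n -> T -> R) (S S1 S2 : 'M[R]_p) (w : 'cV[R]_p),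
  (forall i j, measurable_fun setT (X i j)) -> (forall i, measurable_fun setT (xi i)) ->
  psd S -> (forall i, gaussian_vec P (X i) S) -> indep_family P (fun i => gen_sigma (X i)) ->
  gaussian_vec P xi (sigma ^+ 2)%:M ->
  indep2 P (gen_sigma (fun ij : 'I_n * 'I_p => X ij.1 ij.2)) (gen_sigma xi) ->
  cov_split S S1 S2 -> S2 != 0 ->
  (\rank S1)%:R <= c * n%:R -> n%:R * fsq S2 <= c * \tr S2 ^+ 2 ->
  fsq w * \tr S2 <= c * n%:R -> 1 <= c * n%:R ->
  (P [set om : T | (let Xm := \matrix_(i < n, j < p) X i j om in
      let Y := Xm *m w + \col_i xi i om in
      eps < `| loss sigma S w (minnorm_interp Xm Y) - sigma ^+ 2 |)%R] <= zeta%:E)%E.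
Proof.
move=> eps0 zeta0.
have s2 : 0 < 1 + sigma ^+ 2 by rewrite ltr_pwDl // sqr_ge0.
(* Chosen so that the noise term [2 (1 + sigma^2) eps1 / eps] equals [zeta / 3]. *)
pose eps1 := zeta * eps / (6 * (1 + sigma ^+ 2)).
have eps10 : 0 < eps1 by rewrite divr_gt0 ?mulr_gt0.
have e1 : 0 < 1 + eps1 by rewrite ltr_pwDl // ltW.
(* The bound for a large [Phi] will be at most [8 u (1 + eps1) / eps1], which this choice makes at
   most [zeta / 3]. *)
pose u := Num.min (1 / 2) (zeta * eps1 / (24 * (1 + eps1))).
have u0 : 0 < u by rewrite lt_min; apply/andP; split; rewrite divr_gt0 // mulr_gt0.
have u2 : u <= 1 / 2 by rewrite ge_min lexx.
have u3 : u <= zeta * eps1 / (24 * (1 + eps1)) by rewrite ge_min lexx orbT.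
(* The first two entries serve the event [apart] at level 1/2, needed for solvability: 1/32 for its
   hypothesis and [zeta / 96] for its probability. The others are the requirements of
   [prob_excess_le]. *)
have [|c c0 hc] := @ex_lower_bound R ([:: 1 / 32; zeta / 96] ++
   [:: 1; u ^+ 2 / 20 / 6; (u ^+ 2 / 20 / 50) ^+ 2;
       (u ^+ 2 / 20) ^+ 2 / 8; (u ^+ 2 / 20) ^+ 4 / 32 / 64;
       (u ^+ 2 / 20) ^+ 2 * (u ^+ 2 / 20 / 30 / 40) ^+ 3 / 8;
       u ^+ 2 / 20 * (u ^+ 2 / 20 / 30 / 40) ^+ 4 / 8;
       (u ^+ 2 / 20) ^+ 3 * (u ^+ 2 / 20 / 30 / 40) ^+ 8 / 32]).
  have v0 : 0 < u ^+ 2 / 20 by rewrite divr_gt0 // exprn_gt0.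
  have v1 : 0 < u ^+ 2 / 20 / 30 / 40 by rewrite !divr_gt0 // exprn_gt0.
  by rewrite /= !(divr_gt0, mulr_gt0, exprn_gt0, invr_gt0, ltr0n, ltr01, u0, zeta0).
move: hc; rewrite all_cat => /andP[/andP[c32 /andP[c96 _]] hc].
exists c => // dT T P n p X xi S S1 S2 w mX mxi pS hX iX hxi hxiX [SE p1 p2 _] S20 rc qc wc nc.
have [[sQ _] QQ] := sqrtmP pS; set Q := sqrtm S in sQ QQ.
have tau0 := psd_tr_gt0 p2 S20.
have trMV (M : 'M[R]_p) : M^T = M -> M *m M = M -> \tr (M *m S2) <= fsq (M *m Q).
  move=> sM iM; rewrite fsqMS // -mulmxA QQ SE mulmxDr raddfD /= lerDr.
  exact: tr_proj_psd_ge0.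
have killB (M : 'M[R]_p) : (forall v : 'cV[R]_p, v \in row_basis S1 -> M *m v = 0) -> M *m Q *m Q = M *m S2.
  by move=> kM; rewrite -mulmxA QQ SE mulmxDr (row_basis_kill p1.1 kM) add0r.
have Vge0 (M : 'M[R]_p) : M^T = M -> M *m M = M -> 0 <= \tr (M *m S2) by exact: tr_proj_psd_ge0.
rewrite -QQ in hX *.
have m1 : 1 <= n%:R :> R.
  apply: le_trans nc _; rewrite ler_piMl ?ler0n //.
  by case/andP: hc.
have q0 : 0 <= fsq S2 by exact: fsq_ge0.
have half0 : 0 < 1 / 2 :> R by lra.
have half1 : 1 / 2 < 1 :> R by lra.
have rc' : (size (row_basis S1))%:R <= c * n%:R by rewrite size_row_basis.
apply: le_trans (excess_event_le P (row_basis S1) sigma mX mxi sQ tau0 w eps0 half1) _.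
apply: (@le_trans _ _ ((zeta / 3)%:E + ((zeta / 3)%:E + (zeta / 3)%:E))%E); last first.
  by rewrite -!EFinD lee_fin; lra.
apply: leeD.
  apply: (le_trans (prob_not_apart mX sQ hX iX p2.1 trMV killB tau0 half0 _)).
    have -> : (1 / 2 / 2 * \tr S2) ^+ 2 = 2 * (1 / 32 * \tr S2 ^+ 2) by field.
    have c' : c * \tr S2 ^+ 2 <= 1 / 32 * \tr S2 ^+ 2 by rewrite ler_wpM2r ?sqr_ge0.
    apply: le_trans (_ : 2 * (n%:R * fsq S2) <= _); last by rewrite ler_wpM2l // (le_trans qc).
    rewrite mulrA ler_wpM2r // natrD; have : (size (row_basis S1))%:R <= n%:R :> R; last by lra.
    apply: le_trans rc' _; rewrite ler_piMl ?ler0n //; lra.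
  rewrite lee_fin mulrA ler_pdivrMr ?exprn_gt0 ?mulr_gt0 //.
  have -> : zeta / 3 * (1 / 2 * \tr S2) ^+ 2 = 8 * (zeta / 96 * \tr S2 ^+ 2) by field.
  rewrite mulrCA ler_wpM2l //; apply: le_trans qc _.
  by rewrite ler_wpM2r ?sqr_ge0.
apply: le_trans (noise_le Q mX mxi hxi hxiX w eps0 eps10) _.
apply: leeD; last first.
  rewrite lee_fin le_eqVlt; apply/orP; left; apply/eqP; rewrite /eps1.
  by field; rewrite !gt_eqF.
apply: le_trans (prob_excess_le mX sQ hX iX p2.1 Vge0 trMV killB tau0 u0 u2 eps10 hc rc' qc wc nc) _.
rewrite lee_fin ler_pdivrMr //.
have u3' : u * (24 * (1 + eps1)) <= zeta * eps1 by rewrite -ler_pdivlMr // mulr_gt0.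
have h : (1 + u) / (1 - u) - 1 <= 4 * u.
  rewrite lerBlDr ler_pdivrMr; last by lra.
  by nra.
have : 4 * u <= 4 * u * (1 + eps1) by rewrite ler_peMr; lra.
by lra.
Qed.
Lemma fsq_norm2 {R : realType} k (x : 'cV[R]_k) : norm2 x ^+ 2 = fsq x.
Proof.
rewrite /norm2 sqr_sqrtr; last by apply: sumr_ge0 => i _; exact: sqr_ge0.
by apply: eq_bigr => i _; rewrite big_ord1.
Qed.
Theorem theorem7
  (R : realType)
  (* dimensions: d n >= n *)
  (d : nat -> nat) (hd : forall n, (n <= d n)%N)
  (* covariance, true parameter, noise level (fixed) *)
  (Sigma : forall n, 'M[R]_(d n)) (hSigma : forall n, psd (Sigma n))
  (wstar : forall n, 'cV[R]_(d n))
  (sigma : R) (hsigma : 0 <= sigma)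
  (* the n-th instance lives on a probability space (T n, P n) *)
  (dT : measure_display) (T : nat -> measurableType dT)
  (P : forall n, probability (T n) R)
  (* X n i j = entry (i, j) of X (row i is X_i);  xi n i = i-th noise entry *)
  (X : forall n, 'I_n -> 'I_(d n) -> T n -> R)
  (xi : forall n, 'I_n -> T n -> R)
  (hXmeas : forall n i j, measurable_fun setT (X n i j))
  (hximeas : forall n i, measurable_fun setT (xi n i))
  (* rows X_i ~ N(0, Sigma), i.i.d. *)
  (hXrow : forall n (i : 'I_n), gaussian_vec (P n) (X n i) (Sigma n))
  (hXindep : forall n, indep_family (P n) (fun i : 'I_n => gen_sigma (X n i)))
  (* xi ~ N(0, sigma^2 I_n), independent of X *)
  (hxi : forall n, gaussian_vec (P n) (xi n) (sigma ^+ 2)%:M)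
  (hxiX : forall n, indep2 (P n)
            (gen_sigma (fun ij : 'I_n * 'I_(d n) => X n ij.1 ij.2))
            (gen_sigma (xi n)))
  (* covariance splittings Sigma = Sigma1 (+) Sigma2 with Sigma2 <> 0 *)
  (Sigma1 Sigma2 : forall n, 'M[R]_(d n))
  (hsplit : forall n, cov_split (Sigma n) (Sigma1 n) (Sigma2 n))
  (hSigma2 : forall n, Sigma2 n != 0)
  (* H ~ N(0, I_d), on some probability space (TH n, PH n) *)
  (dH : measure_display) (TH : nat -> measurableType dH)
  (PH : forall n, probability (TH n) R)
  (H : forall n, 'I_(d n) -> TH n -> R)
  (hHmeas : forall n i, measurable_fun setT (H n i))
  (hH : forall n, gaussian_vec (PH n) (H n) 1%:M)
  (* (1) rank(Sigma1)/n -> 0 *)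
  (h1 : (fun n : nat => (\rank (Sigma1 n))%:R / n%:R : R) @ \oo --> 0)
  (* (2) n / R(Sigma2) -> 0 *)
  (h2 : (fun n : nat => n%:R / effrank (Sigma2 n) : R) @ \oo --> 0)
  (* (3) ||w*||_2 E||Sigma2^{1/2} H||_2 / sqrt n -> 0 *)
  (h3 : (fun n : nat =>
           ((norm2 (wstar n))%:E
            * 'E_(PH n)[fun h => norm2 (sqrtm (Sigma2 n) *m \col_i H n i h)]
            * (Num.sqrt n%:R)^-1%:E)%E) @ \oo --> 0%E) :
  (* L(w_hat) -> sigma^2 in probability, where Y = X w* + xi and
     w_hat = argmin { ||w||_2 : X w = Y } *)
  forall eps : R, 0 < eps ->
    (fun n : nat =>
       P n [set om : T n |
             let Xm := \matrix_(i < n, j < d n) X n i j om in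
             let Y := Xm *m wstar n + \col_i xi n i om in
             eps < `| loss sigma (Sigma n) (wstar n) (minnorm_interp Xm Y)
                      - sigma ^+ 2 | ]) @ \oo --> 0%E.
Proof.
move=> eps eps0.
have P0 n (A : set (T n)) : (0 <= P n A)%E by exact: measure_ge0.
pose ev n := [set om : T n |
   (let Xm := \matrix_(i < n, j < d n) X n i j om in
    let Y := Xm *m wstar n + \col_i xi n i om in
    eps < `| loss sigma (Sigma n) (wstar n) (minnorm_interp Xm Y) - sigma ^+ 2 |)%R].
suff small (zeta : R) : 0 < zeta -> \forall n \near \oo, (P n (ev n) <= zeta%:E)%E.
  apply/fine_cvgP; split.
    near=> n; rewrite ge0_fin_numE //; apply: le_lt_trans (ltry 1).
    by near: n; exact: small.
  apply/cvgrPdist_le => zeta zeta0; near=> n.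
  rewrite sub0r normrN ger0_norm ?fine_ge0 //=.
  have h : (P n (ev n) <= zeta%:E)%E by near: n; exact: small.
  by rewrite -lee_fin fineK // ge0_fin_numE // (le_lt_trans h) // ltry.
move=> zeta0; have [c c0 hc] := @excess_prob_le R sigma eps zeta eps0 zeta0.
(* The 4 cancels the one in [expected_norm_ge]; squaring then turns hypothesis (3) into
   [fsq w * \tr S2 <= c * n]. *)
have c16 : 0 < Num.sqrt c / 4 by rewrite divr_gt0 ?sqrtr_gt0.
have h1' : \forall n \near \oo, `|(\rank (Sigma1 n))%:R / n%:R : R| <= c by exact: cvgr0_norm_le.
have h2' : \forall n \near \oo, `|n%:R / effrank (Sigma2 n) : R| <= c by exact: cvgr0_norm_le.
pose a n : \bar R := ((norm2 (wstar n))%:E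
            * 'E_(PH n)[fun h => norm2 (sqrtm (Sigma2 n) *m \col_i H n i h)]
            * (Num.sqrt n%:R)^-1%:E)%E.
have /fine_cvgP[h3fin /cvgr0_norm_le h3'] : a @ \oo --> 0%E := h3.
near=> n.
have [_ _ pS2 _] := hsplit n.
have cn : c^-1 <= n%:R by near: n; exact: nbhs_infty_ger.
have n0 : 0 < n%:R :> R by apply: lt_le_trans cn; rewrite invr_gt0.
have tau0 := psd_tr_gt0 pS2 (hSigma2 n).
have q0 : 0 < fsq (Sigma2 n) by rewrite lt_neqAle fsq_ge0 andbT eq_sym fsq_eq0 hSigma2.
apply: (hc _ _ _ _ _ _ _ _ _ _ _ (@hXmeas n) (@hximeas n) (hSigma n) (@hXrow n) (hXindep n) (hxi n) (hxiX n)
  (hsplit n) (hSigma2 n)).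
- have : `|(\rank (Sigma1 n))%:R / n%:R : R| <= c by near: n.
  by rewrite ger0_norm ?divr_ge0 ?ler0n // ler_pdivrMr.
- have : `|n%:R / effrank (Sigma2 n) : R| <= c by near: n.
  have -> : effrank (Sigma2 n) = \tr (Sigma2 n) ^+ 2 / fsq (Sigma2 n).
    by rewrite /effrank fsqE pS2.1.
  rewrite ger0_norm; last by rewrite divr_ge0 ?ler0n // divr_ge0 ?sqr_ge0 // ltW.
  by rewrite invf_div mulrA ler_pdivrMr ?exprn_gt0.
- have fa : a n \is a fin_num by near: n; exact: h3fin.
  have sa : `|fine (a n)| <= Num.sqrt c / 4 by near: n; exact: h3'.
  have la : ((norm2 (wstar n) * (Num.sqrt (\tr (Sigma2 n)) / 4) / Num.sqrt n%:R)%:E <= a n)%E.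
    rewrite /a EFinM EFinM; apply: lee_wpmul2r; first by rewrite lee_fin invr_ge0 sqrtr_ge0.
    apply: lee_wpmul2l; first by rewrite lee_fin sqrtr_ge0.
    exact: expected_norm_ge.
  have sn0 : 0 < Num.sqrt n%:R :> R by rewrite sqrtr_gt0.
  have : norm2 (wstar n) * (Num.sqrt (\tr (Sigma2 n)) / 4) / Num.sqrt n%:R <= Num.sqrt c / 4.
    by rewrite -lee_fin (le_trans la) // -(fineK fa) lee_fin (le_trans _ sa) // ler_norm.
  rewrite ler_pdivrMr // => h.
  have {}h : norm2 (wstar n) * Num.sqrt (\tr (Sigma2 n)) <= Num.sqrt c * Num.sqrt n%:R by lra.
  have : (norm2 (wstar n) * Num.sqrt (\tr (Sigma2 n))) ^+ 2 <= (Num.sqrt c * Num.sqrt n%:R) ^+ 2.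
    by rewrite ler_sqr // nnegrE mulr_ge0 ?sqrtr_ge0.
  by rewrite !exprMn fsq_norm2 !sqr_sqrtr ?(ltW tau0) ?(ltW c0) ?ler0n.
- by rewrite mulrC -ler_pdivrMr // mul1r.
Unshelve. all: by end_near.
Qed.
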